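(* Consider the Schwarzschild spacetime with mass parameter $M$ in coordinates $(t,\bar r,\theta,\phi)$, with metric $$g=-\left(\frac{1-M/2\bar r}{1+M/2\bar r}\right)^2dt^2+\left(1+\frac{M}{2\bar r}\right)^4\left[d\bar r^2+\bar r^2\left(d\theta^2+\sin^2\theta\, d\phi^2\right)\right].$$ Let $W_{\alpha\beta\mu\nu}$ be a spin-2 field on this spacetime, and let $E_{ij}$ and $H_{ij}$ be its electric and magnetic parts with respect to the foliation by the slices $\Sigma_t=\{t=\mathrm{const}\}$. Then on each slice $\Sigma_t$ the three-dimensional covariant divergences vanish: $$E^i{}_{j|i}=0,\qquad H^i{}_{j|i}=0.$$ Consequently, for every conformal Killing vector field $X$ of the three-dimensional metric induced on $\Sigma_t$, $$(E^k{}_lX^l)_{|k}=0,\qquad (H^k{}_lX^l)_{|k}=0,$$ so the momentary charges fulfill the Gauss law without sources: for every three-dimensional volume $V\subset\Sigma_t$ with boundary $\partial V$ and outward unit normal $\nu$, $$\int_{\partial V}E_{ij}X^j\nu^i\,dS=0,\qquad \int_{\partial V}H_{ij}X^j\nu^i\,dS=0 .$$ That is, the value of a momentary charge does not depend on the choice of the closed integration surface: two closed surfaces $S_1,S_2\subset\Sigma_t$ give the same charge (with consistently oriented normals) if there exists a volume $V\subset\Sigma_t$ whose boundary is the sum of $S_1$ and $S_2$.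
   Context: A tensor field $W_{\alpha\beta\mu\nu}$ on a four-dimensional spacetime with metric $g$ of signature $(-,+,+,+)$ is called a spin-2 field if it satisfies the algebraic conditions $W_{\alpha\beta\mu\nu}=W_{\mu\nu\alpha\beta}=W_{[\alpha\beta][\mu\nu]}$, $W_{\alpha[\beta\mu\nu]}=0$, $g^{\alpha\mu}W_{\alpha\beta\mu\nu}=0$, and the differential condition $\nabla_{[\lambda}W_{\alpha\beta]\mu\nu}=0$, where $\nabla$ is the Levi-Civita connection of $g$ and square brackets denote antisymmetrization. Let $n^\mu$ be the unit normal (timelike) vector field to the foliation $\Sigma_t$. The electric part of $W$ is $E_{\alpha\beta}:=W_{\alpha\mu\nu\beta}n^\mu n^\nu$ and the magnetic part is $H_{\alpha\beta}:=W^*{}_{\alpha\mu\nu\beta}n^\mu n^\nu$, where $W^*{}_{\rho\sigma\mu\nu}:=\frac12W_{\rho\sigma\alpha\beta}\epsilon^{\alpha\beta}{}_{\mu\nu}$ and $\epsilon$ is the Levi-Civita tensor of $g$. Both are symmetric and traceless and satisfy $E_{\mu\nu}n^\mu=H_{\mu\nu}n^\mu=0$, so they are regarded as tensors $E_{ij},H_{ij}$ on $\Sigma_t$ (Latin indices are spatial). The vertical bar $|$ denotes the Levi-Civita covariant derivative of the three-dimensional metric induced on $\Sigma_t$, which is also used to raise and lower Latin indices. A conformal Killing vector field of a three-metric $g_{ij}$ is a vector field $X$ with $X_{(i|j)}=\lambda g_{ij}$ for some function $\lambda$; the metric induced on $\Sigma_t$ is conformally flat, so it has the same ten conformal Killing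 fields as flat three-dimensional space. The momentary charges are the flux integrals $\int_S E_{ij}X^j\nu^i\,dS$ and $\int_S H_{ij}X^j\nu^i\,dS$ over closed surfaces $S\subset\Sigma_t$ with unit normal $\nu$. *)

(* Defs.v *)
From HB Require Import structures.
From mathcomp Require Import all_boot all_order all_algebra ring.
From mathcomp Require Import all_classical all_reals all_analysis.
Set Implicit Arguments.
Unset Strict Implicit.
Unset Printing Implicit Defensive.
Import Order.TTheory GRing.Theory Num.Theory.
Import numFieldNormedType.Exports.
Local Open Scope classical_set_scope.
Local Open Scope ring_scope.

(** * Tensor calculus in a coordinate chart of R^n

    Tensor fields are given by their components, which are functions of the
    coordinate vector.  They are total functions; only their values on the
    coordinate domain are ever constrained. *)

Definition partial (R : realType) (n : nat) (i : 'I_n) (f : 'rV[R]_n -> R)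
    (x : 'rV[R]_n) : R :=
  'D_(delta_mx 0 i) f x.

Definition C1_on (R : realType) (n : nat) (U : set 'rV[R]_n)
    (f : 'rV[R]_n -> R) : Prop :=
  forall x, U x ->
    differentiable f x /\ forall i, {for x, continuous (partial i f)}.

Definition christoffel (R : realType) (n : nat) (g : 'rV[R]_n -> 'M[R]_n)
    (k i j : 'I_n) (x : 'rV[R]_n) : R :=
  2^-1 * \sum_l invmx (g x) k l *
    (partial i (fun y => g y j l) x + partial j (fun y => g y i l) x
     - partial l (fun y => g y i j) x).

(* X^i_{|k} *)
Definition cov_vector (R : realType) (n : nat) (g : 'rV[R]_n -> 'M[R]_n)
    (X : 'I_n -> 'rV[R]_n -> R) (k i : 'I_n) (x : 'rV[R]_n) : R :=
  partial k (X i) x + \sum_m christoffel g i k m x * X m x.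

(* X_{i|k} *)
Definition cov_covector (R : realType) (n : nat) (g : 'rV[R]_n -> 'M[R]_n)
    (X : 'I_n -> 'rV[R]_n -> R) (k i : 'I_n) (x : 'rV[R]_n) : R :=
  partial k (X i) x - \sum_m christoffel g m k i x * X m x.

(* T^i_{j|k} *)
Definition cov_mixed (R : realType) (n : nat) (g : 'rV[R]_n -> 'M[R]_n)
    (T : 'I_n -> 'I_n -> 'rV[R]_n -> R) (k i j : 'I_n) (x : 'rV[R]_n) : R :=
  partial k (T i j) x + \sum_m christoffel g i k m x * T m j x
  - \sum_m christoffel g m k j x * T i m x.

(* nabla_l W_{a b m v} *)
Definition cov_rank4 (R : realType) (n : nat) (g : 'rV[R]_n -> 'M[R]_n)
    (W : 'I_n -> 'I_n -> 'I_n -> 'I_n -> 'rV[R]_n -> R)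
    (l a b m v : 'I_n) (x : 'rV[R]_n) : R :=
  partial l (W a b m v) x
  - \sum_s christoffel g s l a x * W s b m v x
  - \sum_s christoffel g s l b x * W a s m v x
  - \sum_s christoffel g s l m x * W a b s v x
  - \sum_s christoffel g s l v x * W a b m s x.

Definition lower (R : realType) (n : nat) (g : 'rV[R]_n -> 'M[R]_n)
    (X : 'I_n -> 'rV[R]_n -> R) (i : 'I_n) (x : 'rV[R]_n) : R :=
  \sum_j g x i j * X j x.

(* T^i_j = g^{ik} T_{kj} *)
Definition raise_first (R : realType) (n : nat) (g : 'rV[R]_n -> 'M[R]_n)
    (T : 'I_n -> 'I_n -> 'rV[R]_n -> R) (i j : 'I_n) (x : 'rV[R]_n) : R :=
  \sum_k invmx (g x) i k * T k j x.

Definition div_mixed (R : realType) (n : nat) (g : 'rV[R]_n -> 'M[R]_n)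
    (T : 'I_n -> 'I_n -> 'rV[R]_n -> R) (j : 'I_n) (x : 'rV[R]_n) : R :=
  \sum_i cov_mixed g T i i j x.

Definition div_vector (R : realType) (n : nat) (g : 'rV[R]_n -> 'M[R]_n)
    (X : 'I_n -> 'rV[R]_n -> R) (x : 'rV[R]_n) : R :=
  \sum_i cov_vector g X i i x.

Definition conformal_killing (R : realType) (n : nat)
    (g : 'rV[R]_n -> 'M[R]_n) (U : set 'rV[R]_n)
    (X : 'I_n -> 'rV[R]_n -> R) : Prop :=
  (forall i, C1_on U (X i)) /\
  exists lambda : 'rV[R]_n -> R, forall x, U x -> forall i j : 'I_n,
    2^-1 * (cov_covector g (lower g X) j i x
            + cov_covector g (lower g X) i j x) = lambda x * g x i j.

(** * Spin-2 fields, electric and magnetic parts *)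

(* T_{[ab]}, T_{[abc]} *)
Definition antisym2 (R : realType) (I : Type) (T : I -> I -> R) (a b : I) : R :=
  2^-1 * (T a b - T b a).

Definition antisym3 (R : realType) (I : Type) (T : I -> I -> I -> R)
    (a b c : I) : R :=
  6^-1 * (T a b c + T b c a + T c a b - T b a c - T a c b - T c b a).

Definition spin2_field (R : realType) (g : 'rV[R]_4 -> 'M[R]_4)
    (U : set 'rV[R]_4)
    (W : 'I_4 -> 'I_4 -> 'I_4 -> 'I_4 -> 'rV[R]_4 -> R) : Prop :=
  (forall a b m v, C1_on U (W a b m v)) /\
  forall x, U x ->
    [/\ forall a b m v, W a b m v x = W m v a b x,
        forall a b m v, W a b m v x =
          antisym2 (fun a' b' => antisym2 (fun m' v' => W a' b' m' v' x) m v)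
            a b,
        forall a b m v, antisym3 (fun b' m' v' => W a b' m' v' x) b m v = 0,
        forall b v, \sum_a \sum_m invmx (g x) a m * W a b m v x = 0
      & forall l a b m v,
          antisym3 (fun l' a' b' => cov_rank4 g W l' a' b' m v x) l a b = 0].

(* The permutation symbol [a b c d], with [0 1 2 3] = 1: the determinant of the
   matrix whose rows are the unit vectors e_a, e_b, e_c, e_d. *)
Definition perm_symbol (R : realType) (a b c d : 'I_4) : R :=
  \det (\matrix_(i < 4, j < 4) (tnth [tuple a; b; c; d] i == j)%:R).

Definition levi_civita (R : realType) (g : 'rV[R]_4 -> 'M[R]_4)
    (a b c d : 'I_4) (x : 'rV[R]_4) : R :=
  Num.sqrt `|\det (g x)| * perm_symbol R a b c d.

(* W^*_{r s m v} = 1/2 W_{r s a b} eps^{a b}_{m v} *)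
Definition right_dual (R : realType) (g : 'rV[R]_4 -> 'M[R]_4)
    (W : 'I_4 -> 'I_4 -> 'I_4 -> 'I_4 -> 'rV[R]_4 -> R)
    (r s m v : 'I_4) (x : 'rV[R]_4) : R :=
  2^-1 * \sum_a \sum_b W r s a b x *
    (\sum_c \sum_d invmx (g x) a c * invmx (g x) b d
                   * levi_civita g c d m v x).

Definition electric (R : realType)
    (W : 'I_4 -> 'I_4 -> 'I_4 -> 'I_4 -> 'rV[R]_4 -> R)
    (n : 'I_4 -> 'rV[R]_4 -> R) (a b : 'I_4) (x : 'rV[R]_4) : R :=
  \sum_m \sum_v W a m v b x * n m x * n v x.

Definition magnetic (R : realType) (g : 'rV[R]_4 -> 'M[R]_4)
    (W : 'I_4 -> 'I_4 -> 'I_4 -> 'I_4 -> 'rV[R]_4 -> R)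
    (n : 'I_4 -> 'rV[R]_4 -> R) : 'I_4 -> 'I_4 -> 'rV[R]_4 -> R :=
  electric (right_dual g W) n.

(** * The foliation by the slices t = const

    Coordinate 0 is t; the spatial index i : 'I_3 is the spacetime index
    lift ord0 i. *)

Definition event (R : realType) (t : R) (x : 'rV[R]_3) : 'rV[R]_4 :=
  \row_(m < 4) (if unlift ord0 m is Some i then x 0 i else t).

Definition space_part (R : realType) (p : 'rV[R]_4) : 'rV[R]_3 :=
  \row_i p 0 (lift ord0 i).

Definition induced_metric (R : realType) (g : 'rV[R]_4 -> 'M[R]_4) (t : R)
    (x : 'rV[R]_3) : 'M[R]_3 :=
  \matrix_(i, j) g (event t x) (lift ord0 i) (lift ord0 j).

Definition on_slice (R : realType) (t : R)
    (T : 'I_4 -> 'I_4 -> 'rV[R]_4 -> R) (i j : 'I_3) (x : 'rV[R]_3) : R :=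
  T (lift ord0 i) (lift ord0 j) (event t x).

(* g(n, n) = -1 and n is orthogonal to the slices.  This fixes n up to a sign,
   which drops out of the electric and magnetic parts. *)
Definition unit_normal_to_slices (R : realType) (g : 'rV[R]_4 -> 'M[R]_4)
    (U : set 'rV[R]_4) (n : 'I_4 -> 'rV[R]_4 -> R) : Prop :=
  forall p, U p ->
    \sum_a \sum_b g p a b * n a p * n b p = -1 /\
    forall i : 'I_3, \sum_a g p a (lift ord0 i) * n a p = 0.

(** * Schwarzschild spacetime in isotropic coordinates

    The slices are not covered by one spherical chart (rbar, theta, phi), so
    the Cartesian coordinates x = rbar * (sin theta cos phi, sin theta sin phi,
    cos theta) are used; lemma schwarzschild_spherical recovers the spherical
    form of the metric. *)

Definition rbar (R : realType) (x : 'rV[R]_3) : R :=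
  Num.sqrt (\sum_i x 0 i ^+ 2).

(* The largest set of spatial points on which the coordinate expression defines
   a Lorentz metric.  For M > 0 it is rbar > 0 with rbar != M / 2, that is, the
   two sides of the horizon sphere rbar = M / 2, where the lapse vanishes. *)
Definition Sigma (R : realType) (M : R) : set 'rV[R]_3 :=
  [set x | [/\ 0 < rbar x, 1 + M / (2 * rbar x) != 0
             & 1 - M / (2 * rbar x) != 0]].

Definition spacetime (R : realType) (M : R) : set 'rV[R]_4 :=
  [set p | Sigma M (space_part p)].

Definition schwarzschild (R : realType) (M : R) (p : 'rV[R]_4) : 'M[R]_4 :=
  let r := rbar (space_part p) in
  \matrix_(a, b)
    if a == b then
      if a == 0 then - ((1 - M / (2 * r)) / (1 + M / (2 * r))) ^+ 2
      else (1 + M / (2 * r)) ^+ 4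
    else 0.

(* The spherical coordinates (t, rbar, theta, phi). *)
Definition spherical (R : realType) (q : 'rV[R]_4) : 'rV[R]_4 :=
  event (q 0 0) (\row_(i < 3)
    tnth [tuple q 0 1 * sin (q 0 2) * cos (q 0 3);
                q 0 1 * sin (q 0 2) * sin (q 0 3);
                q 0 1 * cos (q 0 2)] i).

Lemma is_derive_coord (R : realType) n (f : R -> R) (df : R) (i j : 'I_n)
    (q : 'rV[R]_n) : is_derive (q 0 j) (1:R) f df ->
  is_derive q (delta_mx 0 i) (fun p : 'rV[R]_n => f (p 0 j)) ((j == i)%:R * df).
Proof.
move=> [fd fE].
have dc : differentiable (fun p : 'rV[R]_n => p 0 j) q.
  exact: differentiable_coord.
have df' : differentiable f (q 0 j) by apply/derivable1_diffP.
have dfc : differentiable (fun p : 'rV[R]_n => f (p 0 j)) q.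
  exact: (@differentiable_comp _ _ _ _ (fun p : 'rV[R]_n => p 0 j) f).
split; first exact: diff_derivable.
rewrite deriveE // (@diff_comp _ _ _ _ (fun p : 'rV[R]_n => p 0 j) f) //=.
rewrite diff1E // derive1E fE; congr (_ * _).
have @c : {linear 'rV[R]_n -> R}.
  by exists (fun p : 'rV[R]_n => p 0 j); do 2![eexists]; do ?[constructor];
     rewrite ?mxE// => ? *; rewrite ?mxE//; move=> ?; rewrite !mxE.
rewrite (_ : (fun _ => _) = c) // diff_lin; last exact: coord_continuous.
by rewrite /= mxE eqxx.
Qed.

Definition spherical_jacobian (R : realType) (q : 'rV[R]_4) : 'M[R]_4 :=
  let r := q 0 1 in let th := q 0 2 in let ph := q 0 3 in
  \matrix_(m < 4, a < 4) tnth (tnth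
   [tuple [tuple 1; 0; 0; 0];
          [tuple 0; sin th * cos ph; r * (cos th * cos ph); - (r * (sin th * sin ph))];
          [tuple 0; sin th * sin ph; r * (cos th * sin ph); r * (sin th * cos ph)];
          [tuple 0; cos th; - (r * sin th); 0]] m) a.

Lemma partial_spherical (R : realType) (q : 'rV[R]_4) (m a : 'I_4) :
  partial a (fun p => spherical p 0 m) q = spherical_jacobian q m a.
Proof.
have D0 k : is_derive q (delta_mx 0 a) (fun p : 'rV[R]_4 => p 0 k) ((k == a)%:R).
  rewrite -[_%:R]mulr1; exact: is_derive_coord.
have Ds k := @is_derive_coord _ _ _ _ a k q (is_derive_sin (q 0 k)).
have Dc k := @is_derive_coord _ _ _ _ a k q (is_derive_cos (q 0 k)).
rewrite /partial /spherical_jacobian mxE.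
case: m => [[|[|[|[|//]]]] lm].
- have -> : (fun p : 'rV[R]_4 => spherical p 0 (Ordinal lm)) = (fun p => p 0 0).
    apply/funext => p; rewrite /spherical /event mxE.
    by case: unliftP => // j /(congr1 val).
  rewrite (derive_val (is_derive := D0 0)).
  by case: a {D0 Ds Dc} => [[|[|[|[|//]]]] la].
- have -> : (fun p : 'rV[R]_4 => spherical p 0 (Ordinal lm)) =
    (fun p => p 0 1) * (fun p => sin (p 0 2)) * (fun p => cos (p 0 3)).
    apply/funext => p; rewrite /spherical /event mxE.
    case: unliftP => [j /(congr1 val)/= []|/(congr1 val)//].
    by case: j => [[|[|[|//]]] lj] //= _; rewrite mxE.
  rewrite (derive_val (is_derive := is_deriveM (is_deriveM (D0 1) (Ds 2)) (Dc 3))).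
  rewrite ?fctE /GRing.scale /=.
  by case: a {D0 Ds Dc} => [[|[|[|[|//]]]] la]; rewrite /tnth /=; ring.
- have -> : (fun p : 'rV[R]_4 => spherical p 0 (Ordinal lm)) =
    (fun p => p 0 1) * (fun p => sin (p 0 2)) * (fun p => sin (p 0 3)).
    apply/funext => p; rewrite /spherical /event mxE.
    case: unliftP => [j /(congr1 val)/= []|/(congr1 val)//].
    by case: j => [[|[|[|//]]] lj] //= _; rewrite mxE.
  rewrite (derive_val (is_derive := is_deriveM (is_deriveM (D0 1) (Ds 2)) (Ds 3))).
  rewrite ?fctE /GRing.scale /=.
  by case: a {D0 Ds Dc} => [[|[|[|[|//]]]] la]; rewrite /tnth /=; ring.
- have -> : (fun p : 'rV[R]_4 => spherical p 0 (Ordinal lm)) =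
    (fun p => p 0 1) * (fun p => cos (p 0 2)).
    apply/funext => p; rewrite /spherical /event mxE.
    case: unliftP => [j /(congr1 val)/= []|/(congr1 val)//].
    by case: j => [[|[|[|//]]] lj] //= _; rewrite mxE.
  rewrite (derive_val (is_derive := is_deriveM (D0 1) (Dc 2))).
  rewrite ?fctE /GRing.scale /=.
  by case: a {D0 Ds Dc} => [[|[|[|[|//]]]] la]; rewrite /tnth /=; ring.
Qed.

Lemma rbar_spherical (R : realType) (q : 'rV[R]_4) : 0 < q 0 1 ->
  rbar (space_part (spherical q)) = q 0 1.
Proof.
move=> r0; rewrite /rbar !big_ord_recl big_ord0 /space_part /spherical /event.
rewrite !mxE !liftK !mxE /tnth /= addr0.
set s := sin (q 0 2); set c := cos (q 0 2).
set s' := sin (q 0 3); set c' := cos (q 0 3).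
have H : c ^+ 2 = 1 - s ^+ 2 by apply: cos2sin2.
have H' : c' ^+ 2 = 1 - s' ^+ 2 by apply: cos2sin2.
rewrite (_ : _ + _ = q 0 1 ^+ 2) ?sqrtr_sqr ?gtr0_norm //.
by rewrite !exprMn H H'; ring.
Qed.

(* The pull back of the metric to spherical coordinates. *)
Lemma schwarzschild_spherical (R : realType) (M : R) (q : 'rV[R]_4)
    (a b : 'I_4) : 0 < q 0 1 ->
  let r := q 0 1 in
  \sum_m \sum_v schwarzschild M (spherical q) m v
      * partial a (fun p => spherical p 0 m) q
      * partial b (fun p => spherical p 0 v) q =
  if a == b then
    tnth [tuple - ((1 - M / (2 * r)) / (1 + M / (2 * r))) ^+ 2;
                (1 + M / (2 * r)) ^+ 4;
                (1 + M / (2 * r)) ^+ 4 * r ^+ 2;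
                (1 + M / (2 * r)) ^+ 4 * (r ^+ 2 * sin (q 0 2) ^+ 2)] a
  else 0.
Proof.
move=> r0 r.
under eq_bigr => m _ do under eq_bigr => v _ do rewrite !partial_spherical.
rewrite /schwarzschild (rbar_spherical r0) -/r.
set N := - _ ^+ 2; set psi := (1 + _) ^+ 4.
rewrite !big_ord_recl !big_ord0 !mxE /= /spherical_jacobian /= -/r.
set s := sin (q 0 2); set c := cos (q 0 2).
set s' := sin (q 0 3); set c' := cos (q 0 3).
have H : c ^+ 2 = 1 - s ^+ 2 by apply: cos2sin2.
have H' : c' ^+ 2 = 1 - s' ^+ 2 by apply: cos2sin2.
case: a => [[|[|[|[|//]]]] la]; case: b => [[|[|[|[|//]]]] lb]; rewrite /tnth /=; try ring.
all: ring: H H'.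
Qed.

(** * Surfaces and surface integrals in R^3 *)

(* A box together with a graph in the direction of one coordinate axis: the
   remaining two coordinates are the parameters. *)
Record graph_chart (R : realType) := GraphChart {
  axis : 'I_3;
  lo : 'rV[R]_3;
  hi : 'rV[R]_3;
  height : 'rV[R]_2 -> R }.

Definition box (R : realType) (c : graph_chart R) : set 'rV[R]_3 :=
  [set x | forall i, lo c 0 i < x 0 i < hi c 0 i].

Definition base (R : realType) (c : graph_chart R) : set 'rV[R]_2 :=
  [set y | forall k : 'I_2,
     lo c 0 (lift (axis c) k) < y 0 k < hi c 0 (lift (axis c) k)].

Definition params (R : realType) (c : graph_chart R) (x : 'rV[R]_3) :
    'rV[R]_2 :=
  \row_(k < 2) x 0 (lift (axis c) k).

Definition graph_point (R : realType) (c : graph_chart R) (y : 'rV[R]_2) :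
    'rV[R]_3 :=
  \row_(i < 3) (if unlift (axis c) i is Some k then y 0 k else height c y).

Definition C1_graph_chart (R : realType) (c : graph_chart R) : Prop :=
  C1_on (base c) (height c) /\ forall y, base c y -> box c (graph_point c y).

(* Inside the box of c, the surface S is the graph. *)
Definition surface_chart (R : realType) (S : set 'rV[R]_3)
    (c : graph_chart R) : Prop :=
  C1_graph_chart c /\
  forall x, box c x -> (S x <-> x 0 (axis c) = height c (params c x)).

Definition closed_surface (R : realType) (S : set 'rV[R]_3) : Prop :=
  compact S /\ forall x, S x -> exists2 c, surface_chart S c & box c x.

(* The surface element of the parametrized surface graph_point c with respect to the
   metric h: the square root of the determinant of the pulled back metric. *)
Definition surface_element (R : realType) (h : 'rV[R]_3 -> 'M[R]_3)
    (c : graph_chart R) (y : 'rV[R]_2) : R :=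
  Num.sqrt (\det (\matrix_(k < 2, l < 2) \sum_i \sum_j
    h (graph_point c y) i j * partial k (fun z => graph_point c z 0 i) y
                      * partial l (fun z => graph_point c z 0 j) y)).

Definition point2 (R : realType) (z : R * R) : 'rV[R]_2 :=
  \row_(k < 2) (if k == 0 then z.1 else z.2).

Definition chart_integral (R : realType) (h : 'rV[R]_3 -> 'M[R]_3)
    (c : graph_chart R) (f : 'rV[R]_3 -> R) : R :=
  Rintegral ((@lebesgue_measure R) \x (@lebesgue_measure R))%E
    (@point2 R @^-1` base c)
    (fun z => f (graph_point c (point2 z)) * surface_element h c (point2 z)).

Record weighted_charts (R : realType) := WeightedCharts {
  nb_charts : nat;
  chart : 'I_nb_charts -> graph_chart R;
  weight : 'I_nb_charts -> 'rV[R]_3 -> R }.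

(* A finite family of charts of S with a subordinate C^1 partition of unity. *)
Definition partition_of_unity (R : realType) (S : set 'rV[R]_3)
    (A : weighted_charts R) : Prop :=
  (forall k : 'I_(nb_charts A),
     [/\ surface_chart S (chart k),
         C1_on setT (weight k),
         forall x, 0 <= weight k x
       & exists K, [/\ compact K, K `<=` box (chart k)
                     & forall x, ~ K x -> weight k x = 0]]) /\
  forall x, S x -> \sum_k weight (w := A) k x = 1.

(* The integral over the compact surface S of f with respect to the surface
   element of h equals I: a partition of unity exists, and every one of them
   gives the value I. *)
Definition is_surface_integral (R : realType) (h : 'rV[R]_3 -> 'M[R]_3)
    (S : set 'rV[R]_3) (f : 'rV[R]_3 -> R) (I : R) : Prop :=
  (exists A, partition_of_unity S A) /\
  forall A, partition_of_unity S A ->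
    \sum_k chart_integral h (chart k) (fun x => weight (w := A) k x * f x) = I.

(** * Volumes, their boundary and the outward normal *)

Definition frontier (R : realType) (V : set 'rV[R]_3) : set 'rV[R]_3 :=
  closure V `\` V°.

(* A compact domain with C^1 boundary, lying locally on one side of it. *)
Definition volume (R : realType) (V : set 'rV[R]_3) : Prop :=
  compact V /\
  forall x, frontier V x -> exists c : graph_chart R,
    [/\ C1_graph_chart c, box c x
      & (forall y, box c y -> (V y <-> y 0 (axis c) <= height c (params c y)))
        \/
        (forall y, box c y -> (V y <-> height c (params c y) <= y 0 (axis c)))].

(* The velocities at x of the curves in S through x. *)
Definition tangent_vector (R : realType) (S : set 'rV[R]_3) (x u : 'rV[R]_3) :
    Prop :=
  exists gamma : R -> 'rV[R]_3,
    [/\ gamma 0 = x, \forall s \near (0 : R), S (gamma s)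
      & is_derive (0 : R) (1 : R) gamma u].

Definition inner (R : realType) (h : 'rV[R]_3 -> 'M[R]_3) (x u v : 'rV[R]_3) :
    R :=
  \sum_i \sum_j h x i j * u 0 i * v 0 j.

(* nu is the outward unit normal of V at the boundary point x. *)
Definition outward_unit_normal (R : realType) (h : 'rV[R]_3 -> 'M[R]_3)
    (V : set 'rV[R]_3) (x nu : 'rV[R]_3) : Prop :=
  [/\ inner h x nu nu = 1,
      forall u, tangent_vector (frontier V) x u -> inner h x nu u = 0
    & \forall s \near (0 : R)^'+, ~ V (x + s *: nu)].

(* T_{ij} X^j nu^i *)
Definition flux_density (R : realType) (T : 'I_3 -> 'I_3 -> 'rV[R]_3 -> R)
    (X : 'I_3 -> 'rV[R]_3 -> R) (nu : 'rV[R]_3 -> 'rV[R]_3) (x : 'rV[R]_3) :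
    R :=
  \sum_i \sum_j T i j x * X j x * nu x 0 i.

(* T^k_l X^l *)
Definition current (R : realType) (h : 'rV[R]_3 -> 'M[R]_3)
    (T : 'I_3 -> 'I_3 -> 'rV[R]_3 -> R) (X : 'I_3 -> 'rV[R]_3 -> R)
    (k : 'I_3) (x : 'rV[R]_3) : R :=
  \sum_l raise_first h T k l x * X l x.

Definition gauss_law (R : realType) (h : 'rV[R]_3 -> 'M[R]_3)
    (U : set 'rV[R]_3) (T : 'I_3 -> 'I_3 -> 'rV[R]_3 -> R)
    (X : 'I_3 -> 'rV[R]_3 -> R) : Prop :=
  forall (V : set 'rV[R]_3) (nu : 'rV[R]_3 -> 'rV[R]_3),
    volume V -> V `<=` U ->
    (forall x, frontier V x -> outward_unit_normal h V x (nu x)) ->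
    is_surface_integral h (frontier V) (flux_density T X nu) 0.

(* The normals nu1, nu2 are consistently oriented: relative to V, nu2 points
   outward on S2 and nu1 points inward on S1. *)
Definition surface_independence (R : realType) (h : 'rV[R]_3 -> 'M[R]_3)
    (U : set 'rV[R]_3) (T : 'I_3 -> 'I_3 -> 'rV[R]_3 -> R)
    (X : 'I_3 -> 'rV[R]_3 -> R) : Prop :=
  forall (S1 S2 V : set 'rV[R]_3) (nu1 nu2 : 'rV[R]_3 -> 'rV[R]_3),
    closed_surface S1 -> closed_surface S2 ->
    volume V -> V `<=` U ->
    frontier V = S1 `|` S2 -> S1 `&` S2 = set0 ->
    (forall x, S1 x -> outward_unit_normal h V x (- nu1 x)) ->
    (forall x, S2 x -> outward_unit_normal h V x (nu2 x)) ->
    exists Q : R,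
      is_surface_integral h S1 (flux_density T X nu1) Q /\
      is_surface_integral h S2 (flux_density T X nu2) Q.

(* Main.v *)
Require Import Defs.
From mathcomp Require Import all_boot all_order all_algebra fingroup perm ring lra.
From mathcomp Require Import all_classical all_reals all_analysis measurable_realfun.
Set Implicit Arguments.
Unset Strict Implicit.
Unset Printing Implicit Defensive.
Import Order.TTheory GRing.Theory Num.Theory.
Import numFieldNormedType.Exports.
Local Open Scope classical_set_scope.
Local Open Scope ring_scope.

(** In isotropic coordinates the slice metric is [p ^ 2] times the flat metric,
    and the lapse [N] depends on the position only.  Contracting the Bianchi
    identity and using the algebraic symmetries of [W], the tensors
    [W_{i00j}] and [W_{i0 j+1 j+2}], which are [E] and [H] up to powers of
    [N] and [p], have vanishing covariant divergence: these powers absorb the connection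
    terms that involve the gradients of [N] and [p].
    For symmetric traceless [E], [E^k_l X^l] is then divergence free as soon as
    [X] is conformal Killing.

    The flux density times the area element is the Euclidean flux of
    [F_i = p E_{ij} X^j], and [div F = 0].  The divergence theorem for [C^1]
    domains is obtained from a [C^1] partition of unity, from a shear
    straightening the boundary inside a chart, and from Fubini.  Surface
    independence applies it with charts of one surface refined so as to avoid
    the other one. *)

(** A surface integral is defined through all partitions of unity, and its invariance under a change
    of partition is never proved for its own sake: the flux through a frontier is computed to be 0
    for every partition, and two partitions of [S1] give the same value because both are compared
    with one partition of [S2]. A chart of such a partition describes the surface but not the
    position of the volume; that the volume lies on one side of it has to be deduced by a
    connectedness argument. The height of a chart is only C^1, so its gradient cannot be
    differentiated again after the shear. Along a fibre in the axis direction this gradient is a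
    constant, which is why the integration along the axis comes first. The factor p in F comes from
    the volume density p^3: raising an index of E divides by p^2, so p E_ij X^j is p^3 times the
    current, and the Euclidean divergence of this density is p^3 times the covariant divergence of
    the current. *)

Lemma nbhs_rV_ball (R : realType) n (x : 'rV[R]_n) (A : set 'rV[R]_n) :
  nbhs x A <-> exists2 e : R, 0 < e &
    forall y : 'rV[R]_n, (forall i, `|x 0 i - y 0 i| < e) -> A y.
Proof.
split.
  move=> /nbhs_ballP[e /= e0 sA]; exists e => // y xy; apply: (sA y).
  by split=> // i j; rewrite ord1; exact: xy.
move=> [e e0 sA]; apply/nbhs_ballP; exists e => //= y [_ xy]; apply: sA => i.
exact: xy.
Qed.

(** An open set is the union of the rational cubes contained in it, of which there are countably
    many; lying in one cube is a finite conjunction of measurable conditions on the coordinates. *)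
Lemma measurable_row_open (R : realType) n (d : measure_display)
    (T : measurableType d) (u : 'I_n -> T -> R) (U : set 'rV[R]_n) :
  (forall i, measurable_fun setT (u i)) -> open U ->
  measurable [set t | U (\row_i u i t)].
Proof.
move=> mu oU.
pose q (k : 'rV[rat]_n) (i : 'I_n) : R := ratr (k 0 i).
pose B (k : 'rV[rat]_n * rat) : set 'rV[R]_n :=
  [set x | forall i, `|q k.1 i - x 0 i| < ratr k.2].
have UE : [set t | U (\row_i u i t)] =
   \bigcup_(k in [set k | B k `<=` U]) [set t | B k (\row_i u i t)].
  apply/seteqP; split => [t /= Ut|t [k /= kU Bt]]; last exact: kU.
  have /nbhs_rV_ball[e e0 sU] : nbhs (\row_i u i t) U by exact: open_nbhs_nbhs.
  have [r /andP[r0 re]] : exists r : rat, 0 < (ratr r : R) < e / 2.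
    have /rat_in_itvoo[r] : 0 < e / 2 by rewrite divr_gt0.
    by rewrite in_itv/= => ?; exists r.
  (* The rational centre is chosen within [ratr r] of the point, so the cube of radius [ratr r]
     around it contains the point and stays within [2 * ratr r < e] of it. *)
  have /choice[k kP] (i : 'I_n) : exists k : rat, `|ratr k - u i t| < ratr r.
    have /rat_in_itvoo[k] : u i t - ratr r < u i t + ratr r by rewrite -subr_gt0; lra.
    by rewrite in_itv/= => ?; exists k; rewrite ltr_distlC addrC; lra.
  exists (\row_i k i, r) => /=; last by move=> i; rewrite /q /= !mxE; exact: kP.
  move=> y By; apply: sU => i; rewrite mxE.
  have := By i; have := kP i; rewrite /q /= mxE => h1 h2.
  have -> : u i t - y 0 i = - (ratr (k i) - u i t) + (ratr (k i) - y 0 i) by ring.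
  by rewrite (le_lt_trans (ler_normD _ _))// normrN; lra.
rewrite UE bigcup_mkcond; apply: countable_bigcupT_measurable => // k.
case: ifP => // _.
rewrite [X in measurable X](_ : _ = \bigcap_(i in [set: 'I_n]) (u i @^-1` (ball (q k.1 i) (ratr k.2)))).
  apply: fin_bigcap_measurable => // i _.
  rewrite -[X in measurable X]setTI; apply: mu => //.
  exact: measurable_ball.
by apply/seteqP; split => [t /= h i _ |t /= h i]; have := h i; rewrite mxE => //; exact.
Qed.

Lemma measurable_row_continuous (R : realType) n (d : measure_display)
    (T : measurableType d) (u : 'I_n -> T -> R) (g : 'rV[R]_n -> R) :
  (forall i, measurable_fun setT (u i)) -> continuous g ->
  measurable_fun setT (fun t => g (\row_i u i t)).
Proof.
move=> mu /continuousP cg; apply: (measurability _ (RGenOInfty.measurableE R)).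
move=> _ [_ [a ->]] <-; rewrite setTI.
apply: (@measurable_row_open R n d T u (g @^-1` `]a, +oo[)) => //.
by apply: cg; exact: interval_open.
Qed.

Lemma measurable_row_closed (R : realType) n (d : measure_display)
    (T : measurableType d) (u : 'I_n -> T -> R) (U : set 'rV[R]_n) :
  (forall i, measurable_fun setT (u i)) -> closed U ->
  measurable [set t | U (\row_i u i t)].
Proof.
move=> mu cU; rewrite -[X in measurable X]setCK; apply: measurableC.
rewrite [X in measurable X](_ : _ = [set t | (~` U) (\row_i u i t)]) //.
by apply: measurable_row_open => //; rewrite openC.
Qed.

(** * Bounded measurable functions with bounded support *)

Lemma Rintegrable_bounded (R : realType) (d : measure_display)
    (T : measurableType d) (mu : {measure set T -> \bar R}) (D : set T)
    (f : T -> R) (c : R) :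
  measurable D -> (mu D < +oo)%E -> measurable_fun setT f ->
  (forall x, `|f x| <= c) -> (forall x, ~ D x -> f x = 0) ->
  mu.-integrable setT (EFin \o f).
Proof.
move=> mD muD mf fc fD.
rewrite (_ : EFin \o f = (EFin \o f) \_ D); last first.
  apply/funext => x; rewrite patchE; case: ifPn => // /negP xD.
  by rewrite /= fD // => Dx; apply: xD; exact: mem_set.
apply/(integrable_mkcond _ mD); apply: measurable_bounded_integrable => //.
  exact: measurable_funTS.
exists `|c|; split; first by rewrite num_real.
move=> r cr x _ /=; apply: (le_trans (fc x)).
by rewrite (le_trans (ler_norm _)) // ltW.
Qed.

(* Bounded, boundedly supported and measurable.  For several variables
   measurability is stated through substitutions, which makes it stable under
   permuting and fixing arguments and needs no sigma-algebra on ['rV[R]_n]. *)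
Definition cbm1 (R : realType) (g : R -> R) : Prop :=
  measurable_fun setT g /\
  exists c : R, forall x, `|g x| <= c /\ (g x != 0 -> `|x| <= c).

Definition cbm2 (R : realType) (g : R -> R -> R) : Prop :=
  (forall d (T : measurableType d) (u v : T -> R),
     measurable_fun setT u -> measurable_fun setT v ->
     measurable_fun setT (fun t => g (u t) (v t))) /\
  exists c : R, forall x y, `|g x y| <= c /\
    (g x y != 0 -> `|x| <= c /\ `|y| <= c).

Definition cbm3 (R : realType) (g : R -> R -> R -> R) : Prop :=
  (forall d (T : measurableType d) (u v w : T -> R),
     measurable_fun setT u -> measurable_fun setT v -> measurable_fun setT w ->
     measurable_fun setT (fun t => g (u t) (v t) (w t))) /\
  exists c : R, forall x y z, `|g x y z| <= c /\
    (g x y z != 0 -> [/\ `|x| <= c, `|y| <= c & `|z| <= c]).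

Lemma product_measure_lty (R : realType) d1 d2 (T1 : measurableType d1)
    (T2 : measurableType d2) (m1 : {measure set T1 -> \bar R})
    (m2 : {sigma_finite_measure set T2 -> \bar R}) (A : set T1) (B : set T2) :
  measurable A -> measurable B -> (m1 A < +oo)%E -> (m2 B < +oo)%E ->
  ((m1 \x m2) (A `*` B) < +oo)%E.
Proof.
move=> mA mB Aoo Boo; rewrite product_measure1E //; apply: lte_mul_pinfty => //.
by rewrite ge0_fin_numE.
Qed.

(** * Iterated integrals and Fubini for functions of two and three variables *)

Section iterated_integrals.
Context (R : realType).
Local Notation mu := (@lebesgue_measure R).

Lemma lebesgue_measure_sym_itv (c : R) : (mu `[(- c)%R, c] < +oo)%E.
Proof. by rewrite lebesgue_measure_itv /=; case: ifPn => // _; rewrite -EFinB ltry. Qed.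

Lemma integrable_cbm1 (g : R -> R) : cbm1 g -> mu.-integrable setT (EFin \o g).
Proof.
move=> [mg [c gc]]; apply: (@Rintegrable_bounded _ _ _ mu `[- c, c] g c) => //.
- exact: lebesgue_measure_sym_itv.
- by move=> x; have [] := gc x.
- move=> x; apply: contra_notP => /eqP /((gc x).2); rewrite ler_norml.
  by rewrite /= in_itv.
Qed.

Lemma cbm2_l (g : R -> R -> R) x : cbm2 g -> cbm1 (g x).
Proof.
move=> [mg [c gc]]; split; first by apply: mg => //; exact: measurable_id.
by exists c => y; have [? h] := gc x y; split => // /h[].
Qed.

Lemma cbm2_swap (g : R -> R -> R) : cbm2 g -> cbm2 (fun x y => g y x).
Proof.
move=> [mg [c gc]]; split=> [d T u v mu_ mv|]; first exact: mg.
by exists c => x y; have [? h] := gc y x; split => // /h[].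
Qed.

Lemma cbm3_l (g : R -> R -> R -> R) x : cbm3 g -> cbm2 (g x).
Proof.
move=> [mg [c gc]]; split => [d T u v mu_ mv|]; first by apply: mg.
by exists c => y z; have [? h] := gc x y z; split => // /h[].
Qed.

Lemma integrable_cbm2 (g : R -> R -> R) : cbm2 g ->
  (mu \x mu)%E.-integrable setT (fun p => (g p.1 p.2)%:E).
Proof.
move=> [mg [c gc]].
apply: (@Rintegrable_bounded _ _ _ (mu \x mu)%E (`[- c, c] `*` `[- c, c])
  (fun p => g p.1 p.2) c).
- exact: measurableX.
- by apply: product_measure_lty => //; exact: lebesgue_measure_sym_itv.
- by apply: mg; [exact: measurable_fst|exact: measurable_snd].
- by move=> [x y] /=; have [] := gc x y.
- move=> [x y] /=; apply: contra_notP => /eqP /((gc x y).2) [].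
  by rewrite !ler_norml !in_itv.
Qed.

Lemma cbm2_Rintegral_prod (g : R -> R -> R) : cbm2 g ->
  Rintegral (mu \x mu)%E setT (fun p => g p.1 p.2) =
  \int[mu]_x \int[mu]_y g x y.
Proof.
move=> cg; rewrite {1}/Rintegral -integral12_prod_meas1; last first.
  exact: integrable_cbm2.
congr fine; apply: eq_integral => x _; rewrite /Rintegral fineK //.
by apply: integrable_fin_num => //; exact: integrable_cbm1 (cbm2_l _ _).
Qed.

Lemma cbm2_Fubini (g : R -> R -> R) : cbm2 g ->
  \int[mu]_x \int[mu]_y g x y = \int[mu]_y \int[mu]_x g x y.
Proof.
move=> cg; rewrite -cbm2_Rintegral_prod // {1}/Rintegral.
rewrite -integral21_prod_meas1; last exact: integrable_cbm2.
congr fine; apply: eq_integral => x _; rewrite /Rintegral fineK //.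
by apply: integrable_fin_num => //; exact: integrable_cbm1 (cbm2_l _ (cbm2_swap cg)).
Qed.

(** Height [c] times the length of [[- c, c]]. The explicit bound makes [cbm3_int] uniform in the
    remaining variables. *)
Lemma normr_Rintegral_cbm1 (g : R -> R) (c : R) : 0 <= c -> measurable_fun setT g ->
  (forall x, `|g x| <= c /\ (g x != 0 -> `|x| <= c)) ->
  `|\int[mu]_x g x| <= c * (2 * c).
Proof.
move=> c0 mg gc.
have cg : cbm1 g by split => //; exists c.
have gE : g = g \_ `[- c, c].
  apply/funext => x; rewrite patchE; case: ifPn => // /negP xD.
  apply/eqP/negP => /negP /((gc x).2) xc; apply: xD; apply: mem_set.
  by rewrite /= in_itv /= -ler_norml.
rewrite gE -Rintegral_mkcond.
have ig : mu.-integrable `[- c, c] (EFin \o g).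
  by apply: integrableS (integrable_cbm1 cg).
rewrite (le_trans (le_normr_Rintegral _ _)) //.
apply: (@le_trans _ _ (\int[mu]_(x in `[- c, c]) c)).
  apply: le_Rintegral => //.
  - exact: integrable_norm.
  - apply: measurable_bounded_integrable => //.
      exact: lebesgue_measure_sym_itv.
    exact: bounded_cst.
  - by move=> x _; have [] := gc x.
rewrite Rintegral_cst //= lebesgue_measure_itv /= lte_fin.
apply: ler_wpM2l => //; case: (- c < c) => /=; last by rewrite mulr_ge0.
by rewrite opprK mulr_natl mulr2n.
Qed.

(** Tonelli's theorem applied separately to the positive and the negative part. *)
Lemma measurable_fun_Rintegral d (T : measurableType d) (f : T * R -> R) :
  measurable_fun setT f -> measurable_fun setT (fun t => \int[mu]_z f (t, z)).
Proof.
move=> /measurable_EFinP mf; apply: (measurableT_comp (fine_measurable measurableT)).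
rewrite (_ : (fun _ => _) = (fun t => \int[mu]_z (EFin \o f)^\+ (t, z))%E \-
   (fun t => \int[mu]_z (EFin \o f)^\- (t, z))%E)%E.
  apply: emeasurable_funB.
    by apply: measurable_fun_fubini_tonelli_F => //; exact: measurable_funepos.
  by apply: measurable_fun_fubini_tonelli_F => //; exact: measurable_funeneg.
apply/funext => t; rewrite [LHS]integralE.
by congr (_ - _)%E; apply: eq_integral => z _; rewrite ?funeposE ?funenegE.
Qed.

Lemma cbm3_int (g : R -> R -> R -> R) : cbm3 g ->
  cbm2 (fun x y => \int[mu]_z g x y z).
Proof.
move=> [mg [c gc]].
have c0 : 0 <= c by have [h _] := gc 0 0 0; exact: le_trans h.
split.
  move=> d T u v mu_ mv.
  apply: (@measurable_fun_Rintegral _ _ (fun p : T * R => g (u p.1) (v p.1) p.2)).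
  apply: mg; last exact: measurable_snd.
    by apply: measurableT_comp => //; exact: measurable_fst.
  by apply: measurableT_comp => //; exact: measurable_fst.
exists (Num.max c (c * (2 * c))) => x y; split.
  rewrite le_max normr_Rintegral_cbm1 ?orbT //.
    exact: (cbm2_l _ (cbm3_l _ (conj mg (ex_intro _ c gc)))).1.
  by move=> z; have [? h] := gc x y z; split => // /h[].
(* A nonzero integral forces a nonzero value of the integrand for some [z], and the support bound at
   that point controls [x] and [y]. *)
move=> h; have [z gz] : exists z, g x y z != 0.
  apply: contrapT => /forallNP g0; move: h => /eqP; apply.
  rewrite (_ : g x y = cst 0) ?Rintegral_cst ?mul0r //.
  by apply/funext => z; have := g0 z; move/negP; rewrite negbK => /eqP.
by have [_ /(_ gz)[xc yc _]] := gc x y z; rewrite !le_max xc yc.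
Qed.

Lemma cbm3_Fubini12 (g : R -> R -> R -> R) : cbm3 g ->
  \int[mu]_x \int[mu]_y \int[mu]_z g x y z =
  \int[mu]_y \int[mu]_x \int[mu]_z g x y z.
Proof. by move=> /cbm3_int /cbm2_Fubini. Qed.

Lemma cbm3_Fubini23 (g : R -> R -> R -> R) : cbm3 g ->
  \int[mu]_x \int[mu]_y \int[mu]_z g x y z =
  \int[mu]_x \int[mu]_z \int[mu]_y g x y z.
Proof.
by move=> cg; apply: eq_Rintegral => x _; rewrite cbm2_Fubini //; exact: cbm3_l.
Qed.

End iterated_integrals.

(** * The fundamental theorem of calculus for compactly supported functions *)

Section compactly_supported_FTC.
Context (R : realType) (u : R -> R) (c : R).
Hypotheses (du : forall x, derivable u x 1) (cu' : continuous (derive1 u))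
  (suppu : forall x, u x != 0 -> `|x| <= c).
Local Notation mu := (@lebesgue_measure R).

Lemma derive1_out_supp x : c < `|x| -> derive1 u x = 0.
Proof.
move=> cx; rewrite derive1E -[RHS](@derive_cst R R R 0 x 1).
apply: near_eq_derive.
have : \forall y \near x, c < `|y|.
  by have /cvgr_gt := @norm_continuous R R x; exact.
apply: filterS => y cy; apply/eqP; apply: contraTT cy => /suppu.
by rewrite -leNgt.
Qed.

(** With [f] given as a restriction, the integrals over the line and over both half-lines are
    instances once they are cut down to the support. *)
Lemma Rintegral_derive1_itv (f : R -> R) (a b : R) : a < b ->
  f = derive1 u \_ `[a, b] -> \int[mu]_x f x = u b - u a.
Proof.
move=> ab ->; rewrite -Rintegral_mkcond /Rintegral.
have cu x : {for x, continuous u}.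
  exact/differentiable_continuous/derivable1_diffP.
have dab : derivable_oo_LRcontinuous u a b.
  split => //; [exact: cvg_at_right_filter (cu a)|exact: cvg_at_left_filter (cu b)].
exact: (congr1 fine (continuous_FTC2 ab (continuous_subspaceT cu') dab (fun _ _ => erefl))).
Qed.

(** The margin puts [C] and [- C] strictly outside the support, so that [u] vanishes at the
    endpoints. *)
Let C := `|c| + 1.
Let C0 : 0 < C. Proof. by rewrite ltr_wpDl. Qed.
Let cC : c < C. Proof. by rewrite (le_lt_trans (ler_norm c)) // ltrDl. Qed.
Let uC x : C <= `|x| -> u x = 0.
Proof.
move=> Cx; apply/eqP; apply: contraT => /suppu xc.
by have := lt_le_trans cC (le_trans Cx xc); rewrite ltxx.
Qed.

Lemma Rintegral_derive1 : \int[mu]_x derive1 u x = 0.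
Proof.
rewrite (@Rintegral_derive1_itv _ (- C) C); last 2 first.
- by rewrite gtrN.
- apply/funext => x; rewrite patchE; case: ifPn => // /negP xD.
  apply: derive1_out_supp; rewrite (lt_le_trans cC) // leNgt.
  apply/negP => /ltW; rewrite ler_norml => xC; apply: xD; apply: mem_set.
  by rewrite /= in_itv.
by rewrite !uC ?subrr ?normrN // ler_norm.
Qed.

Lemma Rintegral_derive1_le0 : \int[mu]_x ((x <= 0 :> R)%R%:R * derive1 u x) = u 0.
Proof.
rewrite (@Rintegral_derive1_itv _ (- C) 0); last 2 first.
- by rewrite oppr_lt0.
- apply/funext => x; rewrite patchE; case: ifPn => [|/negP xD].
    by rewrite inE /= in_itv /= => /andP[_ ->]; rewrite mul1r.
  case: (leP x 0) => x0; last by rewrite mul0r.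
  rewrite derive1_out_supp ?mulr0 // (lt_le_trans cC) // ler0_norm //.
  rewrite leNgt; apply/negP => xC; apply: xD; apply: mem_set.
  by rewrite /= in_itv /= x0 andbT; lra.
by rewrite [u (- C)]uC ?subr0 ?normrN // ler_norm.
Qed.

Lemma Rintegral_derive1_ge0 : \int[mu]_x ((0 <= x :> R)%R%:R * derive1 u x) = - u 0.
Proof.
rewrite (@Rintegral_derive1_itv _ 0 C); last 2 first.
- by [].
- apply/funext => x; rewrite patchE; case: ifPn => [|/negP xD].
    by rewrite inE /= in_itv /= => /andP[-> _]; rewrite mul1r.
  case: (leP 0 x) => x0; last by rewrite mul0r.
  rewrite derive1_out_supp ?mulr0 // (lt_le_trans cC) // ger0_norm //.
  rewrite leNgt; apply/negP => xC; apply: xD; apply: mem_set.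
  by rewrite /= in_itv /= x0 /=; lra.
by rewrite uC ?sub0r // ler_norm.
Qed.

End compactly_supported_FTC.

(** * Volume integrals over three-dimensional space *)

Definition ins (R : realType) (a : 'I_3) (s : R) (y : 'rV[R]_2) : 'rV[R]_3 :=
  \row_(i < 3) (if unlift a i is Some k then y 0 k else s).

Definition row3 (R : realType) (x y z : R) : 'rV[R]_3 :=
  \row_(i < 3) tnth [tuple x; y; z] i.

Definition cbm (R : realType) n (f : 'rV[R]_n -> R) : Prop :=
  (forall d (T : measurableType d) (u : 'I_n -> T -> R),
     (forall i, measurable_fun setT (u i)) ->
     measurable_fun setT (fun t => f (\row_i u i t))) /\
  exists c : R, forall x, `|f x| <= c /\ (f x != 0 -> forall i, `|x 0 i| <= c).

Section volume_integral.
Context (R : realType).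
Implicit Types (f g : 'rV[R]_3 -> R).
Local Notation mu := (@lebesgue_measure R).

(** The order of integration is fixed here; [vol_axis] makes any chosen axis the innermost one. *)
Definition vol f : R := \int[mu]_x \int[mu]_y \int[mu]_z f (row3 x y z).

Lemma cbm_perm3 f (s : 'I_3 -> 'I_3) : cbm f -> injective s ->
  cbm3 (fun x y z => f (\row_i tnth [tuple x; y; z] (s i))).
Proof.
move=> [mf [c fc]] s_inj; split=> [d T u v w mu_ mv mw|].
  apply: (mf _ _ (fun i t => tnth [tuple u t; v t; w t] (s i))) => i.
  by case: (s i) => [[|[|[|//]]] ?].
exists c => x y z; have [-> h] := fc (\row_i tnth [tuple x; y; z] (s i)).
split => // /h {}h; have [s' _ s'K] := injF_bij s_inj.
split; [have := h (s' 0)|have := h (s' 1)|have := h (s' 2)];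
  by rewrite mxE s'K.
Qed.

Lemma cbm_row3 f : cbm f -> cbm3 (fun x y z => f (row3 x y z)).
Proof. by move=> cf; exact: (@cbm_perm3 f id). Qed.

Lemma ins_point2 (a : 'I_3) (s : R) (p : R * R) : ins a s (point2 p) =
  tnth [tuple row3 s p.1 p.2; row3 p.1 s p.2; row3 p.1 p.2 s] a.
Proof.
apply/rowP => i; rewrite !mxE.
case: unliftP => [k ->|->].
  case: a => [[|[|[|//]]] la]; case: k => [[|[|//]] lk];
  by rewrite !mxE.
case: a => [[|[|[|//]]] la]; by rewrite !mxE.
Qed.

(** At most two Fubini exchanges bring the axis [a] inside. The two outer variables are put back
    into a product measure because chart integrals are taken with respect to it. *)
Lemma vol_axis (a : 'I_3) f : cbm f ->
  vol f = Rintegral (mu \x mu)%E setT (fun p => \int[mu]_s f (ins a s (point2 p))).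
Proof.
move=> cf; have c0 := cbm_row3 cf.
under eq_Rintegral do under eq_Rintegral do rewrite ins_point2.
case: a => [[|[|[|//]]] la]; rewrite /tnth /=.
- have c3 : cbm3 (fun x y z => f (row3 z x y)).
    split => [d T u v w *|]; first by apply: c0.1.
    have [c fc] := c0.2; exists c => x y z; have [? h] := fc z x y.
    by split => // /h[].
  rewrite (cbm2_Rintegral_prod (cbm3_int c3)) (cbm3_Fubini23 c3).
  rewrite cbm3_Fubini12 //.
  split => [d T u v w *|]; first by apply: c0.1.
  have [c fc] := c0.2; exists c => x y z; have [? h] := fc y x z.
  by split => // /h[].
- have c3 : cbm3 (fun x y z => f (row3 x z y)).
    split => [d T u v w *|]; first by apply: c0.1.
    have [c fc] := c0.2; exists c => x y z; have [? h] := fc x z y.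
    by split => // /h[].
  by rewrite (cbm2_Rintegral_prod (cbm3_int c3)) (cbm3_Fubini23 c3).
- by rewrite (cbm2_Rintegral_prod (cbm3_int c0)).
Qed.

Lemma cbmD n (f g : 'rV[R]_n -> R) : cbm f -> cbm g -> cbm (fun x => f x + g x).
Proof.
move=> [mf [c fc]] [mg [e ge]]; split => [d T u mu_|].
  by apply: measurable_funD; [exact: mf|exact: mg].
exists (`|c| + `|e|) => x; split.
  rewrite (le_trans (ler_normD _ _)) // lerD //.
    by rewrite (le_trans (fc x).1) // ler_norm.
  by rewrite (le_trans (ge x).1) // ler_norm.
move=> fg i; have [f0|f0] := eqVneq (f x) 0.
  rewrite f0 add0r in fg; rewrite (le_trans ((ge x).2 fg i)) //.
  by rewrite (le_trans (ler_norm _)) // lerDr.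
by rewrite (le_trans ((fc x).2 f0 i)) // (le_trans (ler_norm _)) // lerDl.
Qed.

Lemma cbm0 n : cbm (fun _ : 'rV[R]_n => 0).
Proof.
split=> [d T u _|]; first exact: measurable_cst.
by exists 0 => x; rewrite normr0 eqxx.
Qed.

Lemma cbmMl n (f g : 'rV[R]_n -> R) :
  (forall d (T : measurableType d) (u : 'I_n -> T -> R),
     (forall i, measurable_fun setT (u i)) ->
     measurable_fun setT (fun t => g (\row_i u i t))) ->
  (exists c : R, forall x, `|g x| <= c) ->
  cbm f -> cbm (fun x => g x * f x).
Proof.
move=> mg [e ge] [mf [c fc]]; split => [d T u mu_|].
  by apply: measurable_funM; [exact: mg|exact: mf].
exists (Num.max c (e * c)) => x; split.
  by rewrite le_max normrM (ler_pM _ _ (ge x) (fc x).1) ?orbT.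
rewrite mulf_eq0 negb_or => /andP[_ f0] i.
by rewrite le_max ((fc x).2 f0 i).
Qed.

Lemma cbmN n (f : 'rV[R]_n -> R) : cbm f -> cbm (fun x => - f x).
Proof.
move=> [mf [c fc]]; split => [d T u mu_|]; first exact: measurableT_comp (mf _ _ _ _).
by exists c => x; rewrite normrN oppr_eq0; exact: fc.
Qed.

Lemma cbm_sum n m (f : 'I_m -> 'rV[R]_n -> R) : (forall i, cbm (f i)) ->
  cbm (fun x => \sum_i f i x).
Proof.
move=> cf; elim: m f cf => [|m IH] f cf.
  rewrite (_ : (fun _ => _) = fun=> 0); first exact: cbm0.
  by apply/funext => x; rewrite big_ord0.
rewrite (_ : (fun _ => _) = fun x => f ord0 x + \sum_i f (lift ord0 i) x).
  by apply: cbmD => //; exact: IH.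
by apply/funext => x; rewrite big_ord_recl.
Qed.

Lemma volD f g : cbm f -> cbm g -> vol (fun x => f x + g x) = vol f + vol g.
Proof.
move=> /cbm_row3 cf /cbm_row3 cg; rewrite /vol.
have i3 h x y : cbm3 h -> mu.-integrable setT (EFin \o h x y).
  by move=> ?; apply: integrable_cbm1; apply: cbm2_l; exact: cbm3_l.
have i2 h x : cbm3 h -> mu.-integrable setT
   (EFin \o (fun y => \int[mu]_z h x y z)).
  by move=> /cbm3_int ch; apply: integrable_cbm1; exact: (cbm2_l x ch).
have i1 h : cbm3 h -> mu.-integrable setT
   (EFin \o (fun x => \int[mu]_y \int[mu]_z h x y z)).
  move=> ch; apply: integrable_cbm1.
  have [mh [c hc]] := cbm3_int ch; split.
    apply: (@measurable_fun_Rintegral _ _ _ (fun p : R * R => \int[mu]_z h p.1 p.2 z)).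
    by apply: mh.
  exists (Num.max c (c * (2 * c))) => x; split.
    rewrite le_max normr_Rintegral_cbm1 ?orbT //.
    - by apply: le_trans (normr_ge0 _) (hc 0 0).1.
    - exact: (cbm2_l x (cbm3_int ch)).1.
    - by move=> y; have [? k] := hc x y; split => // /k[].
  move=> hx; have [y hy] : exists y, \int[mu]_z h x y z != 0.
    apply: contrapT => /forallNP g0; move: hx => /eqP; apply.
    rewrite (_ : (fun _ => _) = cst 0) ?Rintegral_cst ?mul0r //.
    by apply/funext => y; have := g0 y; move/negP; rewrite negbK => /eqP.
  by have [_ /(_ hy)[xc _]] := hc x y; rewrite le_max xc.
rewrite -RintegralD //; [|exact: (i1 _ cf)|exact: (i1 _ cg)].
apply: eq_Rintegral => x _.
rewrite -RintegralD //; [|exact: (i2 _ _ cf)|exact: (i2 _ _ cg)].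
apply: eq_Rintegral => y _.
by rewrite -RintegralD //; [exact: (i3 _ _ _ cf)|exact: (i3 _ _ _ cg)].
Qed.

Lemma vol0 : vol (fun=> 0) = 0.
Proof.
rewrite /vol; apply: (etrans (eq_Rintegral _ (g := fun=> 0) _)); last first.
  by rewrite Rintegral_cst ?mul0r.
move=> x _; apply: (etrans (eq_Rintegral _ (g := fun=> 0) _)); last first.
  by rewrite Rintegral_cst ?mul0r.
by move=> y _; rewrite Rintegral_cst ?mul0r.
Qed.

Lemma volN f : cbm f -> vol (fun x => - f x) = - vol f.
Proof.
move=> cf; apply/eqP; rewrite -subr_eq0 opprK -volD //; last exact: cbmN.
by under eq_fun do rewrite addNr; rewrite vol0.
Qed.

Lemma vol_sum m (f : 'I_m -> 'rV[R]_3 -> R) : (forall i, cbm (f i)) ->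
  vol (fun x => \sum_i f i x) = \sum_i vol (f i).
Proof.
move=> cf; elim: m f cf => [|m IH] f cf.
  by rewrite big_ord0; under eq_fun do rewrite big_ord0; rewrite vol0.
under eq_fun do rewrite big_ord_recl.
rewrite big_ord_recl volD //; last exact: cbm_sum.
by rewrite IH.
Qed.

Lemma cbm_continuous n (f : 'rV[R]_n -> R) (c : R) : continuous f ->
  (forall x, f x != 0 -> forall i, `|x 0 i| <= c) -> cbm f.
Proof.
move=> cf fc; split=> [d T u mu_|]; first exact: measurable_row_continuous.
pose K := [set x : 'rV[R]_n | forall i, `[- c, c]%classic (x 0 i)].
have cK : compact K.
  exact: (@rV_compact _ _ (fun=> `[- c, c]%classic) (fun=> @segment_compact _ _ _)).
have : compact (f @` K) by apply: continuous_compact => //; exact: continuous_subspaceT.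
move=> /compact_bounded[e [_ fe]].
(* One constant has to bound both the support and the values: [c] serves for the support, [e + 1]
   for the values on the cube, and [0] for the points where [f] vanishes. *)
exists (Num.max c (Num.max 0 (e + 1))) => x; split; last first.
  by move=> /fc xc i; rewrite le_max xc.
have [->|/fc xc] := eqVneq (f x) 0; first by rewrite normr0 !le_max lexx orbT.
rewrite !le_max (fe (e + 1)) ?orbT ?ltrDl //.
by exists x => // i; rewrite /= in_itv /= -ler_norml.
Qed.

End volume_integral.

(** * Partial derivatives and C^1 functions *)

Section partial_calculus.
Context (R : realType).

Lemma partial_near_eq n (f g : 'rV[R]_n -> R) x i :
  (\forall y \near x, f y = g y) -> partial i f x = partial i g x.
Proof. by move=> fg; exact: near_eq_derive. Qed.

Lemma partial_cst n (c : R) x (i : 'I_n) : partial i (fun=> c) x = 0.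
Proof. exact: derive_cst. Qed.

Lemma partialD n (f g : 'rV[R]_n -> R) x i :
  differentiable f x -> differentiable g x ->
  partial i (fun y => f y + g y) x = partial i f x + partial i g x.
Proof. by move=> df dg; rewrite /partial -deriveD //; exact: diff_derivable. Qed.

Lemma partialN n (f : 'rV[R]_n -> R) x i :
  differentiable f x -> partial i (fun y => - f y) x = - partial i f x.
Proof. by move=> df; rewrite /partial -deriveN //; exact: diff_derivable. Qed.

Lemma partialM n (f g : 'rV[R]_n -> R) x i :
  differentiable f x -> differentiable g x ->
  partial i (fun y => f y * g y) x = f x * partial i g x + g x * partial i f x.
Proof. by move=> df dg; rewrite /partial -[RHS]deriveM //; exact: diff_derivable. Qed.

Lemma differentiable_sumE n m (f : 'I_m -> 'rV[R]_n -> R) x :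
  (forall k, differentiable (f k) x) ->
  differentiable (fun y => \sum_k f k y) x.
Proof.
move=> df; rewrite (_ : (fun y => _) = \sum_k f k); first exact: differentiable_sum.
by apply/funext => y; rewrite fct_sumE.
Qed.

Lemma partial_sum n m (f : 'I_m -> 'rV[R]_n -> R) x i :
  (forall k, differentiable (f k) x) ->
  partial i (fun y => \sum_k f k y) x = \sum_k partial i (f k) x.
Proof.
move=> df; rewrite /partial -derive_sum; last by move=> k; exact: diff_derivable.
by congr ('D_ _ _ _); apply/funext => y; rewrite fct_sumE.
Qed.

Lemma partial_coord n x (i j : 'I_n) :
  partial i (fun y : 'rV[R]_n => y 0 j) x = (j == i)%:R.
Proof.
have := @is_derive_coord R n id 1 i j x (is_derive_id _ _).
by move=> /@derive_val; rewrite mulr1.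
Qed.

Lemma differentiable_comp1 n (f : 'rV[R]_n -> R) (phi : R -> R) x :
  differentiable f x -> derivable phi (f x) 1 ->
  differentiable (fun y => phi (f y)) x.
Proof. by move=> df /derivable1_diffP dphi; exact: differentiable_comp. Qed.

Lemma partial_comp1 n (f : 'rV[R]_n -> R) (phi : R -> R) x i :
  differentiable f x -> derivable phi (f x) 1 ->
  partial i (fun y => phi (f y)) x = derive1 phi (f x) * partial i f x.
Proof.
move=> df /derivable1_diffP dphi.
rewrite /partial deriveE ?deriveE //; last exact: differentiable_comp.
by rewrite (@diff_comp _ _ _ _ f phi) //= diff1E // mulrC.
Qed.

Lemma differentiable_row m n (g : 'rV[R]_m -> 'rV[R]_n) x :
  (forall i, differentiable (fun y => g y 0 i) x) -> differentiable g x.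
Proof.
move=> dg; rewrite (_ : g = \sum_i (fun y => g y 0 i *: delta_mx 0 i)).
  by apply: differentiable_sum => i; exact: differentiableZl.
by apply/funext => y; rewrite fct_sumE; exact: row_sum_delta.
Qed.

Lemma differentiable_entry m n (g : 'rV[R]_m -> 'rV[R]_n) x i :
  differentiable g x -> differentiable (fun y => g y 0 i) x.
Proof.
move=> dg; apply: (@differentiable_comp _ _ _ _ g (fun y => y 0 i)) => //.
exact: differentiable_coord.
Qed.

Lemma diff_coord n (x v : 'rV[R]_n) i : 'd (fun y : 'rV[R]_n => y 0 i) x v = v 0 i.
Proof.
have @c : {linear 'rV[R]_n -> R}.
  by exists (fun p : 'rV[R]_n => p 0 i); do 2![eexists]; do ?[constructor];
     rewrite ?mxE// => ? *; rewrite ?mxE//; move=> ?; rewrite !mxE.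
by rewrite (_ : (fun _ => _) = c) // diff_lin //; exact: coord_continuous.
Qed.

Lemma partial_comp m n (f : 'rV[R]_n -> R) (g : 'rV[R]_m -> 'rV[R]_n) x k :
  differentiable g x -> differentiable f (g x) ->
  partial k (fun y => f (g y)) x =
  \sum_i partial i f (g x) * partial k (fun y => g y 0 i) x.
Proof.
move=> dg df; rewrite /partial deriveE; last exact: differentiable_comp.
rewrite (@diff_comp _ _ _ _ g f) //= [X in 'd f _ X]row_sum_delta linear_sum /=.
apply: eq_bigr => i _; rewrite linearZ /= deriveE // [RHS]mulrC; congr (_ * _).
rewrite deriveE; last exact: differentiable_entry.
rewrite (@diff_comp _ _ _ _ g (fun y => y 0 i)) //=; last exact: differentiable_coord.
by rewrite diff_coord.
Qed.

End partial_calculus.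
(** Functions that agree near [x] have the same first-order expansion there, and [diff_unique] reads
    the differential of [g] off this expansion. *)
Lemma differentiable_near_eq (R : realType) (V W : normedModType R) (f g : V -> W) (x : V) :
  (\forall y \near x, f y = g y) -> differentiable f x -> differentiable g x.
Proof.
move=> fg df; have fgx := nbhs_singleton fg.
have E : g \o shift x = cst (g x) + 'd f x +o_ 0 id.
  apply/eqaddoP => e e0.
  have /eqaddoP/(_ _ e0) := diff_locally df.
  have : \forall h \near 0, f (h + x) = g (h + x).
    by move: fg; rewrite (near_shift 0); apply: filterS => h /=; rewrite subr0.
  apply: filterS2 => h E.
  by move: E; rewrite !fctE /= => ->; rewrite fgx.
have D := diff_unique (diff_continuous df) E.
by apply/diff_locallyP; rewrite D; split => //; exact: diff_continuous.
Qed.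

Section C1_calculus.
Context (R : realType).

Lemma continuous_near_eq (T : topologicalType) (p q : T -> R) (x : T) :
  (\forall y \near x, p y = q y) -> {for x, continuous p} ->
  {for x, continuous q}.
Proof.
move=> pq cp; have pqx := nbhs_singleton pq.
by rewrite /prop_for /continuous_at -pqx; apply: cvg_trans cp; exact: near_eq_cvg.
Qed.

Lemma continuous_sum (T : topologicalType) m (f : 'I_m -> T -> R) (x : T) :
  (forall i, {for x, continuous (f i)}) ->
  {for x, continuous (fun y => \sum_i f i y)}.
Proof.
elim: m f => [|m IH] f cf.
  rewrite (_ : (fun _ => _) = fun=> 0); first exact: cst_continuous.
  by apply/funext => y; rewrite big_ord0.
rewrite (_ : (fun _ => _) = fun y => f ord0 y + \sum_i f (lift ord0 i) y).
  apply: (@continuousD _ _ _ (f ord0) (fun y => \sum_i f (lift ord0 i) y)).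
    exact: cf.
  by apply: IH => i; exact: cf.
by apply/funext => y; rewrite big_ord_recl.
Qed.

Lemma C1_onS n (U V : set 'rV[R]_n) f : V `<=` U -> C1_on U f -> C1_on V f.
Proof. by move=> VU cf x /VU; exact: cf. Qed.

Lemma C1_on_continuous n (U : set 'rV[R]_n) f x : C1_on U f -> U x ->
  {for x, continuous f}.
Proof. by move=> cf /cf[/differentiable_continuous]. Qed.

(** Continuity of a partial derivative at a point concerns a neighbourhood; openness of [U] makes
    the formula [p i] valid on one, so that its continuity transfers. *)
Lemma C1_on_partial n (U : set 'rV[R]_n) f (p : 'I_n -> 'rV[R]_n -> R) :
  open U -> (forall x, U x -> differentiable f x) ->
  (forall x i, U x -> partial i f x = p i x) ->
  (forall x i, U x -> {for x, continuous (p i)}) -> C1_on U f.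
Proof.
move=> oU df pf cp x Ux; split=> [|i]; first exact: df.
apply: continuous_near_eq (cp x i Ux).
by have := open_nbhs_nbhs (conj oU Ux); apply: filterS => y /pf.
Qed.

Lemma near_open n (U : set 'rV[R]_n) (P : 'rV[R]_n -> Prop) x : open U -> U x ->
  (forall y, U y -> P y) -> \forall y \near x, P y.
Proof.
by move=> oU Ux UP; have := open_nbhs_nbhs (conj oU Ux); apply: filterS.
Qed.

Lemma C1_on_ext n (U : set 'rV[R]_n) f g : open U ->
  (forall x, U x -> f x = g x) -> C1_on U f -> C1_on U g.
Proof.
move=> oU fg cf.
have nU y : U y -> \forall z \near y, f z = g z.
  by move=> Uy; exact: near_open Uy fg.
apply: (@C1_on_partial _ _ _ (fun i => partial i f)); first exact: oU.
- by move=> x Ux; apply: differentiable_near_eq (nU _ Ux) (cf x Ux).1.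
- by move=> x i Ux; apply: esym; apply: partial_near_eq; exact: nU.
- by move=> x i /cf[].
Qed.

Lemma C1_on_cst n (U : set 'rV[R]_n) (c : R) : C1_on U (fun=> c).
Proof.
move=> x Ux; split=> [|i]; first exact: differentiable_cst.
rewrite (_ : partial i _ = fun=> 0); first exact: cst_continuous.
by apply/funext => y; rewrite partial_cst.
Qed.

Lemma C1_on_coord n (U : set 'rV[R]_n) i : C1_on U (fun x => x 0 i).
Proof.
move=> x Ux; split=> [|k]; first exact: differentiable_coord.
rewrite (_ : partial k _ = fun=> (i == k)%:R); first exact: cst_continuous.
by apply/funext => y; rewrite partial_coord.
Qed.

Lemma C1_onD n (U : set 'rV[R]_n) f g : open U -> C1_on U f -> C1_on U g ->
  C1_on U (fun x => f x + g x).
Proof.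
move=> oU cf cg.
apply: (@C1_on_partial _ _ _ (fun i x => partial i f x + partial i g x)); first exact: oU.
- by move=> x Ux; apply: differentiableD; [exact: (cf x Ux).1|exact: (cg x Ux).1].
- by move=> x i Ux; apply: partialD; [exact: (cf x Ux).1|exact: (cg x Ux).1].
- move=> x i Ux; apply: (@continuousD _ _ _ (partial i f) (partial i g)).
    exact: (cf x Ux).2.
  exact: (cg x Ux).2.
Qed.

Lemma C1_onN n (U : set 'rV[R]_n) f : open U -> C1_on U f ->
  C1_on U (fun x => - f x).
Proof.
move=> oU cf.
apply: (@C1_on_partial _ _ _ (fun i x => - partial i f x)); first exact: oU.
- by move=> x Ux; apply: differentiableN; exact: (cf x Ux).1.
- by move=> x i Ux; apply: partialN; exact: (cf x Ux).1.
- move=> x i Ux; apply: (@continuousN _ _ _ (partial i f)); exact: (cf x Ux).2.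
Qed.

Lemma C1_onB n (U : set 'rV[R]_n) f g : open U -> C1_on U f -> C1_on U g ->
  C1_on U (fun x => f x - g x).
Proof. by move=> oU cf cg; exact: (C1_onD oU cf (C1_onN oU cg)). Qed.

Lemma C1_onM n (U : set 'rV[R]_n) f g : open U -> C1_on U f -> C1_on U g ->
  C1_on U (fun x => f x * g x).
Proof.
move=> oU cf cg; apply: (@C1_on_partial _ _ _
  (fun i x => f x * partial i g x + g x * partial i f x)); first exact: oU.
- by move=> x Ux; apply: differentiableM; [exact: (cf x Ux).1|exact: (cg x Ux).1].
- by move=> x i Ux; apply: partialM; [exact: (cf x Ux).1|exact: (cg x Ux).1].
- move=> x i Ux.
  apply: (@continuousD _ _ _ (fun x => f x * partial i g x) (fun x => g x * partial i f x)).
    apply: (@continuousM _ _ f (partial i g)); last exact: (cg x Ux).2.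
    exact: C1_on_continuous Ux.
  apply: (@continuousM _ _ g (partial i f)); last exact: (cf x Ux).2.
  exact: C1_on_continuous Ux.
Qed.

Lemma C1_on_sum n m (U : set 'rV[R]_n) (f : 'I_m -> 'rV[R]_n -> R) : open U ->
  (forall k, C1_on U (f k)) -> C1_on U (fun x => \sum_k f k x).
Proof.
move=> oU cf; elim: m f cf => [|m IH] f cf.
  by under eq_fun do rewrite big_ord0; exact: C1_on_cst.
under eq_fun do rewrite big_ord_recl.
by apply: C1_onD => //; exact: IH.
Qed.

Lemma C1_on_prod n m (U : set 'rV[R]_n) (f : 'I_m -> 'rV[R]_n -> R) : open U ->
  (forall k, C1_on U (f k)) -> C1_on U (fun x => \prod_k f k x).
Proof.
move=> oU cf; elim: m f cf => [|m IH] f cf.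
  by under eq_fun do rewrite big_ord0; exact: C1_on_cst.
under eq_fun do rewrite big_ord_recl.
by apply: C1_onM => //; exact: IH.
Qed.

Lemma C1_on_comp1 n (U : set 'rV[R]_n) f (phi : R -> R) : open U -> C1_on U f ->
  (forall x, U x -> derivable phi (f x) 1) ->
  (forall x, U x -> {for f x, continuous (derive1 phi)}) ->
  C1_on U (fun x => phi (f x)).
Proof.
move=> oU cf dphi cphi; apply: (@C1_on_partial _ _ _
  (fun i x => derive1 phi (f x) * partial i f x)); first exact: oU.
- by move=> x Ux; apply: differentiable_comp1; [exact: (cf x Ux).1|exact: dphi].
- by move=> x i Ux; apply: partial_comp1; [exact: (cf x Ux).1|exact: dphi].
- move=> x i Ux; apply: (@continuousM _ _ (derive1 phi \o f) (partial i f)).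
    apply: continuous_comp; [exact: C1_on_continuous Ux|exact: cphi].
  exact: (cf x Ux).2.
Qed.

Lemma C1_onV n (U : set 'rV[R]_n) f : open U -> C1_on U f ->
  (forall x, U x -> f x != 0) -> C1_on U (fun x => (f x)^-1).
Proof.
move=> oU cf f0.
have dinv (y : R) : y != 0 -> is_derive y 1 (fun z : R => z^-1) (- y ^- 2).
  move=> y0; have := @is_deriveV R (fun z => z) y 1 1 y0 (is_derive_id y 1).
  by rewrite /= /GRing.scale /= mulr1.
apply: C1_on_comp1 => // [x Ux|x Ux].
  by have [] := dinv _ (f0 x Ux).
apply: (@continuous_near_eq _ (fun y : R => - y ^- 2)).
  have : \forall y \near f x, y != 0.
    exact: (@cvgr_neq0 _ _ _ (nbhs (f x)) _ id) (@cvg_id _ _) (f0 x Ux).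
  by apply: filterS => y /dinv /@derive_val yd; rewrite derive1E.
apply: (@continuousN _ _ _ (fun y : R => y ^- 2)).
apply: (@continuousV _ _ (fun y : R => y ^+ 2)); last exact: exprn_continuous.
by rewrite expf_neq0 // f0.
Qed.

Lemma C1_on_sqrt n (U : set 'rV[R]_n) f : open U -> C1_on U f ->
  (forall x, U x -> 0 < f x) -> C1_on U (fun x => Num.sqrt (f x)).
Proof.
move=> oU cf f0.
apply: C1_on_comp1 => // [x Ux|x Ux].
  by have [] := is_derive1_sqrt (f0 x Ux).
apply: (@continuous_near_eq _ (fun y : R => (2 * Num.sqrt y)^-1)).
  have : \forall y \near f x, 0 < y.
    exact: (@cvgr_gt _ _ (nbhs (f x)) _ id _ (@cvg_id _ _) 0 (f0 x Ux)).
  by apply: filterS => y y0; rewrite derive1E derive_sqrt.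
apply: (@continuousV _ _ (fun y : R => 2 * Num.sqrt y)).
  by rewrite mulf_neq0 // gt_eqF // sqrtr_gt0 f0.
apply: (@continuousM _ _ (cst (2:R)) Num.sqrt); first exact: cst_continuous.
exact: sqrt_continuous.
Qed.

Lemma continuous_row (T : topologicalType) n (g : T -> 'rV[R]_n) (x : T) :
  (forall i, {for x, continuous (fun y => g y 0 i)}) -> {for x, continuous g}.
Proof.
move=> cg A /nbhs_rV_ball[e e0 sA].
have : nbhs x [set y | forall i, `|g x 0 i - g y 0 i| < e].
  apply: (@filter_forall _ _ (fun i y => `|g x 0 i - g y 0 i| < e) (nbhs x)) => i.
  exact: (cg i _ (nbhsx_ballx (g x 0 i) e e0)).
by apply: filterS => y /sA.
Qed.

Lemma C1_on_comp m n (U : set 'rV[R]_m) (V : set 'rV[R]_n) f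
    (g : 'rV[R]_m -> 'rV[R]_n) : open U -> C1_on V f ->
  (forall i, C1_on U (fun y => g y 0 i)) -> (forall x, U x -> V (g x)) ->
  C1_on U (fun y => f (g y)).
Proof.
move=> oU cf cg UV.
have dg x : U x -> differentiable g x.
  by move=> Ux; apply: differentiable_row => i; exact: (cg i x Ux).1.
have ctg x : U x -> {for x, continuous g}.
  by move=> Ux; exact: differentiable_continuous (dg x Ux).
apply: (@C1_on_partial _ _ _
  (fun k x => \sum_i partial i f (g x) * partial k (fun y => g y 0 i) x)); first exact: oU.
- by move=> x Ux; apply: differentiable_comp (dg x Ux) (cf _ (UV _ Ux)).1.
- by move=> x i Ux; apply: partial_comp (dg x Ux) (cf _ (UV _ Ux)).1.
- move=> x k Ux; apply: (@continuous_sum _ _ (fun i x => partial i f (g x) *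
      partial k (fun y => g y 0 i) x)) => i.
  apply: (@continuousM _ _ (partial i f \o g) (partial k (fun y => g y 0 i))).
    by apply: continuous_comp; [exact: ctg|exact: (cf _ (UV _ Ux)).2].
  exact: (cg i x Ux).2.
Qed.

Lemma C1_on_open_cover n (U : set 'rV[R]_n) f :
  (forall x, U x -> exists V, [/\ open V, V x & C1_on V f]) -> C1_on U f.
Proof. by move=> h x /h[V [_ Vx]]; apply. Qed.

End C1_calculus.

(** * Translation of integrals over half-lines *)

Lemma Rintegral_shift_itv (R : realType) (h : R -> R) (c a b : R) : a < b -> continuous h ->
  \int[@lebesgue_measure R]_(x in `[c + a, c + b]) h x = \int[@lebesgue_measure R]_(x in `[a, b]) h (c + x).
Proof.
move=> ab ch; rewrite /Rintegral.
have dF (x : R) : is_derive x 1 (fun s : R => c + s) 1.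
  have := is_deriveD (is_derive_cst c x 1) (is_derive_id x 1).
  by rewrite add0r.
have F' : derive1 (fun s : R => c + s) = cst 1.
  by apply/funext => x; rewrite derive1E (derive_val (is_derive := dF x)).
have cF (x : R) : {for x, continuous (fun s : R => c + s)}.
  by apply/differentiable_continuous/derivable1_diffP; have [] := dF x.
have := @integration_by_substitution_increasing R (fun s => c + s) h a b (ltW ab).
rewrite F' => -> //.
- by congr fine; apply: eq_integral => x _; rewrite !fctE /= mulr1.
- by move=> x y _ _; rewrite ltrD2l.
- by move=> x _; exact: cst_continuous.
- exact: is_cvg_cst.
- exact: is_cvg_cst.
- split => [x _| |]; first by have [] := dF x.
  + exact: cvg_at_right_filter (cF a).
  + exact: cvg_at_left_filter (cF b).
- exact: continuous_subspaceT.
Qed.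

(** From here on, [e = true] stands for a volume below the graph of a chart and [e = false] for one
    above it. *)
Definition half (R : realType) (e : bool) (s : R) : R :=
  ((if e then s <= 0 else 0 <= s))%R%:R.

Lemma Rintegral_half_shift (R : realType) (e : bool) (h : R -> R) (c C : R) :
  continuous h -> (forall x, h x != 0 -> `|x| <= C) ->
  \int[@lebesgue_measure R]_x (half e (x - c) * h x) =
  \int[@lebesgue_measure R]_x (half e x * h (c + x)).
Proof.
(* [L] is so large that [h] vanishes beyond distance [L] from [c]; the half-lines become compact
   intervals, on which the substitution applies. *)
move=> ch hC; pose L := `|C| + `|c| + 1.
have L0 : 0 < L by rewrite ltr_wpDl // addr_ge0.
have h0 x : x < - L + c \/ c + L < x -> h x = 0.
  move=> xL; apply/eqP; apply: contraT => /hC; rewrite ler_norml => /andP[x1 x2].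
  have := ler_norm c; have := ler_normr c c; have := ler_norm (- c); rewrite normrN.
  have := ler_norm C; rewrite /L in xL; case: xL; lra.
case: e.
- transitivity (\int[@lebesgue_measure R]_(x in `[c + - L, c + 0]) h x).
    rewrite [RHS]Rintegral_mkcond; apply: eq_Rintegral => x _.
    rewrite patchE /half subr_le0 addr0; case: ifPn => [|/negP xD].
      by rewrite inE /= in_itv /= => /andP[_ ->]; rewrite mul1r.
    case: (leP x c) => xc; last by rewrite mul0r.
    rewrite mul1r h0 //; left; rewrite ltNge; apply/negP => xL; apply: xD.
    by apply: mem_set; rewrite /= in_itv /= xc addrC xL.
  rewrite Rintegral_shift_itv //; last by rewrite oppr_lt0.
  rewrite [LHS]Rintegral_mkcond; apply: eq_Rintegral => x _.
  rewrite patchE /half; case: ifPn => [|/negP xD].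
    by rewrite inE /= in_itv /= => /andP[_ ->]; rewrite mul1r.
  case: (leP x 0) => xc; last by rewrite mul0r.
  rewrite mul1r h0 //; left; rewrite ltNge; apply/negP => xL; apply: xD.
  by apply: mem_set; rewrite /= in_itv /= xc andbT; lra.
- transitivity (\int[@lebesgue_measure R]_(x in `[c + 0, c + L]) h x).
    rewrite [RHS]Rintegral_mkcond; apply: eq_Rintegral => x _.
    rewrite patchE /half subr_ge0 addr0; case: ifPn => [|/negP xD].
      by rewrite inE /= in_itv /= => /andP[-> _]; rewrite mul1r.
    case: (leP c x) => xc; last by rewrite mul0r.
    rewrite mul1r h0 //; right; rewrite ltNge; apply/negP => xL; apply: xD.
    by apply: mem_set; rewrite /= in_itv /= xc xL.
  rewrite Rintegral_shift_itv //.
  rewrite [LHS]Rintegral_mkcond; apply: eq_Rintegral => x _.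
  rewrite patchE /half; case: ifPn => [|/negP xD].
    by rewrite inE /= in_itv /= => /andP[-> _]; rewrite mul1r.
  case: (leP 0 x) => xc; last by rewrite mul0r.
  rewrite mul1r h0 //; right; rewrite ltNge; apply/negP => xL; apply: xD.
  by apply: mem_set; rewrite /= in_itv /= xc /=; lra.
Qed.

(** * The divergence theorem below or above a graph *)

Section insertion.
Context (R : realType).
Implicit Types (a : 'I_3) (s : R) (z : 'rV[R]_2) (x : 'rV[R]_3).

Lemma ins_axis a s z : ins a s z 0 a = s.
Proof. by rewrite mxE unlift_none. Qed.

Lemma ins_lift a s z k : ins a s z 0 (lift a k) = z 0 k.
Proof. by rewrite mxE liftK. Qed.

Lemma params_ins (c : graph_chart R) s z : params c (ins (axis c) s z) = z.
Proof. by apply/rowP => k; rewrite mxE ins_lift. Qed.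

Lemma ins_params (c : graph_chart R) x : ins (axis c) (x 0 (axis c)) (params c x) = x.
Proof. by apply/rowP => i; rewrite mxE; case: unliftP => [k ->|->] //; rewrite mxE. Qed.

Lemma graph_pointE (c : graph_chart R) z :
  graph_point c z = ins (axis c) (height c z) z.
Proof. by []. Qed.

Lemma differentiable_ins a z s (H : 'rV[R]_3 -> R) :
  differentiable H (ins a s z) -> derivable (fun r => H (ins a r z)) s 1 /\
  derive1 (fun r => H (ins a r z)) s = partial a H (ins a s z).
Proof.
move=> /(@diff_derivable _ _ _ _ _ (delta_mx 0 a)) dH.
have E h : ins a (h *: (1:R) + s) z = h *: delta_mx 0 a + ins a s z.
  apply/rowP => i; rewrite !mxE; case: unliftP => [k ->|->].
    by rewrite eq_sym (negbTE (neq_lift _ _)) andbF mulr0 add0r.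
  by rewrite !eqxx.
have E' : (fun h : R => h^-1 *: ((fun r => H (ins a r z)) (h *: 1 + s) - H (ins a s z))) =
  (fun h : R => h^-1 *: (H (h *: delta_mx 0 a + ins a s z) - H (ins a s z))).
  by apply/funext => h; rewrite E.
by split; rewrite ?derive1E /derivable /partial /derive /= E'.
Qed.

End insertion.

Lemma entry_le_norm (R : realType) n (x : 'rV[R]_n) j : `|x 0 j| <= `|x|.
Proof.
rewrite -[`|x|]/(mx_norm x) mx_normrE.
exact: (le_bigmax _ (fun ij : 'I_1 * 'I_n => `|x ij.1 ij.2|) (0, j)).
Qed.

Lemma open_box_rV (R : realType) n (u v : 'I_n -> R) :
  open [set y : 'rV[R]_n | forall k, u k < y 0 k < v k].
Proof.
rewrite openE => y By; rewrite /interior.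
apply: (@filter_forall _ _ (fun k (y : 'rV[R]_n) => u k < y 0 k < v k) (nbhs y)) => k.
have cy : (fun z : 'rV[R]_n => z 0 k) @ y --> y 0 k by exact: coord_continuous.
have /= /andP[uy yv] := By k.
have h : nbhs (y 0 k) `]u k, v k[%classic.
  by apply: open_nbhs_nbhs; split; [exact: interval_open|rewrite /= in_itv /= uy yv].
exact: (cy _ h).
Qed.

Section shear.
Context (R : realType) (c : graph_chart R).
Local Notation a := (axis c).
Hypothesis hC1 : C1_on (base c) (height c).

Lemma open_base : open (base c).
Proof. exact: open_box_rV. Qed.

Lemma open_box : open (box c).
Proof. exact: open_box_rV. Qed.

Lemma box_base x : box c x -> base c (params c x).
Proof. by move=> bx k; rewrite mxE; exact: bx. Qed.

(** The shear displaces points along the axis, possibly out of the box, so its natural domain is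
    everything that projects to the base. *)
Definition cylinder : set 'rV[R]_3 := [set x | base c (params c x)].

Lemma C1_on_params k U : C1_on U (fun x => params c x 0 k).
Proof. by under eq_fun do rewrite mxE; exact: C1_on_coord. Qed.

Lemma continuous_params : continuous (params c).
Proof.
move=> x; apply: continuous_row => k.
exact: (C1_on_continuous (C1_on_params k (U := setT)) I).
Qed.

Lemma open_cylinder : open cylinder.
Proof. by apply: open_comp open_base => x _; exact: continuous_params. Qed.

Lemma C1_on_height_params : C1_on cylinder (fun x => height c (params c x)).
Proof.
apply: (C1_on_comp open_cylinder hC1) => [k|x //]; exact: C1_on_params.
Qed.

(** It carries the plane where the axis coordinate vanishes to the graph. On each line parallel to
    the axis it is a translation, so that Fubini and translation invariance replace a change of
    variables in space. *)
Definition shear (x : 'rV[R]_3) : 'rV[R]_3 :=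
  ins a (height c (params c x) + x 0 a) (params c x).

Lemma shear_ins s z : shear (ins a s z) = ins a (height c z + s) z.
Proof. by rewrite /shear params_ins ins_axis. Qed.

Lemma params_shear x : params c (shear x) = params c x.
Proof. exact: params_ins. Qed.

Lemma C1_on_shear i : C1_on cylinder (fun x => shear x 0 i).
Proof.
have [k ->|->] := unliftP a i.
  by under eq_fun do rewrite ins_lift; exact: C1_on_params.
under eq_fun do rewrite ins_axis.
apply: C1_onD; [exact: open_cylinder|exact: C1_on_height_params|exact: C1_on_coord].
Qed.

Lemma partial_shear_lift x k j : cylinder x ->
  partial j (fun y => shear y 0 (lift a k)) x = (lift a k == j)%:R.
Proof.
move=> _; rewrite [X in partial j X](_ : _ = fun y : 'rV[R]_3 => y 0 (lift a k)) ?partial_coord //.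
by apply/funext => y; rewrite ins_lift mxE.
Qed.

Lemma partial_height_params x j : cylinder x ->
  partial j (fun y => height c (params c y)) x =
  \sum_k partial k (height c) (params c x) * (lift a k == j)%:R.
Proof.
move=> cx; rewrite (@partial_comp R 3 2 (height c) (params c) x j); last exact: (@hC1 (params c x) cx).1.
  apply: eq_bigr => k _.
  rewrite [X in partial j X](_ : _ = fun y : 'rV[R]_3 => y 0 (lift a k)) ?partial_coord //.
  by apply/funext => y; rewrite mxE.
by apply: differentiable_row => k; exact: (C1_on_params k (U := setT) (x := x) I).1.
Qed.

Lemma partial_shear_axis x j : cylinder x ->
  partial j (fun y => shear y 0 a) x =
  \sum_k partial k (height c) (params c x) * (lift a k == j)%:R + (a == j)%:R.
Proof.
move=> cx; rewrite -partial_height_params // -[(a == j)%:R](partial_coord x).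
rewrite [X in partial j X](_ : _ = fun y : 'rV[R]_3 => height c (params c y) + y 0 a); last first.
  by apply/funext => y; rewrite ins_axis.
apply: partialD.
- exact: (C1_on_height_params cx).1.
- exact: (@C1_on_coord R 3 setT a x I).1.
Qed.

Section sheared_function.
Variables (G : 'rV[R]_3 -> R) (K : set 'rV[R]_3).
Hypotheses (GC1 : C1_on setT G) (cK : compact K) (Kbox : K `<=` box c)
  (suppG : forall x, ~ K x -> G x = 0).

Definition sheared (x : 'rV[R]_3) : R :=
  if `[< cylinder x >] then G (shear x) else 0.

Lemma shearedE x : cylinder x -> sheared x = G (shear x).
Proof. by move=> cx; rewrite /sheared asboolT. Qed.

Lemma sheared_supp x : sheared x != 0 -> cylinder x /\ K (shear x).
Proof.
rewrite /sheared; case: asboolP; last by rewrite eqxx.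
by move=> cx Gx; split => //; apply: contrapT => /suppG h; rewrite h eqxx in Gx.
Qed.

Lemma compact_params : compact (params c @` K).
Proof.
by apply: continuous_compact => //; apply: continuous_subspaceT; exact: continuous_params.
Qed.

Lemma near_sheared0 x : ~ (params c @` K) (params c x) ->
  \forall y \near x, sheared y = 0.
Proof.
move=> nx.
have oP : open (~` (params c @` K)).
  by rewrite openC; apply: compact_closed => //; exact: compact_params.
have oQ : open [set y | ~ (params c @` K) (params c y)].
  by apply: open_comp oP => y _; exact: continuous_params.
apply: (near_open oQ nx) => y /= ny; apply/eqP; apply: contraT => /sheared_supp[_ Ky].
by exfalso; apply: ny; exists (shear y) => //; exact: params_shear.
Qed.

Lemma sheared_out x : ~ cylinder x -> ~ (params c @` K) (params c x).
Proof. by move=> ncx [y /Kbox/box_base By E]; apply: ncx; rewrite /cylinder /= -E. Qed.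

Lemma near_sheared_cyl x : cylinder x -> \forall y \near x, G (shear y) = sheared y.
Proof.
by move=> cx; apply: (near_open open_cylinder cx) => y cy; rewrite shearedE.
Qed.

(** A point off the cylinder projects outside the compact projection of [K], and so do all nearby
    points; hence the extension by 0 vanishes near it. *)
Lemma C1_on_sheared : C1_on setT sheared.
Proof.
apply: C1_on_open_cover => x _.
have [cx|/sheared_out nx] := pselect (cylinder x).
  exists cylinder; split => //; first exact: open_cylinder.
  apply: (@C1_on_ext _ _ _ (fun x => G (shear x)) _ open_cylinder).
    by move=> y cy; rewrite shearedE.
  by apply: (C1_on_comp open_cylinder GC1) => // i; exact: C1_on_shear.
exists [set y | ~ (params c @` K) (params c y)]; split => //.
  have oP : open (~` (params c @` K)).
    by rewrite openC; apply: compact_closed => //; exact: compact_params.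
  by apply: open_comp oP => y _; exact: continuous_params.
move=> y /near_sheared0 y0.
have y0' : \forall z \near y, 0 = sheared z by apply: filterS y0.
split=> [|i]; first exact: differentiable_near_eq y0' (differentiable_cst _ _).
apply: (@continuous_near_eq _ _ (fun=> 0)); last exact: cst_continuous.
apply: filterS (near_join y0') => z hz.
by rewrite -[LHS](@partial_cst R 3 0 z i); exact: partial_near_eq.
Qed.

Lemma partial_sheared_out x j : ~ cylinder x -> partial j sheared x = 0.
Proof.
move=> /sheared_out/near_sheared0 h; rewrite -[RHS](@partial_cst R 3 0 x j).
exact: partial_near_eq.
Qed.

Lemma partial_sheared x j : cylinder x -> partial j sheared x =
  partial a G (shear x) *
   (\sum_k partial k (height c) (params c x) * (lift a k == j)%:R + (a == j)%:R)
  + \sum_k partial (lift a k) G (shear x) * (lift a k == j)%:R.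
Proof.
move=> cx; rewrite -(partial_near_eq _ (near_sheared_cyl cx)) (@partial_comp R 3 3 G shear x j).
- rewrite (bigD1_ord a) //= partial_shear_axis //; congr (_ + _).
  by apply: eq_bigr => k _; rewrite partial_shear_lift.
- by apply: differentiable_row => i; exact: (C1_on_shear _ cx).1.
- exact: (@GC1 (shear x) I).1.
Qed.

Lemma partial_sheared_axis x : cylinder x ->
  partial a sheared x = partial a G (shear x).
Proof.
move=> cx; rewrite partial_sheared // eqxx.
rewrite !big1 ?add0r ?addr0 ?mulr1 // => k _;
  by rewrite eq_sym (negbTE (neq_lift _ _)) mulr0.
Qed.

Lemma partial_sheared_lift x k : cylinder x -> partial (lift a k) sheared x =
  partial a G (shear x) * partial k (height c) (params c x)
  + partial (lift a k) G (shear x).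
Proof.
move=> cx; rewrite partial_sheared // (negbTE (neq_lift _ _)) addr0.
congr (_ * _ + _).
  rewrite (bigD1 k) //= eqxx mulr1 big1 ?addr0 // => i ik.
  by rewrite (inj_eq lift_inj) (negbTE ik) mulr0.
rewrite (bigD1 k) //= eqxx mulr1 big1 ?addr0 // => i ik.
by rewrite (inj_eq lift_inj) (negbTE ik) mulr0.
Qed.

(** The axis coordinate of [x] is that of [shear x] minus the height, and both are bounded: the
    first by compactness of [K], the second by continuity of the height on the projection of [K]. *)
Lemma sheared_bounded_supp : exists C : R, forall x, sheared x != 0 ->
  forall i, `|x 0 i| <= C.
Proof.
have [C1 [_ hC1']] := compact_bounded cK.
have : compact (height c @` (params c @` K)).
  apply: continuous_compact compact_params.
  apply: continuous_in_subspaceT => z; rewrite inE => -[x /Kbox/box_base Bx <-].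
  exact: C1_on_continuous Bx.
move=> /compact_bounded[C2 [_ hC2]].
exists (C1 + 1 + (C2 + 1)) => x /sheared_supp[cx Kx] i.
have b1 j : `|shear x 0 j| <= C1 + 1.
  have := hC1' (C1 + 1); rewrite ltrDl => /(_ ltr01 _ Kx) /=.
  by apply: le_trans; exact: entry_le_norm.
have b2 : `|height c (params c x)| <= C2 + 1.
  apply: (hC2 (C2 + 1)); first by rewrite ltrDl.
  exists (params c x) => //; exists (shear x) => //; exact: params_shear.
have b20 := le_trans (normr_ge0 _) b2.
have [k E|E] := unliftP a i.
  have := b1 i; rewrite E ins_lift mxE => /le_trans; apply.
  by rewrite lerDl.
have := b1 a; rewrite ins_axis E => b3.
have -> : x 0 a = (height c (params c x) + x 0 a) - height c (params c x) by ring.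
by rewrite (le_trans (ler_normB _ _)) // lerD.
Qed.

End sheared_function.
End shear.

(** * Integrals along the fibres of an axis *)

Definition bounded_supp (R : realType) n (f : 'rV[R]_n -> R) : Prop :=
  exists C : R, forall x, f x != 0 -> forall i, `|x 0 i| <= C.

(** The sign of the axis component of the outward normal to a volume on side [e] of a graph. *)
Definition sgn (R : realType) (e : bool) : R := if e then 1 else - 1.

Section fiber_integrals.
Context (R : realType).
Implicit Types (f g : 'rV[R]_3 -> R) (a : 'I_3).
Local Notation mu := (@lebesgue_measure R).

Lemma continuous_ins a y : continuous (fun s : R => ins a s y).
Proof.
move=> s A /nbhs_rV_ball[e e0 sA]; apply/nbhs_ballP; exists e => // r sr.
apply: sA => i; rewrite !mxE; case: unliftP => [k _|_]; last exact: sr.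
by rewrite subrr normr0.
Qed.

Lemma bounded_supp_partial n (f : 'rV[R]_n -> R) j :
  bounded_supp f -> bounded_supp (partial j f).
Proof.
move=> [C fC]; exists C => x px i; rewrite leNgt; apply/negP => Cx.
have oU : open [set y : 'rV[R]_n | C < `|y 0 i|].
  rewrite (_ : mkset _ = (fun y : 'rV[R]_n => `|y 0 i|) @^-1` `]C, +oo[%classic).
    apply: open_comp (@interval_open R (BRight C) +oo%O isT isT) => y _.
    apply: continuous_comp; [exact: coord_continuous|exact: norm_continuous].
  by apply/seteqP; split => y /=; rewrite in_itv /= andbT.
move: px; rewrite (@partial_near_eq _ _ f (fun=> 0)) ?partial_cst ?eqxx //.
apply: (near_open oU Cx) => y /= Cy; apply/eqP; apply: contraT => /fC/(_ i).
by rewrite leNgt Cy.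
Qed.

Lemma cbm_partial n (f : 'rV[R]_n -> R) j : C1_on setT f -> bounded_supp f ->
  cbm (partial j f).
Proof.
move=> cf /(bounded_supp_partial j)[C fC]; apply: cbm_continuous fC => x.
exact: (cf x I).2.
Qed.

Lemma measurable_half (e : bool) : measurable_fun setT (@half R e).
Proof.
rewrite (_ : half e = \1_(if e then `]-oo, 0]%classic else `[0, +oo[%classic)).
  by apply: measurable_indic; case: e.
apply/funext => s; rewrite indicE /half.
by case: e; rewrite mem_setE in_itv /= ?andbT.
Qed.

Lemma half_le1 (e : bool) (s : R) : `|half e s| <= 1.
Proof. by rewrite /half; case: (if e then _ else _); rewrite ?normr1 ?normr0. Qed.

Lemma cbm_half (e : bool) a f : cbm f -> cbm (fun x => half e (x 0 a) * f x).
Proof.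
apply: cbmMl; last by exists 1 => x; exact: half_le1.
move=> d T u mu_; under eq_fun do rewrite mxE.
exact: measurableT_comp (@measurable_half e) (mu_ a).
Qed.

Lemma cbm_ins a f : cbm f -> cbm3 (fun y z s => f (ins a s (point2 (y, z)))).
Proof.
move=> /cbm_row3 [mf [c fc]]; split => [d T u v w mu_ mv mw|].
  under eq_fun do rewrite ins_point2.
  by case: a => [[|[|[|//]]] la]; rewrite /tnth /=; exact: mf.
exists c => y z s; rewrite ins_point2.
case: a => [[|[|[|//]]] la]; rewrite /tnth /=.
- by have [? h] := fc s y z; split => // /h[].
- by have [? h] := fc y s z; split => // /h[].
- by have [? h] := fc y z s; split => // /h[].
Qed.

Lemma cbm1_ins a f z : cbm f -> cbm1 (fun s => f (ins a s z)).
Proof.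
move=> /(cbm_ins a)/(cbm3_l (z 0 0))/(cbm2_l (z 0 1)).
rewrite (_ : point2 _ = z) //; apply/rowP => k; rewrite mxE.
by case: k => [[|[|//]] lk] /=; congr (z 0 _); apply: val_inj.
Qed.

Lemma fiber_partial a f y : C1_on setT f -> bounded_supp f ->
  \int[mu]_s partial a f (ins a s y) = 0.
Proof.
move=> cf [C fC]; pose u s := f (ins a s y).
have [du du'] : (forall s, derivable u s 1) /\ derive1 u = fun s => partial a f (ins a s y).
  by split=> [s|]; [|apply/funext => s]; have [] := differentiable_ins (cf (ins a s y) I).1.
rewrite -du'; apply: (@Rintegral_derive1 R u C du).
  rewrite du' => s; apply: (@continuous_comp _ _ _ (fun s => ins a s y) (partial a f)).
    exact: continuous_ins.
  exact: (cf (ins a s y) I).2.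
by move=> s /fC/(_ a); rewrite ins_axis.
Qed.

Lemma fiber_half_partial e a f y : C1_on setT f -> bounded_supp f ->
  \int[mu]_s (half e s * partial a f (ins a s y)) = sgn R e * f (ins a 0 y).
Proof.
move=> cf [C fC]; pose u s := f (ins a s y).
have [du du'] : (forall s, derivable u s 1) /\ derive1 u = fun s => partial a f (ins a s y).
  by split=> [s|]; [|apply/funext => s]; have [] := differentiable_ins (cf (ins a s y) I).1.
have cu' : continuous (derive1 u).
  rewrite du' => s; apply: (@continuous_comp _ _ _ (fun s => ins a s y) (partial a f)).
    exact: continuous_ins.
  exact: (cf (ins a s y) I).2.
have su s : u s != 0 -> `|s| <= C by move=> /fC/(_ a); rewrite ins_axis.
under eq_Rintegral do rewrite -[partial _ _ _]/((fun s => partial a f (ins a s y)) _) -du'.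
rewrite /half /sgn; case: e.
  by rewrite mul1r; exact: Rintegral_derive1_le0 du cu' su.
by rewrite mulN1r; exact: Rintegral_derive1_ge0 du cu' su.
Qed.

Lemma vol_partial a f : C1_on setT f -> bounded_supp f -> vol (partial a f) = 0.
Proof.
move=> cf sf; rewrite (vol_axis a); last exact: cbm_partial.
under eq_Rintegral do rewrite fiber_partial //.
by rewrite Rintegral_cst ?mul0r.
Qed.

(** The indicator depends on the coordinate [a] only, so it is constant along the other axis and the
    derivative integrates to 0 on each fibre. *)
Lemma vol_half_partial e a k f : C1_on setT f -> bounded_supp f ->
  vol (fun x => half e (x 0 a) * partial (lift a k) f x) = 0.
Proof.
move=> cf sf; have cp := cbm_partial (lift a k) cf sf.
rewrite (vol_axis (lift a k)); last exact: cbm_half.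
apply: (etrans (eq_Rintegral _ (g := fun=> 0) _)); last first.
  by rewrite Rintegral_cst ?mul0r.
move=> p _; have [k' E] : exists k', a = lift (lift a k) k'.
  by have [k'|] := unliftP (lift a k) a; [exists k'|move/eqP; rewrite (negbTE (neq_lift _ _))].
have H s : ins (lift a k) s (point2 p) 0 a = point2 p 0 k'.
  by rewrite [X in _ 0 X]E ins_lift.
under eq_Rintegral do rewrite H.
rewrite RintegralZl //; last exact: integrable_cbm1 (cbm1_ins _ _ _).
by rewrite fiber_partial ?mulr0.
Qed.

End fiber_integrals.

Definition euclidean_div (R : realType) n (G : 'I_n -> 'rV[R]_n -> R)
    (x : 'rV[R]_n) : R :=
  \sum_i partial i (G i) x.

(* G . (- grad f, 1) on the graph of f = height c, extended by 0 *)
Definition graph_flux (R : realType) (c : graph_chart R)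
    (G : 'I_3 -> 'rV[R]_3 -> R) (z : 'rV[R]_2) : R :=
  if `[< base c z >] then
    G (axis c) (graph_point c z) -
    \sum_k partial k (height c) z * G (lift (axis c) k) (graph_point c z)
  else 0.

Section half_fiber.
Context (R : realType) (e : bool) (a : 'I_3) (z : 'rV[R]_2).
Local Notation mu := (@lebesgue_measure R).

Lemma integrable_half_fiber f : cbm f ->
  mu.-integrable setT (EFin \o (fun s => half e s * f (ins a s z))).
Proof.
move=> /(cbm_half e a)/(cbm1_ins a z)/integrable_cbm1.
by apply: eq_integrable => // s _ /=; rewrite ins_axis.
Qed.

Lemma half_fiberD f g : cbm f -> cbm g ->
  \int[mu]_s (half e s * (f (ins a s z) + g (ins a s z))) =
  \int[mu]_s (half e s * f (ins a s z)) + \int[mu]_s (half e s * g (ins a s z)).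
Proof.
move=> cf cg; under eq_Rintegral do rewrite mulrDr.
by rewrite RintegralD //; exact: integrable_half_fiber.
Qed.

Lemma cbmZ n (k : R) (f : 'rV[R]_n -> R) : cbm f -> cbm (fun x => k * f x).
Proof.
apply: cbmMl => [d T u _|]; first exact: measurable_cst.
by exists `|k|.
Qed.

Lemma half_fiberZ k f : cbm f ->
  \int[mu]_s (half e s * (k * f (ins a s z))) =
  k * \int[mu]_s (half e s * f (ins a s z)).
Proof.
move=> cf; under eq_Rintegral do rewrite mulrCA.
by rewrite RintegralZl //; exact: integrable_half_fiber.
Qed.

Lemma half_fiber_sum m (f : 'I_m -> 'rV[R]_3 -> R) : (forall k, cbm (f k)) ->
  \int[mu]_s (half e s * \sum_k f k (ins a s z)) =
  \sum_k \int[mu]_s (half e s * f k (ins a s z)).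
Proof.
move=> cf; elim: m f cf => [|m IH] f cf.
  rewrite big_ord0 (_ : (fun _ => _) = cst 0) ?Rintegral_cst ?mul0r //.
  by apply/funext => s; rewrite big_ord0 mulr0.
rewrite big_ord_recl -(IH (fun k => f (lift ord0 k))) //.
under eq_Rintegral do rewrite big_ord_recl.
exact: (half_fiberD (cf ord0) (cbm_sum (fun k => cf (lift ord0 k)))).
Qed.

End half_fiber.

(** * The divergence theorem inside one chart *)

Section local_divergence.
Context (R : realType) (c : graph_chart R) (e : bool).
Local Notation a := (axis c).
Local Notation mu := (@lebesgue_measure R).
Variables (G : 'I_3 -> 'rV[R]_3 -> R) (K : set 'rV[R]_3) (chi : 'rV[R]_3 -> R).
Hypotheses (hC1 : C1_on (base c) (height c))
  (GC1 : forall i, C1_on setT (G i)) (cK : compact K) (Kbox : K `<=` box c)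
  (suppG : forall i x, ~ K x -> G i x = 0)
  (cchi : cbm (fun x => chi x * euclidean_div G x))
  (chiE : forall x, K x -> chi x = half e (x 0 a - height c (params c x))).

Lemma compact_bounded_supp (f : 'rV[R]_3 -> R) : (forall x, ~ K x -> f x = 0) ->
  bounded_supp f.
Proof.
move=> fK; have [C [_ hC]] := compact_bounded cK.
exists (C + 1) => x fx i; rewrite (le_trans (entry_le_norm _ _)) //.
apply: (hC (C + 1)); first by rewrite ltrDl.
by apply: contrapT => /fK f0; rewrite f0 eqxx in fx.
Qed.

Lemma partial_out_supp (f : 'rV[R]_3 -> R) x i : (forall x, ~ K x -> f x = 0) ->
  ~ K x -> partial i f x = 0.
Proof.
move=> fK nKx; rewrite -[RHS](@partial_cst R 3 0 x i); apply: partial_near_eq.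
have oK : open (~` K) by rewrite openC; exact: compact_closed.
by apply: (near_open oK nKx) => y /fK.
Qed.

Local Notation g i := (sheared c (G i)).
Let gC1 i : C1_on setT (g i) := C1_on_sheared hC1 (GC1 i) cK Kbox (suppG i).
Let gsupp i : bounded_supp (g i) := sheared_bounded_supp hC1 cK Kbox (suppG i).

Lemma euclidean_div_out x : ~ K x -> euclidean_div G x = 0.
Proof. by move=> nKx; apply: big1 => i _; apply: partial_out_supp => // y; exact: suppG. Qed.

(** The chain rule solved for the derivatives of [G]. The slope [partial k (height c) z] is merely
    continuous in [z] and could not be put under a tangential derivative; it stays outside, as a
    constant of the fibre. *)
Lemma euclidean_div_sheared z s : base c z ->
  euclidean_div G (ins a (height c z + s) z) =
  \sum_k partial (lift a k) (g (lift a k)) (ins a s z) +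
  (partial a (g a) (ins a s z) -
   \sum_k partial k (height c) z * partial a (g (lift a k)) (ins a s z)).
Proof.
move=> Bz; have cz : cylinder c (ins a s z) by rewrite /cylinder /= params_ins.
rewrite /euclidean_div (bigD1_ord a) //= addrCA; congr (_ + _).
  by rewrite partial_sheared_axis // shear_ins.
rewrite -sumrB; apply: eq_bigr => k _.
rewrite partial_sheared_axis // partial_sheared_lift // shear_ins params_ins.
by ring.
Qed.

(** After translating by the height the half-line ends at 0. There the axis derivatives leave
    boundary values, which make up the flux, while the tangential derivatives remain and vanish only
    after integration over the base. *)
Lemma fiber_div z : base c z ->
  \int[mu]_s (chi (ins a s z) * euclidean_div G (ins a s z)) =
  \sum_k \int[mu]_s (half e s * partial (lift a k) (g (lift a k)) (ins a s z)) +
  sgn R e * graph_flux c G z.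
Proof.
move=> Bz.
have cD : continuous (fun s => euclidean_div G (ins a s z)).
  move=> s; apply: (@continuous_sum _ _ _ (fun i s => partial i (G i) (ins a s z))) => i.
  apply: (@continuous_comp _ _ _ (fun s => ins a s z) (partial i (G i))).
    exact: continuous_ins.
  exact: (GC1 i (x := ins a s z) I).2.
have [C sD] : exists C, forall s, euclidean_div G (ins a s z) != 0 -> `|s| <= C.
  have [C hC] := compact_bounded_supp euclidean_div_out.
  by exists C => s /hC/(_ a); rewrite ins_axis.
have E1 s : chi (ins a s z) * euclidean_div G (ins a s z) =
   half e (s - height c z) * euclidean_div G (ins a s z).
  have [Ks|/euclidean_div_out ->] := pselect (K (ins a s z)); last by rewrite !mulr0.
  by rewrite chiE // params_ins ins_axis.
under eq_Rintegral do rewrite E1.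
rewrite (Rintegral_half_shift e (height c z) cD sD).
under eq_Rintegral do rewrite euclidean_div_sheared //.
have cp i j := cbm_partial j (gC1 i) (gsupp i).
have cs k : cbm (fun x => - (partial k (height c) z * partial a (g (lift a k)) x)).
  by apply: cbmN; exact: cbmZ.
rewrite -(@half_fiber_sum R e a _ 2 (fun k => partial (lift a k) (g (lift a k)))); last first.
  by move=> k; exact: cp.
under eq_Rintegral do rewrite -sumrN.
have cS := cbm_sum (fun k => cp (lift a k) (lift a k)).
apply: (etrans (half_fiberD e a z cS (cbmD (cp a a) (cbm_sum cs)))).
congr (_ + _).
apply: (etrans (half_fiberD e a z (cp a a) (cbm_sum cs))).
rewrite (half_fiber_sum e a z cs) fiber_half_partial // /graph_flux asboolT // mulrDr.
have gE i : g i (ins a 0 z) = G i (graph_point c z).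
  by rewrite shearedE ?shear_ins ?addr0 // /cylinder /= params_ins.
rewrite gE; congr (_ + _); rewrite mulrN mulr_sumr -sumrN; apply: eq_bigr => k _.
under eq_Rintegral do rewrite -mulNr.
by rewrite (half_fiberZ e a z _ (cp _ _)) fiber_half_partial // gE; ring.
Qed.

(** [chi] will be the indicator of the volume. It is known to be a half-space indicator in the
    sheared picture only on [K], and [K] carries the field. *)
Theorem local_divergence :
  vol (fun x => chi x * euclidean_div G x) =
  Rintegral (mu \x mu)%E setT (fun p => sgn R e * graph_flux c G (point2 p)).
Proof.
have cp i j := cbm_partial j (gC1 i) (gsupp i).
pose F (x : 'rV[R]_3) := chi x * euclidean_div G x.
pose T k (x : 'rV[R]_3) := half e (x 0 a) * partial (lift a k) (g (lift a k)) x.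
have cT k : cbm (T k) by exact: cbm_half.
(* The tangential terms have volume integral 0. Subtracting them beforehand leaves a function whose
   integral along every single fibre is the flux at its base point. *)
pose H (x : 'rV[R]_3) := F x - \sum_k T k x.
have cH : cbm H by apply: cbmD => //; apply: cbmN; exact: cbm_sum.
have vT k : vol (T k) = 0 by exact: vol_half_partial.
have -> : vol F = vol H.
  by rewrite volD // ?volN ?vol_sum ?big1 ?subr0 //; [exact: cbm_sum|apply: cbmN; exact: cbm_sum].
have HE p : \int[mu]_s H (ins a s (point2 p)) = sgn R e * graph_flux c G (point2 p).
  have i1 f : cbm f -> mu.-integrable setT (EFin \o (fun s => f (ins a s (point2 p)))).
    by move=> cf; apply: integrable_cbm1; exact: cbm1_ins.
  rewrite RintegralB //; [|exact: i1|by apply: (i1 (fun x => \sum_k T k x)); exact: cbm_sum].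
  have -> : \int[mu]_s \sum_k T k (ins a s (point2 p)) =
     \sum_k \int[mu]_s (half e s * partial (lift a k) (g (lift a k)) (ins a s (point2 p))).
    rewrite -(@half_fiber_sum R e a _ 2 (fun k => partial (lift a k) (g (lift a k)))); last first.
      by move=> k; exact: cp.
    by apply: eq_Rintegral => s _; rewrite mulr_sumr; apply: eq_bigr => k _; rewrite /T ins_axis.
  have [Bz|nBz] := pselect (base c (point2 p)).
    by rewrite fiber_div // addrAC subrr add0r.
  rewrite /graph_flux asboolF // mulr0.
  rewrite big1 => [|k _].
    rewrite subr0 (_ : (fun _ => _) = cst 0) ?Rintegral_cst ?mul0r //.
    apply/funext => s; rewrite /F euclidean_div_out ?mulr0 // => /Kbox/box_base.
    by rewrite params_ins.
  rewrite (_ : (fun _ => _) = cst 0) ?Rintegral_cst ?mul0r //.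
  apply/funext => s; rewrite (partial_sheared_out cK Kbox (suppG _)) ?mulr0 //.
  by rewrite /cylinder /= params_ins.
by rewrite (vol_axis a) //; under eq_Rintegral do rewrite HE.
Qed.

End local_divergence.

(** * C^1 partitions of unity *)

Section bumps.
Context (R : realType).

(** A C^1 substitute for the usual exp(-1/t): zero on the negative half-line, positive on the
    positive one. *)
Definition ramp2 (t : R) : R := Num.max t 0 ^+ 2.

Lemma is_derive_ramp2 (x : R) : is_derive x 1 ramp2 (2 * Num.max x 0).
Proof.
have [x0|x0|->] := ltgtP x 0.
- have : \forall y \near x, cst 0 y = ramp2 y.
    have : \forall y \near x, y < 0 by exact: (@cvgr_lt _ _ (nbhs x) _ id _ (@cvg_id _ _) 0 x0).
    by apply: filterS => y y0; rewrite /ramp2 max_r ?expr0n //; exact: ltW.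
  by move=> /near_eq_is_derive; apply; rewrite mulr0; exact: is_derive_cst.
- have : \forall y \near x, y ^+ 2 = ramp2 y.
    have : \forall y \near x, 0 < y by exact: (@cvgr_gt _ _ (nbhs x) _ id _ (@cvg_id _ _) 0 x0).
    by apply: filterS => y y0; rewrite /ramp2 max_l //; exact: ltW.
  move=> /near_eq_is_derive; apply.
  split; first exact: exprn_derivable.
  by rewrite exp_derive /GRing.scale /= mulr1 expr1.
- rewrite mulr0.
  have cv : (fun h : R => h^-1 *: (ramp2 (h *: 1 + 0) - ramp2 0)) @ 0^' --> 0.
    apply/cvgr0Pnorm_le => e e0; near=> h.
    rewrite /ramp2 addr0 maxxx expr0n subr0 /GRing.scale /= mulr1.
    have h0 : h != 0 by near: h; exact: nbhs_dnbhs_neq.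
    have [hp|hn] := leP h 0; first by rewrite expr0n mulr0 normr0 ltW.
    by rewrite expr2 mulrA mulVf // mul1r; near: h; exact: dnbhs0_le.
  by split; [apply/cvg_ex; exists 0|exact: cvg_lim cv].
Unshelve. all: by end_near. Qed.

Definition smoothstep (t : R) : R := ramp2 t / (ramp2 t + ramp2 (1 - t)).

Lemma ramp2_ge0 t : 0 <= ramp2 t. Proof. exact: sqr_ge0. Qed.

Lemma ramp2_le0 t : t <= 0 -> ramp2 t = 0.
Proof. by move=> t0; rewrite /ramp2 max_r ?expr0n. Qed.

Lemma ramp2_gt0 t : 0 < t -> 0 < ramp2 t.
Proof. by move=> t0; rewrite /ramp2 max_l ?exprn_gt0 // ltW. Qed.

Lemma smoothstep_den t : 0 < ramp2 t + ramp2 (1 - t).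
Proof.
have [t0|t0] := ltP 0 t; first by rewrite ltr_pwDl ?ramp2_gt0 ?ramp2_ge0.
by rewrite ltr_wpDl ?ramp2_gt0 ?ramp2_ge0 // subr_gt0 (le_lt_trans t0).
Qed.

Lemma smoothstep_ge0 t : 0 <= smoothstep t.
Proof. by rewrite divr_ge0 ?ramp2_ge0 // ltW // smoothstep_den. Qed.

Lemma smoothstep_le1 t : smoothstep t <= 1.
Proof. by rewrite ler_pdivrMr ?smoothstep_den // mul1r lerDl ramp2_ge0. Qed.

Lemma smoothstep_le0 t : t <= 0 -> smoothstep t = 0.
Proof. by move=> t0; rewrite /smoothstep ramp2_le0 ?mul0r. Qed.

Lemma smoothstep_ge1 t : 1 <= t -> smoothstep t = 1.
Proof.
move=> t1; rewrite /smoothstep (@ramp2_le0 (1 - t)) ?subr_le0 // addr0 divff //.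
by rewrite gt_eqF // ramp2_gt0 // (lt_le_trans ltr01).
Qed.

Lemma C1_on_ramp2 n (U : set 'rV[R]_n) f : open U -> C1_on U f ->
  C1_on U (fun x => ramp2 (f x)).
Proof.
move=> oU cf; apply: C1_on_comp1 => // x Ux.
  by have [] := is_derive_ramp2 (f x).
rewrite (_ : derive1 ramp2 = fun t => 2 * Num.max t 0).
  apply: (@continuousM _ _ (cst (2:R)) (fun t : R => Num.max t 0)).
    exact: cst_continuous.
  by apply: continuous_max; [exact: cvg_id|exact: cst_continuous].
apply/funext => t; rewrite derive1E.
exact: (derive_val (is_derive := is_derive_ramp2 t)).
Qed.

Lemma C1_on_smoothstep n (U : set 'rV[R]_n) f : open U -> C1_on U f ->
  C1_on U (fun x => smoothstep (f x)).
Proof.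
move=> oU cf.
have cden := C1_onD oU (C1_on_ramp2 oU cf)
  (C1_on_ramp2 oU (C1_onB oU (@C1_on_cst R n U 1) cf)).
apply: (C1_onM oU (C1_on_ramp2 oU cf) (C1_onV oU cden _)) => x _.
by rewrite gt_eqF // smoothstep_den.
Qed.

(** Squaring the coordinate differences avoids the corner of the absolute value. The argument of
    [smoothstep] is at least 1 for differences up to e/2 and at most 0 from e/sqrt 2 on. *)
Definition bump n (p : 'rV[R]_n) (e : R) (x : 'rV[R]_n) : R :=
  \prod_i smoothstep (2 - 4 * e ^- 2 * ((x 0 i - p 0 i) * (x 0 i - p 0 i))).

Lemma bump_C1 n (p : 'rV[R]_n) e : C1_on setT (bump p e).
Proof.
have oT := @openT 'rV[R]_n.
apply: (C1_on_prod oT) => i; apply: (C1_on_smoothstep oT).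
have cd : C1_on setT (fun x : 'rV[R]_n => x 0 i - p 0 i).
  exact: (C1_onB oT (C1_on_coord i) (C1_on_cst (p 0 i))).
exact: (C1_onB oT (C1_on_cst 2) (C1_onM oT (C1_on_cst (4 * e ^- 2)) (C1_onM oT cd cd))).
Qed.

Lemma bump_ge0 n (p : 'rV[R]_n) e x : 0 <= bump p e x.
Proof. by apply: prodr_ge0 => i _; exact: smoothstep_ge0. Qed.

Lemma bump_le1 n (p : 'rV[R]_n) e x : bump p e x <= 1.
Proof.
rewrite /bump; apply: prodr_ile1 => i _.
by rewrite smoothstep_ge0 smoothstep_le1.
Qed.

Lemma bump_eq1 n (p x : 'rV[R]_n) (e : R) : 0 < e ->
  (forall i, `|p 0 i - x 0 i| < e / 2) -> bump p e x = 1.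
Proof.
move=> e0 H; rewrite /bump big1 // => i _; apply: smoothstep_ge1.
have := H i; rewrite distrC => /ltW h.
have : (x 0 i - p 0 i) * (x 0 i - p 0 i) <= (e / 2) ^+ 2.
  rewrite -expr2 -real_normK ?num_real // ler_pXn2r ?nnegrE //; lra.
move=> h2; rewrite lerBrDr -lerBrDl.
have -> : 2 - 1 = 4 * e ^- 2 * (e / 2) ^+ 2 :> R.
  by field; rewrite gt_eqF.
by rewrite ler_wpM2l // mulr_ge0 // invr_ge0 exprn_ge0 // ltW.
Qed.

Lemma bump_supp n (p : 'rV[R]_n) (e : R) : 0 < e ->
  exists K, [/\ compact K, K `<=` [set x : 'rV[R]_n | forall i, `|p 0 i - x 0 i| < e] &
    forall x, ~ K x -> bump p e x = 0].
Proof.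
move=> e0.
(* The factor 3/4 lies between 1/sqrt 2 and 1: outside this closed cube the bump is already 0, and
   the cube is still contained in the open one of radius [e]. *)
exists [set x : 'rV[R]_n | forall i, `[p 0 i - 3 / 4 * e, p 0 i + 3 / 4 * e]%classic (x 0 i)].
split.
- exact: (@rV_compact _ _ (fun i => `[p 0 i - 3 / 4 * e, p 0 i + 3 / 4 * e]%classic)
   (fun=> @segment_compact _ _ _)).
- move=> x Kx i; have := Kx i; rewrite /= in_itv /= => /andP[h1 h2].
  by rewrite ltr_norml; apply/andP; split; lra.
- move=> x /existsNP[i]; rewrite /= in_itv /= => /negP h.
  rewrite /bump (bigD1 i) //= smoothstep_le0 ?mul0r //.
  have : (3 / 4 * e) ^+ 2 <= (x 0 i - p 0 i) * (x 0 i - p 0 i).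
    rewrite -expr2 -[leRHS]real_normK ?num_real //.
    apply: lerXn2r; rewrite ?nnegrE ?normr_ge0 //; first by rewrite mulr_ge0 // ltW.
    rewrite leNgt; apply/negP; rewrite ltr_norml => /andP[h1 h2].
    by move/negP: h; apply; apply/andP; split; lra.
  move=> h2; rewrite subr_le0.
  apply: (@le_trans _ _ (4 * e ^- 2 * (3 / 4 * e) ^+ 2)).
    have -> : 4 * e ^- 2 * (3 / 4 * e) ^+ 2 = 9 / 4 :> R by field; rewrite gt_eqF.
    lra.
  by rewrite ler_wpM2l // mulr_ge0 // invr_ge0 exprn_ge0 // ltW.
Qed.

Lemma sum_telescope_prod (phi : nat -> R) m :
  \sum_(k < m) phi k * \prod_(j < k) (1 - phi j) = 1 - \prod_(j < m) (1 - phi j).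
Proof.
elim: m => [|m IH]; first by rewrite !big_ord0 subrr.
by rewrite !big_ord_recr /= IH; ring.
Qed.

(** The weights are phi_k times the product of the earlier 1 - phi_j. By telescoping they sum to 1
    wherever some phi_k is 1, which happens on the open set covered by the half-size cubes. A sum
    equal to 1 on a neighbourhood of [K], and not just on [K], can be used under derivatives. *)
Theorem C1_partition_of_unity n (J : Type) (O : J -> set 'rV[R]_n) (K : set 'rV[R]_n) :
  compact K -> (forall j, open (O j)) -> (forall x, K x -> exists j, O j x) ->
  exists (m : nat) (j : 'I_m -> J) (w : 'I_m -> 'rV[R]_n -> R) (U : set 'rV[R]_n),
    [/\ forall k, [/\ C1_on setT (w k), forall x, 0 <= w k x &
          exists L, [/\ compact L, L `<=` O (j k) & forall x, ~ L x -> w k x = 0]],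
        open U, K `<=` U & forall x, U x -> \sum_k w k x = 1].
Proof.
move=> cK oO KO.
have /choice[ch chP] (x : 'rV[R]_n) : exists je : option (J * R),
    K x -> if je is Some (j, e) then
      0 < e /\ (fun y : 'rV[R]_n => forall i, `|x 0 i - y 0 i| < e) `<=` O j else False.
  have [Kx|nKx] := pselect (K x); last by exists None.
  have [j Oj] := KO x Kx.
  have /nbhs_rV_ball[e e0 sO] := open_nbhs_nbhs (conj (oO j) Oj).
  by exists (Some (j, e)).
pose rad (x : 'rV[R]_n) := if ch x is Some (_, e) then e else 1.
pose cov (x : 'rV[R]_n) := [set y : 'rV[R]_n | forall i, `|x 0 i - y 0 i| < rad x / 2].
have ocov x : K x -> open (cov x).
  move=> _; rewrite (_ : cov x = [set y | forall i, x 0 i - rad x / 2 < y 0 i < x 0 i + rad x / 2]).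
    exact: open_box_rV.
  by apply/seteqP; split => y h i; have := h i; rewrite distrC ltr_distl.
have cK' : cover_compact K by rewrite -compact_cover.
have [x Kx|D DK Kcov] := cK' _ K cov ocov.
  exists x => // i; rewrite subrr normr0.
  by have := chP x Kx; rewrite /rad; case: (ch x) => [[j e]|//] [e0 _]; rewrite divr_gt0.
pose s := finmap.enum_fset D.
have sK x : x \in s -> K x by move=> xs; have := DK x xs; rewrite inE.
(* An empty cover means that [K] is empty. Then [J] may be empty as well, so no default index is
   available and the empty family is returned. *)
have [s0|/eqP s0] := eqVneq s [::].
  have f0 (T : Type) : 'I_0 -> T by case.
  exists 0, (f0 _), (f0 _), set0.
  split; [by case|exact: open0|move=> x /Kcov[y] /=|by []].
  by rewrite -[_ \in _]/(y \in s) s0.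
pose x0 := head 0 s.
pose P k := nth x0 s k.
have KP k : K (P k).
  apply: sK; have [ks|ks] := ltnP k (size s); first exact: mem_nth.
  by rewrite /P nth_default // /x0; case: (s) s0 => // a l _; rewrite mem_head.
have [j1 _] : exists j : J, True.
  by have := chP _ (KP 0); case: (ch _) => [[j e] _|//]; exists j.
pose jj k := if ch (P k) is Some (j, _) then j else j1.
pose phi k := bump (P k) (rad (P k)).
have rad0 k : 0 < rad (P k).
  by have := chP _ (KP k); rewrite /rad; case: (ch _) => [[j e] []|].
have oT := @openT 'rV[R]_n.
exists (size s), (fun k => jj k), (fun k x => phi k x * \prod_(i < k) (1 - phi i x)),
  (\bigcup_(k in [set k | (k < size s)%N]) cov (P k)).
split.
- move=> k; split.
  + apply: (C1_onM oT (bump_C1 _ _)); apply: (C1_on_prod oT) => i.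
    exact: (C1_onB oT (C1_on_cst 1) (bump_C1 _ _)).
  + move=> x; rewrite mulr_ge0 ?bump_ge0 // prodr_ge0 // => i _.
    by rewrite subr_ge0 bump_le1.
  + have [L [cL Lr L0]] := @bump_supp _ (P k) _ (rad0 k).
    exists L; split => // [x /Lr|x /L0 Lx]; last by rewrite /phi Lx mul0r.
    have := chP _ (KP k); rewrite /jj /rad; case: (ch _) => [[j e] [_]|//]; exact.
- by apply: bigcup_open => k _; apply: ocov; exact: KP.
- move=> x /Kcov[y yD cy]; exists (index y s); first by rewrite /= index_mem.
  by rewrite /P nth_index.
- move=> x [k /= ks cx]; rewrite (@sum_telescope_prod (fun k => phi k x)).
  rewrite (bigD1 (Ordinal ks)) //= {1}/phi bump_eq1 ?subrr ?mul0r ?subr0 //.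
Qed.

End bumps.

(** * The position of a volume relative to a chart of its boundary *)

Definition side (R : realType) (e : bool) (V : set 'rV[R]_3) (c : graph_chart R) : Prop :=
  forall y, box c y -> (V y <->
    (if e then y 0 (axis c) <= height c (params c y)
     else height c (params c y) <= y 0 (axis c))).

Section chart_geometry.
Context (R : realType).
Implicit Types (V S : set 'rV[R]_3) (c : graph_chart R) (x y : 'rV[R]_3).

Definition elevation c x : R := x 0 (axis c) - height c (params c x).

Lemma continuous_elevation c x : C1_on (base c) (height c) -> box c x ->
  {for x, continuous (elevation c)}.
Proof.
move=> hC1 bx; have cx : cylinder c x by exact: box_base.
apply: (@continuousD _ _ _ (fun y => y 0 (axis c)) (fun y => - height c (params c y))).
  exact: coord_continuous.
apply: (@continuousN _ _ _ (fun y => height c (params c y))).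
exact: C1_on_continuous (C1_on_height_params hC1) cx.
Qed.

Lemma sideE e V c y : side e V c -> box c y ->
  V y <-> (if e then elevation c y <= 0 else 0 <= elevation c y).
Proof. by move=> sV /sV ->; case: e {sV}; rewrite /elevation ?subr_le0 ?subr_ge0. Qed.

Lemma near_box c x : box c x -> \forall y \near x, box c y.
Proof. by move=> bx; exact: (near_open (@open_box _ c) bx (fun y h => h)). Qed.

Lemma near_elevation_gt0 c x : C1_on (base c) (height c) -> box c x ->
  0 < elevation c x -> \forall y \near x, box c y /\ 0 < elevation c y.
Proof.
move=> hC1 bx x0; near=> y; split; near: y; first exact: near_box.
exact: (@cvgr_gt _ _ (nbhs x) _ (elevation c) _ (continuous_elevation hC1 bx) 0 x0).
Unshelve. all: by end_near. Qed.

Lemma near_elevation_lt0 c x : C1_on (base c) (height c) -> box c x ->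
  elevation c x < 0 -> \forall y \near x, box c y /\ elevation c y < 0.
Proof.
move=> hC1 bx x0; near=> y; split; near: y; first exact: near_box.
exact: (@cvgr_lt _ _ (nbhs x) _ (elevation c) _ (continuous_elevation hC1 bx) 0 x0).
Unshelve. all: by end_near. Qed.

Lemma near_line x (A : set 'rV[R]_3) (a : 'I_3) : nbhs x A ->
  exists2 s : R, 0 < s & A (x + s *: delta_mx 0 a) /\ A (x - s *: delta_mx 0 a).
Proof.
move=> /nbhs_rV_ball[e e0 sA]; exists (e / 2); first by rewrite divr_gt0.
have H s : `|s| < e -> A (x + s *: delta_mx 0 a).
  move=> se; apply: sA => i; rewrite !mxE opprD addrA subrr sub0r normrN.
  by case: (_ && _); rewrite ?mulr1 ?mulr0 ?normr0.
split; first by apply: H; rewrite gtr0_norm; lra.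
by rewrite -scaleNr; apply: H; rewrite normrN gtr0_norm; lra.
Qed.

Lemma elevation_line c x s :
  elevation c (x + s *: delta_mx 0 (axis c)) = elevation c x + s.
Proof.
rewrite /elevation (_ : params c _ = params c x); first by rewrite !mxE !eqxx mulr1; ring.
by apply/rowP => k; rewrite !mxE eq_sym (negbTE (neq_lift _ _)) andbF mulr0 addr0.
Qed.

(** Off the graph, either the volume or its complement is a neighbourhood of the point. On the graph
    the point belongs to the volume, but an arbitrarily small move along the axis leaves it. *)
Lemma side_surface_chart e V c : C1_graph_chart c -> side e V c ->
  surface_chart (frontier V) c.
Proof.
move=> C1c sV; split => // x bx; have hC1 := C1c.1.
have sVE y : box c y -> _ := sideE sV.
have -> : x 0 (axis c) = height c (params c x) <-> elevation c x = 0.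
  by rewrite /elevation; split => [->|/eqP]; rewrite ?subrr // subr_eq0 => /eqP.
split=> [[clV nintV]|x0].
  have [xl|xg|//] := ltgtP (elevation c x) 0.
    have near_x := near_elevation_lt0 hC1 bx xl.
    case: e sV sVE => sV sVE.
      exfalso; apply: nintV; apply: filterS near_x => y [By yl]; apply/sVE => //.
      exact: ltW.
    have [y [Vy [By yl]]] := clV _ near_x.
    by move: ((sVE y By).1 Vy); rewrite leNgt yl.
  have near_x := near_elevation_gt0 hC1 bx xg.
  case: e sV sVE => sV sVE.
    have [y [Vy [By yl]]] := clV _ near_x.
    by move: ((sVE y By).1 Vy); rewrite leNgt yl.
  exfalso; apply: nintV; apply: filterS near_x => y [By yl]; apply/sVE => //.
  exact: ltW.
split.
  apply: subset_closure; apply/sVE => //; rewrite x0.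
  by case: (e).
move=> intV; have nx : nbhs x (V `&` box c) by apply: filterI => //; exact: near_box.
have [s s0 [[V1 B1] [V2 B2]]] := near_line (axis c) nx.
case: e sV sVE => sV sVE.
  by move: ((sVE _ B1).1 V1); rewrite elevation_line x0 add0r leNgt s0.
move: ((sVE _ B2).1 V2); rewrite -scaleNr elevation_line x0 add0r oppr_ge0 leNgt.
by rewrite s0.
Qed.

(** The parameters sent into [V] form a subset of [0, 1] that is closed, since [V] is, and open,
    since a point of [V] off the frontier is interior; connectedness of the interval concludes. *)
Lemma connected_path_set V (gamma : R -> 'rV[R]_3) : closed V ->
  (forall t : R, 0 <= t <= 1 -> {for t, continuous gamma}) ->
  (forall t : R, 0 <= t <= 1 -> ~ frontier V (gamma t)) ->
  V (gamma 0) -> V (gamma 1).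
Proof.
move=> clV cg ng V0.
have conn := @segment_connected R 0 1.
have intV t : 0 <= t <= 1 -> V (gamma t) -> V° (gamma t).
  move=> t01 Vt; apply: contrapT => nI; apply: (ng t t01); split => //.
  exact: subset_closure.
pose B := `[0, 1]%classic `&` [set t | V (gamma t)].
have BE : B = `[0, 1]%classic.
  apply: conn.
  - by exists 0; split => //; rewrite /= in_itv /= lexx ler01.
  - exists ([set t | V (gamma t)]°); first exact: open_interior.
    apply/seteqP; split => [t [t01 Vt]|t [t01 /interior_subset Vt]] //.
    split => //; move: (t01); rewrite /= in_itv /= => t01'.
    exact: (cg t t01' _ (intV t t01' Vt)).
  - exists (~` ([set t | ~ V (gamma t)]°)).
      by rewrite closedC; exact: open_interior.
    apply/seteqP; split => [t [t01 Vt]|t [t01 Vt]]; split => //.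
      by move=> /interior_subset.
    apply: contrapT => nVt; apply: Vt; move: t01; rewrite /= in_itv /= => t01'.
    apply: (cg t t01' (~` V)); apply: open_nbhs_nbhs; split => //.
    by rewrite openC.
have : B 1 by rewrite BE /= in_itv /= ler01 lexx.
by case.
Qed.

(* The vertical coordinate is an affine interpolation between the graph and
   the face [b] of the box, so that the region becomes convex. *)
Lemma one_sided_region V c (b : R) (P : R -> Prop) : closed V -> C1_graph_chart c ->
  (forall z t : R, lo c 0 (axis c) < z < hi c 0 (axis c) -> 0 < t < 1 ->
     lo c 0 (axis c) < (1 - t) * z + t * b < hi c 0 (axis c) /\ (1 - t) * z + t * b != z) ->
  (forall x, box c x -> P (elevation c x) ->
     exists2 t : R, 0 < t < 1 & x 0 (axis c) = (1 - t) * height c (params c x) + t * b) ->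
  (forall x, box c x -> elevation c x != 0 -> ~ frontier V x) ->
  forall p q, box c p -> box c q -> P (elevation c p) -> P (elevation c q) -> V p -> V q.
Proof.
move=> clV [hC1 hbox] hb hP nfr p q bp bq Pp Pq Vp.
have [tp tp01 pE] := hP p bp Pp; have [tq tq01 qE] := hP q bq Pq.
pose z (t : R) := (1 - t) *: params c p + t *: params c q.
pose tau (t : R) := (1 - t) * tp + t * tq.
pose gamma (t : R) := ins (axis c) ((1 - tau t) * height c (z t) + tau t * b) (z t).
have conv (t u v l h : R) : 0 <= t <= 1 -> l < u < h -> l < v < h ->
    l < (1 - t) * u + t * v < h.
  move=> /andP[t0 t1] /andP[u0 u1] /andP[v0 v1].
  have [->|tn0] := eqVneq t 0; first by apply/andP; split; lra.
  have tp0 : 0 < t by rewrite lt_def tn0.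
  have t1' : 0 <= 1 - t by rewrite subr_ge0.
  have [ul hu vl hv] : [/\ 0 < u - l, 0 < h - u, 0 < v - l & 0 < h - v].
    by rewrite !subr_gt0.
  have h1 := mulr_ge0 t1' (ltW ul); have h2 := mulr_ge0 t1' (ltW hu).
  have h3 := mulr_gt0 tp0 vl; have h4 := mulr_gt0 tp0 hv.
  by apply/andP; split; lra.
have zB t : 0 <= t <= 1 -> base c (z t).
  move=> t01 k; have := box_base bp k; have := box_base bq k; rewrite !mxE => ? ?.
  exact: conv.
have tau01 t : 0 <= t <= 1 -> 0 < tau t < 1 by move=> t01; exact: conv.
have hB (y : 'rV[R]_2) : base c y -> lo c 0 (axis c) < height c y < hi c 0 (axis c).
  by move=> /hbox/(_ (axis c)); rewrite graph_pointE ins_axis.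
have gB t : 0 <= t <= 1 -> box c (gamma t).
  move=> t01 i; have [k ->|->] := unliftP (axis c) i.
    by rewrite ins_lift; exact: zB.
  by rewrite ins_axis; have [] := hb _ _ (hB _ (zB t t01)) (tau01 t t01).
have g0 : gamma 0 = p.
  rewrite /gamma /tau /z subr0 scale1r scale0r addr0 mul0r addr0 mul1r -pE.
  exact: ins_params.
have g1 : gamma 1 = q.
  rewrite /gamma /tau /z subrr scale1r scale0r add0r mul0r add0r mul1r -qE.
  exact: ins_params.
rewrite -g1; apply: (@connected_path_set _ gamma clV); last by rewrite g0.
  move=> t t01.
  have c1m : {for t, continuous (fun s : R => 1 - s)}.
    by apply: cvgB; [exact: cvg_cst|exact: cvg_id].
  have caff (u v : R) : {for t, continuous (fun s : R => (1 - s) * u + s * v)}.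
    apply: (@continuousD _ _ _ (fun s : R => (1 - s) * u) (fun s : R => s * v)).
      apply: (@continuousM _ _ (fun s : R => 1 - s) (cst u)); last exact: cst_continuous.
      exact: c1m.
    by apply: (@continuousM _ _ (fun s : R => s) (cst v)); last exact: cst_continuous.
  have czk k : {for t, continuous (fun s => z s 0 k)}.
    rewrite (_ : (fun s => z s 0 k) =
      fun s => (1 - s) * params c p 0 k + s * params c q 0 k); first exact: caff.
    by apply/funext => s; rewrite !mxE.
  have cz : {for t, continuous z} by exact: continuous_row.
  have cf : {for t, continuous (fun s => height c (z s))}.
    apply: (@continuous_comp _ _ _ z (height c)) => //.
    exact: C1_on_continuous hC1 (zB t t01).
  apply: continuous_row => i; have [k ->|->] := unliftP (axis c) i.
    rewrite (_ : (fun s => _) = fun s => z s 0 k) //.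
    by apply/funext => s; rewrite ins_lift.
  rewrite (_ : (fun s => _) = fun s => (1 - tau s) * height c (z s) + tau s * b); last first.
    by apply/funext => s; rewrite ins_axis.
  apply: (@continuousD _ _ _ (fun s => (1 - tau s) * height c (z s)) (fun s => tau s * b)).
    apply: (@continuousM _ _ (fun s => 1 - tau s) (fun s => height c (z s))) => //.
    by apply: cvgB; [exact: cvg_cst|exact: caff].
  by apply: (@continuousM _ _ tau (cst b)); [exact: caff|exact: cst_continuous].
move=> t t01; apply: nfr; first exact: gB.
have [_ ne] := hb _ _ (hB _ (zB t t01)) (tau01 t t01).
by rewrite /elevation ins_axis params_ins subr_eq0.
Qed.

Lemma elevation_pos_region V c : closed V -> C1_graph_chart c ->
  (forall x, box c x -> elevation c x != 0 -> ~ frontier V x) ->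
  forall p q, box c p -> box c q -> 0 < elevation c p -> 0 < elevation c q -> V p -> V q.
Proof.
move=> clV C1c nfr; pose b := hi c 0 (axis c).
apply: (@one_sided_region V c b (fun e => 0 < e) clV C1c) => //.
- move=> z t /andP[z0 z1] /andP[t0 t1].
  have bz : 0 < b - z by rewrite subr_gt0.
  have t1' : 0 < 1 - t by rewrite subr_gt0.
  have h1 := mulr_gt0 t0 bz; have h2 := mulr_gt0 t1' bz.
  split; first by apply/andP; split; rewrite -/b; lra.
  by rewrite gt_eqF //; lra.
- move=> x bx; rewrite /elevation; set f := height _ _; set y := x 0 _ => yf.
  have yb : y < b by have /andP[] := bx (axis c).
  have bf : 0 < b - f by lra.
  (* The solution [t] of [y = (1 - t) * f + t * b], where [b] is the upper face of the box. *)
  exists ((y - f) / (b - f)).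
    by rewrite divr_gt0 //= ltr_pdivrMr // mul1r; lra.
  by field; rewrite gt_eqF.
Qed.

Lemma elevation_neg_region V c : closed V -> C1_graph_chart c ->
  (forall x, box c x -> elevation c x != 0 -> ~ frontier V x) ->
  forall p q, box c p -> box c q -> elevation c p < 0 -> elevation c q < 0 -> V p -> V q.
Proof.
move=> clV C1c nfr; pose b := lo c 0 (axis c).
apply: (@one_sided_region V c b (fun e => e < 0) clV C1c) => //.
- move=> z t /andP[z0 z1] /andP[t0 t1].
  have bz : 0 < z - b by rewrite subr_gt0.
  have t1' : 0 < 1 - t by rewrite subr_gt0.
  have h1 := mulr_gt0 t0 bz; have h2 := mulr_gt0 t1' bz.
  split; first by apply/andP; split; rewrite -/b; lra.
  by rewrite lt_eqF //; lra.
- move=> x bx; rewrite /elevation; set f := height _ _; set y := x 0 _ => yf.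
  have yb : b < y by have /andP[] := bx (axis c).
  have bf : 0 < f - b by lra.
  exists ((f - y) / (f - b)).
    by rewrite divr_gt0 /= ?ltr_pdivrMr // ?mul1r; lra.
  by field; rewrite gt_eqF.
Qed.

(** A small move along the axis, away from the graph and into the volume, reaches an interior point.
    This will rule out a volume that is locally nothing but its own boundary. *)
Lemma near_side_interior e V c x : C1_graph_chart c -> side e V c -> box c x ->
  V x -> forall A, nbhs x A -> exists2 y, A y & V° y.
Proof.
move=> [hC1 _] sV bx Vx A nA.
have nx : nbhs x (A `&` box c) by apply: filterI => //; exact: near_box.
have [s s0 [[A1 B1] [A2 B2]]] := near_line (axis c) nx.
have ex := (sideE sV bx).1 Vx.
case: e sV ex => sV ex.
  exists (x - s *: delta_mx 0 (axis c)) => //.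
  have : elevation c (x - s *: delta_mx 0 (axis c)) < 0.
    by rewrite -scaleNr elevation_line; lra.
  move=> /(near_elevation_lt0 hC1 B2); apply: filterS => y [By yl].
  by apply/(sideE sV By); exact: ltW.
exists (x + s *: delta_mx 0 (axis c)) => //.
have : 0 < elevation c (x + s *: delta_mx 0 (axis c)).
  by rewrite elevation_line; lra.
move=> /(near_elevation_gt0 hC1 B1); apply: filterS => y [By yl].
by apply/(sideE sV By); exact: ltW.
Qed.

(** A chart of the frontier comes without a side. The regions above and below its graph avoid the
    frontier, so each lies entirely in [V] or entirely outside. If both lay in [V], points of the
    graph would be interior; exactly one in [V] gives the two sides; neither is excluded by the
    chart that the definition of a volume provides. *)
Theorem surface_chart_side V c : volume V -> surface_chart (frontier V) c ->
  (exists z, base c z) -> exists e, side e V c.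
Proof.
move=> [cV volV] [C1c SE] [z Bz].
have clV : closed V by exact: compact_closed.
have [hC1 hbox] := C1c.
have SE' y : box c y -> frontier V y <-> elevation c y = 0.
  move=> By; rewrite (SE y By) /elevation; split => [->|/eqP]; first by rewrite subrr.
  by rewrite subr_eq0 => /eqP.
have nfr y : box c y -> elevation c y != 0 -> ~ frontier V y.
  by move=> By; rewrite (SE' y By) => /eqP.
pose x := graph_point c z; have bx : box c x by exact: hbox.
have ex : elevation c x = 0.
  by rewrite /elevation /x graph_pointE ins_axis params_ins subrr.
have Sx : frontier V x by apply/SE'.
have frV y : frontier V y -> V y by case=> /clV.
have [s s0 [B1 B2]] := near_line (axis c) (near_box bx).
pose p := x + s *: delta_mx 0 (axis c); pose q := x - s *: delta_mx 0 (axis c).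
have ep : 0 < elevation c p by rewrite elevation_line ex add0r.
have eq0 : elevation c q < 0 by rewrite /q -scaleNr elevation_line ex add0r oppr_lt0.
have up := elevation_pos_region clV C1c nfr; have dn := elevation_neg_region clV C1c nfr.
have [Vp|nVp] := pselect (V p); have [Vq|nVq] := pselect (V q).
- exfalso; case: Sx => _; apply.
  apply: filterS (near_box bx) => y By.
  have [yl|yg|/(SE' y By)/frV//] := ltgtP (elevation c y) 0.
    exact: (dn q).
  exact: (up p).
- exists false => y By.
  rewrite -subr_ge0 -/(elevation c y); split=> [Vy|].
    by rewrite leNgt; apply/negP => yl; apply: nVq; exact: (dn y).
  rewrite le_eqVlt => /predU1P[/esym/(SE' y By)/frV//|yg]; exact: (up p).
- exists true => y By.
  rewrite -subr_le0 -/(elevation c y); split=> [Vy|].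
    by rewrite leNgt; apply/negP => yl; apply: nVp; exact: (up y).
  rewrite le_eqVlt => /predU1P[/(SE' y By)/frV//|yg]; exact: (dn q).
(* With both regions outside, [V] would be locally contained in its frontier; the one-sided chart
   [c'] at [x] supplies interior points of [V] close to [x]. *)
- exfalso; have [c' [C1c' bx' sd]] := volV x Sx.
  have [e sV] : exists e, side e V c' by case: sd => ?; [exists true|exists false].
  have [y By iVy] := near_side_interior C1c' sV bx' (frV _ Sx) (near_box bx).
  have Vy := interior_subset iVy.
  have [yl|yg|/(SE' y By)] := ltgtP (elevation c y) 0.
  + by apply: nVq; exact: (dn y).
  + by apply: nVp; exact: (up y).
  + by case.
Qed.

End chart_geometry.

(** * The outward unit normal of a graph *)

Section outward_normal.
Context (R : realType).

Lemma is_derive_line n (f : 'rV[R]_n -> R) y d : differentiable f y ->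
  is_derive (0 : R) (1 : R) (fun s : R => f (y + s *: d)) ('D_d f y).
Proof.
move=> /(@diff_derivable _ _ _ _ _ d) df.
have E : (fun h : R => h^-1 *: ((fun s : R => f (y + s *: d)) (h *: 1 + 0) -
     (fun s : R => f (y + s *: d)) 0)) = (fun h : R => h^-1 *: (f (h *: d + y) - f y)).
  by apply/funext => h; rewrite addr0 scale0r addr0 /GRing.scale /= mulr1 [y + _]addrC.
by split; rewrite /derivable /derive E.
Qed.

Lemma derive_partials n (f : 'rV[R]_n -> R) y d : differentiable f y ->
  'D_d f y = \sum_i d 0 i * partial i f y.
Proof.
move=> df; rewrite deriveE // {1}[d]row_sum_delta linear_sum /=.
by apply: eq_bigr => i _; rewrite linearZ /= /partial deriveE.
Qed.

Lemma partial_graph_point (c : graph_chart R) k y i : C1_on (base c) (height c) ->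
  base c y -> differentiable (fun z => graph_point c z 0 i) y /\
  partial k (fun z => graph_point c z 0 i) y =
  if unlift (axis c) i is Some k' then (k' == k)%:R else partial k (height c) y.
Proof.
move=> hC1 By; case: unliftP => [k' ->|->].
  have -> : (fun z => graph_point c z 0 (lift (axis c) k')) = fun z => z 0 k'.
    by apply/funext => z; rewrite graph_pointE ins_lift.
  by rewrite partial_coord; split => //; exact: differentiable_coord.
have -> : (fun z => graph_point c z 0 (axis c)) = height c.
  by apply/funext => z; rewrite graph_pointE ins_axis.
by split => //; exact: (hC1 _ By).1.
Qed.

Lemma tangent_graph (c : graph_chart R) (S : set 'rV[R]_3) y k :
  surface_chart S c -> base c y ->
  tangent_vector S (graph_point c y)
    (\row_i partial k (fun z => graph_point c z 0 i) y).
Proof.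
move=> [[hC1 hbox] SE] By.
exists (fun s : R => graph_point c (y + s *: delta_mx 0 k)); split.
- by rewrite scale0r addr0.
- have cl : {for (0 : R), continuous (fun s : R => y + s *: delta_mx 0 k)}.
    apply: continuous_row => i.
    rewrite (_ : (fun s => _) = fun s : R => y 0 i + s * (delta_mx 0 k : 'rV[R]_2) 0 i).
      apply: cvgD; first exact: cvg_cst.
      by apply: cvgM; [exact: cvg_id|exact: cvg_cst].
    by apply/funext => s; rewrite !mxE.
  have nB : nbhs (y + 0 *: delta_mx 0 k) (base c).
    by rewrite scale0r addr0; apply: (near_open (@open_base _ c) By (fun y h => h)).
  have nB' : nbhs (0 : R) [set s | base c (y + s *: delta_mx 0 k)] := cl _ nB.
  apply: filterS nB' => s Bs; apply/SE; first exact: hbox.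
  by rewrite graph_pointE ins_axis params_ins.
- have der i : is_derive (0 : R) (1 : R)
     (fun s : R => graph_point c (y + s *: delta_mx 0 k) 0 i)
     (partial k (fun z => graph_point c z 0 i) y).
    exact: (is_derive_line _ (partial_graph_point k i hC1 By).1).
  have dm : derivable (fun s : R => graph_point c (y + s *: delta_mx 0 k)) 0 1.
    apply/derivable_mxP => i j; rewrite ord1; have [+ _] := der j; exact.
  split => //; rewrite derive_mx //; apply/rowP => i; rewrite !mxE.
  exact: (derive_val (is_derive := der i)).
Qed.

Lemma partial_elevation (c : graph_chart R) x j : C1_on (base c) (height c) ->
  cylinder c x -> differentiable (elevation c) x /\ partial j (elevation c) x =
  if unlift (axis c) j is Some k then - partial k (height c) (params c x) else 1.
Proof.
move=> hC1 cx.
have d1 : differentiable (fun y : 'rV[R]_3 => y 0 (axis c)) x by exact: differentiable_coord.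
have d2 : differentiable (fun y => height c (params c y)) x.
  exact: (C1_on_height_params hC1 cx).1.
split; first exact: differentiableB.
rewrite /elevation partialD ?partialN ?partial_coord //; last exact: differentiableN.
rewrite partial_height_params //; case: unliftP => [k ->|->].
  rewrite (negbTE (neq_lift _ _)) add0r (bigD1 k) //= eqxx mulr1 big1 ?addr0 //.
  by move=> i ik; rewrite (inj_eq lift_inj) (negbTE ik) mulr0.
rewrite eqxx big1 ?subr0 // => i _.
by rewrite eq_sym (negbTE (neq_lift _ _)) mulr0.
Qed.

Lemma derive_sign (f : 'rV[R]_3 -> R) x d : differentiable f x -> f x = 0 ->
  0 < 'D_d f x -> \forall s \near (0 : R)^'+, 0 < f (x + s *: d).
Proof.
move=> /(is_derive_line d)[dl dE] f0 D0.
have := dl; rewrite /derivable => /cvg_ex[l cl].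
have lE : l = 'D_d f x by rewrite -dE; apply/esym/cvg_lim.
have : \forall h \near 0^', 0 < h^-1 *: (f (x + (h *: (1 : R) + 0) *: d) - f (x + 0 *: d)).
  by apply: (cvgr_gt l cl); rewrite lE.
rewrite scale0r addr0 f0.
rewrite /dnbhs /at_right !near_withinE; apply: filterS => h Hh h0.
have := Hh _; rewrite /GRing.scale /= subr0 addr0 mulr1 pmulr_rgt0 ?invr_gt0 //.
by apply; rewrite gt_eqF.
Qed.

Lemma right_ex3 (A B C : set R) : (\forall s \near (0 : R)^'+, A s) ->
  (\forall s \near (0 : R)^'+, B s) -> (\forall s \near (0 : R)^'+, C s) ->
  exists s, [/\ A s, B s & C s].
Proof.
move=> hA hB hC.
have : \forall s \near (0 : R)^'+, [/\ A s, B s & C s] by near=> s; split; near: s.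
by move=> H; have [s hs] := @filter_ex _ _ (at_right_proper_filter (0 : R)) _ H; exists s.
Unshelve. all: by end_near. Qed.

(* The length of the covector (- grad f, 1). *)
Definition slant (c : graph_chart R) (y : 'rV[R]_2) : R :=
  Num.sqrt (1 + \sum_k partial k (height c) y ^+ 2).

Lemma slant_gt0 c y : 0 < slant c y.
Proof. by rewrite sqrtr_gt0 ltr_pwDl // sumr_ge0 // => k _; exact: sqr_ge0. Qed.

Lemma inner_scalar (h : 'rV[R]_3 -> 'M[R]_3) x b (u v : 'rV[R]_3) : h x = b%:M ->
  inner h x u v = b * \sum_i u 0 i * v 0 i.
Proof.
move=> hx; rewrite /inner mulr_sumr; apply: eq_bigr => i _.
rewrite (bigD1 i) //= big1 ?addr0 => [|j ji].
  by rewrite hx mxE eqxx mulr1n mulrA.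
by rewrite hx mxE eq_sym (negbTE ji) mulr0n !mul0r.
Qed.

(** Orthogonality to the coordinate curves makes [nu] proportional to (- grad f, 1), the unit length
    fixes the factor up to sign, and the sign follows from the derivative of the elevation along
    [nu]. *)
Lemma outward_normal_graph (h : 'rV[R]_3 -> 'M[R]_3) e V c y p nu :
  C1_graph_chart c -> side e V c -> base c y ->
  h (graph_point c y) = (p ^+ 2)%:M -> 0 < p ->
  outward_unit_normal h V (graph_point c y) nu ->
  nu 0 (axis c) = sgn R e / (p * slant c y) /\
  forall k, nu 0 (lift (axis c) k) = - partial k (height c) y * nu 0 (axis c).
Proof.
move=> C1c sV By hx p0 [n1 nt nout].
set x := graph_point c y in hx n1 nt nout *.
have [hC1 hbox] := C1c.
have bx : box c x by exact: hbox.
have p2 : p ^+ 2 != 0 by rewrite expf_neq0 // gt_eqF.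
have nl k : nu 0 (lift (axis c) k) = - partial k (height c) y * nu 0 (axis c).
  have := nt _ (tangent_graph k (side_surface_chart C1c sV) By).
  rewrite (inner_scalar _ _ hx) => /eqP; rewrite mulf_eq0 (negbTE p2) /=.
  rewrite (bigD1_ord (axis c)) //= mxE (partial_graph_point k _ hC1 By).2 unlift_none.
  rewrite (bigD1 k) //= mxE (partial_graph_point k _ hC1 By).2 liftK eqxx mulr1.
  rewrite big1 ?addr0 => [|i ik].
    by rewrite addrC addr_eq0 mulNr mulrC => /eqP.
  by rewrite mxE (partial_graph_point k _ hC1 By).2 liftK (negbTE ik) mulr0.
split => //.
set a := nu 0 (axis c) in nl *; set q := slant c y.
have q0 : 0 < q by exact: slant_gt0.
have q2 : q ^+ 2 = 1 + \sum_k partial k (height c) y ^+ 2.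
  by rewrite sqr_sqrtr // addr_ge0 // sumr_ge0 // => k _; exact: sqr_ge0.
have aq : (a * (p * q)) ^+ 2 = 1.
  rewrite !exprMn q2 -[RHS]n1 (inner_scalar _ _ hx) (bigD1_ord (axis c)) //= -/a.
  under [in RHS]eq_bigr do rewrite nl.
  rewrite [in RHS](eq_bigr (fun k => a ^+ 2 * partial k (height c) y ^+ 2)) => [|k _]; last by ring.
  by rewrite -mulr_sumr; ring.
have cx : cylinder c x by exact: box_base.
have Dn : 'D_nu (elevation c) x = a * q ^+ 2.
  have de j := (partial_elevation j hC1 cx).
  rewrite derive_partials; last exact: (de (axis c)).1.
  rewrite (bigD1_ord (axis c)) //= (de _).2 unlift_none mulr1 -/a q2 mulrDr mulr1.
  congr (_ + _); rewrite mulr_sumr; apply: eq_bigr => k _.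
  by rewrite (de _).2 liftK nl /x params_ins; ring.
have ex : elevation c x = 0.
  by rewrite /elevation /x graph_pointE ins_axis params_ins subrr.
have dex : differentiable (elevation c) x by exact: (partial_elevation (axis c) hC1 cx).1.
have nbox : \forall s \near (0 : R)^'+, box c (x + s *: nu).
  have cl : {for (0 : R), continuous (fun s : R => x + s *: nu)}.
    apply: continuous_row => i.
    rewrite (_ : (fun s => _) = fun s : R => x 0 i + s * nu 0 i).
      apply: cvgD; first exact: cvg_cst.
      by apply: cvgM; [exact: cvg_id|exact: cvg_cst].
    by apply/funext => s; rewrite !mxE.
  have nB : nbhs (x + 0 *: nu) (box c) by rewrite scale0r addr0; exact: near_box.
  have nB' : nbhs (0 : R) [set s | box c (x + s *: nu)] := cl _ nB.
  by apply: cvg_within; exact: nB'.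
(* With the opposite sign, the elevation along [nu] would at once take the sign that places
   [x + s *: nu] in [V], contrary to [nout]. *)
have sg : 0 < sgn R e * a.
  have a0 : a != 0.
    by apply/eqP => a0; move/eqP: aq; rewrite a0 mul0r expr0n eq_sym oner_eq0.
  have q20 : 0 < q ^+ 2 by rewrite exprn_gt0.
  case: e sV => sV; rewrite /sgn ?mul1r ?mulN1r ?oppr_gt0.
    have [//|an|a0'] := ltgtP 0 a; last by rewrite a0' eqxx in a0.
    have dN : 'D_nu (fun y => - elevation c y) x = - 'D_nu (elevation c) x.
      by apply: (deriveN (f := elevation c)); exact: diff_derivable.
    have pos : 0 < 'D_nu (fun y => - elevation c y) x by rewrite dN Dn; nra.
    have ex' : (fun y => - elevation c y) x = 0 by rewrite /= ex oppr0.
    have H := derive_sign (differentiableN dex) ex' pos.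
    exfalso; have [s [Bs out neg]] := right_ex3 nbox nout H.
    by apply: out; apply/(sideE sV Bs); rewrite -oppr_ge0 ltW.
  have [an|//|a0'] := ltgtP 0 a; last by rewrite a0' eqxx in a0.
  have pos : 0 < 'D_nu (elevation c) x by rewrite Dn; nra.
  have H := derive_sign dex ex pos.
  exfalso; have [s [Bs out neg]] := right_ex3 nbox nout H.
  by apply: out; apply/(sideE sV Bs); rewrite ltW.
have pq0 : 0 < p * q by rewrite mulr_gt0.
move/eqP: aq; rewrite sqrf_eq1 => /orP[] /eqP aq; apply: (mulIf (lt0r_neq0 pq0));
  rewrite aq divfK ?gt_eqF //; move: sg; rewrite /sgn; case: e {sV} => //.
- by rewrite mulN1r oppr_gt0 => a0; move: aq; nra.
- by rewrite mul1r => a0; move: aq; nra.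
Qed.

End outward_normal.

(** * The Gauss law for conformally flat metrics *)

Section flux_through_charts.
Context (R : realType).
Local Notation mu := (@lebesgue_measure R).

Lemma det_mx2 (A : 'M[R]_2) : \det A = A 0 0 * A 1 1 - A 0 1 * A 1 0.
Proof.
rewrite (expand_det_row _ 0) !big_ord_recl big_ord0 /cofactor !det_mx11 !mxE /=.
have e1 : lift 0 0 = 1 :> 'I_2 by exact: val_inj.
have e2 : lift (lift ord0 ord0) 0 = 0 :> 'I_2 by exact: val_inj.
by rewrite e2 e1 expr0 expr1; ring.
Qed.

(** With f_k the partial derivatives of the height, the pulled back metric is p^2 (delta_kl + f_k
    f_l), whose determinant is p^4 (1 + |grad f|^2). *)
Lemma surface_element_scalar (h : 'rV[R]_3 -> 'M[R]_3) c y p :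
  C1_on (base c) (height c) -> base c y ->
  h (graph_point c y) = (p ^+ 2)%:M ->
  surface_element h c y = p ^+ 2 * slant c y.
Proof.
move=> hC1 By hx; rewrite /surface_element /slant.
set f := fun k => partial k (height c) y.
have E k l : \sum_i \sum_j h (graph_point c y) i j *
    partial k (fun z => graph_point c z 0 i) y *
    partial l (fun z => graph_point c z 0 j) y = p ^+ 2 * (f k * f l + (k == l)%:R).
  pose u k : 'rV[R]_3 := \row_i partial k (fun z => graph_point c z 0 i) y.
  have := inner_scalar (u k) (u l) hx; rewrite /inner => H.
  transitivity (\sum_i \sum_j h (graph_point c y) i j * u k 0 i * u l 0 j).
    apply: eq_bigr => i _; apply: eq_bigr => j _.
    by congr (_ * _ * _); rewrite [RHS]mxE.
  have uE j i : u j 0 i = if unlift (axis c) i is Some k' then (k' == j)%:R else f j.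
    by rewrite [LHS]mxE (partial_graph_point j i hC1 By).2.
  rewrite H {H}; clearbody u; congr (_ * _); rewrite (bigD1_ord (axis c)) //= !uE unlift_none.
  congr (_ + _); rewrite (bigD1 k) //= !uE liftK eqxx mul1r.
  rewrite big1 ?addr0 // => i ik.
  by rewrite uE liftK (negbTE ik) mul0r.
have -> : (\matrix_(k < 2, l < 2) \sum_i \sum_j h (graph_point c y) i j *
    partial k (fun z => graph_point c z 0 i) y *
    partial l (fun z => graph_point c z 0 j) y) =
    \matrix_(k < 2, l < 2) (p ^+ 2 * (f k * f l + (k == l)%:R)).
  by apply/matrixP => k l; rewrite [LHS]mxE [RHS]mxE; exact: E.
rewrite -[\sum_k _]/(\sum_k f k ^+ 2); move: f E => f _.
rewrite det_mx2 !mxE !big_ord_recl big_ord0 /=.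
rewrite (_ : lift ord0 ord0 = 1); last exact: val_inj.
rewrite (_ : _ - _ = (p ^+ 2) ^+ 2 * (1 + (f 0 ^+ 2 + (f 1 ^+ 2 + 0)))); last by rewrite /=; ring.
by rewrite sqrtrM ?sqr_ge0 // sqrtr_sqr ger0_norm // sqr_ge0.
Qed.

Definition chart_integrand (h : 'rV[R]_3 -> 'M[R]_3) (c : graph_chart R)
    (f : 'rV[R]_3 -> R) : R * R -> R :=
  (fun z => f (graph_point c (point2 z)) * surface_element h c (point2 z))
    \_ (@point2 R @^-1` base c).

Lemma chart_integralE h c f :
  chart_integral h c f = Rintegral (mu \x mu)%E setT (chart_integrand h c f).
Proof. by rewrite /chart_integral Rintegral_mkcond. Qed.

(** The slant cancels between the normal and the area element, and p^2 from the area against 1/p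
    from the unit normal leaves the single factor [p] of the Euclidean field. *)
Lemma chart_integrand_flux (h : 'rV[R]_3 -> 'M[R]_3) e V c (p w : 'rV[R]_3 -> R)
    (T : 'I_3 -> 'I_3 -> 'rV[R]_3 -> R) (X : 'I_3 -> 'rV[R]_3 -> R) nu z :
  surface_chart (frontier V) c -> side e V c ->
  (forall x, frontier V x -> h x = (p x ^+ 2)%:M /\ 0 < p x) ->
  (forall x, frontier V x -> outward_unit_normal h V x (nu x)) ->
  chart_integrand h c (fun x => w x * flux_density T X nu x) z =
  sgn R e * graph_flux c
    (fun i x => w x * (p x * \sum_j T i j x * X j x)) (point2 z).
Proof.
move=> [C1c SE] sV hp hnu; have [hC1 hbox] := C1c.
rewrite /chart_integrand patchE /graph_flux; case: asboolP => By; last first.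
  by rewrite mulr0; case: ifPn => // /set_mem.
rewrite mem_set //; set y := point2 z in By *; set x := graph_point c y.
have Sx : frontier V x.
  by apply/SE; [exact: hbox|rewrite /x graph_pointE ins_axis params_ins].
have [hx p0] := hp x Sx.
have [na nl] := outward_normal_graph C1c sV By hx p0 (hnu x Sx).
rewrite (surface_element_scalar hC1 By hx).
have -> : flux_density T X nu x = \sum_i nu x 0 i * \sum_j T i j x * X j x.
  apply: eq_bigr => i _; rewrite mulr_sumr; apply: eq_bigr => j _; ring.
rewrite (bigD1_ord (axis c)) //=.
rewrite (eq_bigr (fun k => - nu x 0 (axis c) * (partial k (height c) y *
   (\sum_j T (lift (axis c) k) j x * X j x)))) => [|k _]; last by rewrite nl; ring.
rewrite -mulr_sumr.
rewrite [in RHS](eq_bigr (fun k => w x * p x * (partial k (height c) y *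
   (\sum_j T (lift (axis c) k) j x * X j x)))) => [|k _]; last by ring.
rewrite -mulr_sumr na.
set A := \sum_j _; set B := \sum_k _; set q := slant c y.
have q0 : q != 0 by rewrite gt_eqF // slant_gt0.
by field; rewrite q0 gt_eqF.
Qed.

End flux_through_charts.

(** * The divergence theorem for compact domains with C^1 boundary *)

Section gauss.
Context (R : realType).
Local Notation mu := (@lebesgue_measure R).
Implicit Types (V U : set 'rV[R]_3).

Definition ind V (x : 'rV[R]_3) : R := \1_V x.

(** [U] and the complement of [L] are open and cover the space; the product is C^1 on the first and
    zero on the second. *)
Lemma C1_on_cutoff n (U L : set 'rV[R]_n) w f : open U -> compact L -> L `<=` U ->
  C1_on setT w -> (forall x, ~ L x -> w x = 0) -> C1_on U f ->
  C1_on setT (fun x => w x * f x).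
Proof.
move=> oU cL LU cw w0 cf; apply: C1_on_open_cover => x _.
have [Ux|nUx] := pselect (U x).
  exists U; split => //; exact: (C1_onM oU (C1_onS (@subsetT _ U) cw) cf).
exists (~` L); split; [by rewrite openC; exact: compact_closed| |].
  by move=> /LU.
apply: (@C1_on_ext _ _ _ (fun=> 0)).
- by rewrite openC; exact: compact_closed.
- by move=> y /w0 ->; rewrite mul0r.
- exact: C1_on_cst.
Qed.

Lemma cbm_ind V f : compact V -> cbm f -> cbm (fun x => ind V x * f x).
Proof.
move=> cV; apply: cbmMl; last first.
  by exists 1 => x; rewrite /ind indicE; case: (_ \in _); rewrite ?normr1 ?normr0.
move=> d T u mu_.
have mV := measurable_row_closed mu_ (compact_closed (@norm_hausdorff _ _) cV).
rewrite (_ : (fun t => _) = \1_[set t | V (\row_i u i t)]); first exact: measurable_indic.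
by apply/funext => t; rewrite /ind !indicE; congr (_%:R); congr nat_of_bool; apply/idP/idP;
  rewrite !inE.
Qed.

Lemma indE V x : V x -> ind V x = 1.
Proof. by move=> Vx; rewrite /ind indicE mem_set. Qed.

Lemma ind0 V x : ~ V x -> ind V x = 0.
Proof. by move=> Vx; rewrite /ind indicE memNset. Qed.

Lemma cbm_div (G : 'I_3 -> 'rV[R]_3 -> R) : (forall i, C1_on setT (G i)) ->
  (forall i, bounded_supp (G i)) -> cbm (euclidean_div G).
Proof. by move=> cG sG; apply: cbm_sum => i; exact: cbm_partial. Qed.

Lemma bounded_supp_compact (K : set 'rV[R]_3) (f : 'rV[R]_3 -> R) : compact K ->
  (forall x, ~ K x -> f x = 0) -> bounded_supp f.
Proof.
move=> cK fK; have [C [_ hC]] := compact_bounded cK.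
exists (C + 1) => x fx i; rewrite (le_trans (entry_le_norm _ _)) //.
apply: (hC (C + 1)); first by rewrite ltrDl.
by apply: contrapT => /fK f0; rewrite f0 eqxx in fx.
Qed.

Lemma eq_graph_flux c (G H : 'I_3 -> 'rV[R]_3 -> R) z :
  (base c z -> forall i, G i (graph_point c z) = H i (graph_point c z)) ->
  graph_flux c G z = graph_flux c H z.
Proof.
rewrite /graph_flux; case: asboolP => // Bz /(_ Bz) GH.
by rewrite GH; congr (_ - _); apply: eq_bigr => k _; rewrite GH.
Qed.

Lemma vol_div_chart e V c K (phi : 'rV[R]_3 -> R) (F : 'I_3 -> 'rV[R]_3 -> R) :
  compact V -> C1_graph_chart c -> side e V c -> compact K -> K `<=` box c ->
  C1_on setT phi -> (forall x, ~ K x -> phi x = 0) -> (forall i, C1_on setT (F i)) ->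
  vol (fun x => ind V x * euclidean_div (fun i x => phi x * F i x) x) =
  Rintegral (mu \x mu)%E setT (fun z => sgn R e * graph_flux c
    (fun i x => phi x * F i x) (point2 z)).
Proof.
move=> cV C1c sV cK Kbox cphi phi0 cF.
have cG i : C1_on setT (fun x => phi x * F i x) by exact: (C1_onM (@openT _) cphi (cF i)).
have G0 i x : ~ K x -> phi x * F i x = 0 by move=> /phi0 ->; rewrite mul0r.
apply: (local_divergence C1c.1 cG cK Kbox G0).
  by apply: cbm_ind => //; apply: cbm_div => // i; exact: bounded_supp_compact cK (G0 i).
move=> x /Kbox bx; rewrite -/(elevation c x) /half.
have := sideE sV bx; case: (boolP (if e then _ else _)) => h [h1 h2].
  by rewrite indE //; exact: h2.
by rewrite ind0 // => /h1; exact/negP.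
Qed.

Lemma vol_div_interior V K (phi : 'rV[R]_3 -> R) (F : 'I_3 -> 'rV[R]_3 -> R) :
  compact K -> K `<=` V ->
  C1_on setT phi -> (forall x, ~ K x -> phi x = 0) -> (forall i, C1_on setT (F i)) ->
  vol (fun x => ind V x * euclidean_div (fun i x => phi x * F i x) x) = 0.
Proof.
move=> cK KV cphi phi0 cF.
have cG i : C1_on setT (fun x => phi x * F i x) by exact: (C1_onM (@openT _) cphi (cF i)).
have G0 i x : ~ K x -> phi x * F i x = 0 by move=> /phi0 ->; rewrite mul0r.
have sG i := bounded_supp_compact cK (G0 i).
rewrite (_ : (fun x => _) = fun x => \sum_i partial i (fun x => phi x * F i x) x).
  rewrite vol_sum => [|i]; last exact: cbm_partial.
  by rewrite big1 // => i _; exact: vol_partial.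
apply/funext => x; have [/indE ->|nVx] := pselect (V x); first by rewrite mul1r.
rewrite ind0 // mul0r big1 // => i _; apply: (partial_out_supp cK) => [y|/KV//].
exact: G0.
Qed.

(** The weights of [A] sum to 1 on the frontier, not near it, so the remainder [w0] need not be
    supported in the interior. It is therefore cut again by a partition [b] of all of [V]; the
    pieces supported near the boundary have zero flux because [w0] vanishes on the frontier. *)
Theorem flux_through_frontier V U (F : 'I_3 -> 'rV[R]_3 -> R) (A : weighted_charts R)
    (e : 'I_(nb_charts A) -> bool) :
  volume V -> open U -> V `<=` U -> (forall i, C1_on U (F i)) ->
  (forall x, V x -> euclidean_div F x = 0) ->
  partition_of_unity (frontier V) A -> (forall k, side (e k) V (chart k)) ->
  \sum_k Rintegral (mu \x mu)%E setT (fun z => sgn R (e k) * graph_flux (chart k)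
    (fun i x => weight (w := A) k x * F i x) (point2 z)) = 0.
Proof.
move=> [cV volV] oU VU cF divF [Ak Asum] sA.
have clV : closed V by exact: compact_closed.
have frV x : frontier V x -> V x by case=> /clV.
have oT := @openT 'rV[R]_3.
(* [F] is controlled on [U] only; a cutoff equal to 1 near [V] replaces it by the globally C^1 field
   [Ft]. *)
have [m1 [j1 [w1 [U1 [w1P oU1 VU1 sumw1]]]]] :=
  @C1_partition_of_unity R 3 unit (fun=> U) V cV (fun=> oU) (fun x Vx => ex_intro _ tt (VU x Vx)).
pose Ft i x := \sum_k w1 k x * F i x.
have cFt i : C1_on setT (Ft i).
  apply: (C1_on_sum oT) => k; have [cw _ [L [cL LU w0]]] := w1P k.
  exact: C1_on_cutoff oU cL LU cw w0 (cF i).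
have FtE i x : U1 x -> Ft i x = F i x.
  by move=> /sumw1 E; rewrite /Ft -mulr_suml E mul1r.
(* [None] stands for the interior of [V] and [Some c] for the box of a one-sided chart; any other
   chart is given the empty set, which keeps the family total. *)
pose O (j : option (graph_chart R)) : set 'rV[R]_3 := if j is Some c then
  (if `[< C1_graph_chart c /\ exists e, side e V c >] then box c else set0) else V°.
have oO j : open (O j).
  case: j => [c|] /=; last exact: open_interior.
  by case: ifP => _; [exact: open_box|exact: open0].
have VO x : V x -> exists j, O j x.
  move=> Vx; have [iV|niV] := pselect (V° x); first by exists None.
  have [c [C1c bx sd]] := volV x (conj (subset_closure Vx) niV).
  exists (Some c); rewrite /O asboolT //; split => //.
  by case: sd => ?; [exists true|exists false].
have [m2 [j2 [b [U2 [bP oU2 VU2 sumb]]]]] := C1_partition_of_unity cV oO VO.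
pose w k x := weight (w := A) k x.
have cw k : C1_on setT (w k) by have [] := Ak k.
pose w0 x := 1 - \sum_k w k x.
have cw0 : C1_on setT w0 by exact: (C1_onB oT (C1_on_cst 1) (C1_on_sum oT cw)).
have w00 x : frontier V x -> w0 x = 0 by move=> /Asum; rewrite /w0 => ->; rewrite subrr.
have supw k : exists K, [/\ compact K, K `<=` box (chart k) & forall x, ~ K x -> w k x = 0].
  by have [] := Ak k.
have C1c (k : 'I_(nb_charts A)) : C1_graph_chart (chart k) by have [sc _ _ _] := Ak k; exact: sc.1.
pose D1 k x := ind V x * euclidean_div (fun i x => w k x * Ft i x) x.
pose D2 j x := ind V x * euclidean_div (fun i x => (b j x * w0 x) * Ft i x) x.
have E1 k : Rintegral (mu \x mu)%E setT (fun z => sgn R (e k) * graph_flux (chart k)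
    (fun i x => weight (w := A) k x * F i x) (point2 z)) = vol (D1 k).
  have [K [cK Kbox wK]] := supw k.
  rewrite /D1 (vol_div_chart cV (C1c k) (sA k) cK Kbox (cw k) wK cFt).
  apply: eq_Rintegral => z _; congr (_ * _); apply: eq_graph_flux => Bz i.
  rewrite FtE //; apply: VU1; apply: frV.
  have [[_ SE] _ _ _] := Ak k; apply/SE; first exact: (C1c k).2.
  by rewrite graph_pointE ins_axis params_ins.
have cbw j : C1_on setT (fun x => b j x * w0 x).
  by have [cb _ _] := bP j; exact: (C1_onM oT cb cw0).
have supbw j : exists L, [/\ compact L, L `<=` O (j2 j) &
    forall x, ~ L x -> b j x * w0 x = 0].
  have [_ _ [L [cL LO b0]]] := bP j; exists L; split => // x /b0 ->; by rewrite mul0r.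
have E2 j : vol (D2 j) = 0.
  have [L [cL + bw0]] := supbw j; rewrite /O; case: (j2 j) => [c|]; last first.
    by move=> LV; apply: (vol_div_interior cL _ (cbw j) bw0 cFt) => x /LV/interior_subset.
  case: asboolP => [[C1c' [e' sV']] LO|_ L0].
    rewrite /D2 (vol_div_chart cV C1c' sV' cL LO (cbw j) bw0 cFt).
    rewrite (_ : (fun z => _) = cst 0) ?Rintegral_cst ?mul0r //.
    apply/funext => z; rewrite (@eq_graph_flux _ _ (fun _ _ => 0)).
      rewrite /graph_flux; case: asboolP => _; last by rewrite mulr0.
      by rewrite big1 ?subrr ?mulr0 // => k _; rewrite mulr0.
    move=> Bz i; rewrite w00 ?mulr0 ?mul0r //.
    have [_ SE] := side_surface_chart C1c' sV'.
    apply/SE; first exact: C1c'.2.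
    by rewrite graph_pointE ins_axis params_ins.
  by apply: (vol_div_interior cL _ (cbw j) bw0 cFt) => x /L0.
have cD1 k : cbm (D1 k).
  have [K [cK Kbox wK]] := supw k.
  apply: cbm_ind => //; apply: cbm_div => i; first exact: (C1_onM oT (cw k) (cFt i)).
  by apply: (bounded_supp_compact cK) => x /wK ->; rewrite mul0r.
have cD2 j : cbm (D2 j).
  have [K [cK Kbox wK]] := supbw j.
  apply: cbm_ind => //; apply: cbm_div => i; first exact: (C1_onM oT (cbw j) (cFt i)).
  by apply: (bounded_supp_compact cK) => x /wK ->; rewrite mul0r.
rewrite (eq_bigr (fun k => vol (D1 k))) //.
have -> : \sum_k vol (D1 k) = vol (fun x => \sum_k D1 k x + \sum_j D2 j x).
  rewrite volD; [|exact: cbm_sum|exact: cbm_sum].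
  by rewrite !vol_sum // [X in _ + X]big1 ?addr0.
rewrite -[RHS](@vol0 R); congr vol; apply/funext => x.
rewrite /D1 /D2 -!mulr_sumr -mulrDr.
have [Vx|/ind0 ->] := pselect (V x); last by rewrite mul0r.
rewrite indE // mul1r -[RHS](divF x Vx).
have dw k i : differentiable (fun y => w k y * Ft i y) x by exact: (C1_onM oT (cw k) (cFt i) I).1.
have db j i : differentiable (fun y => b j y * w0 y * Ft i y) x.
  exact: (C1_onM oT (cbw j) (cFt i) I).1.
rewrite /euclidean_div exchange_big [X in _ + X]exchange_big -big_split /=.
apply: eq_bigr => i _; rewrite -!partial_sum // -partialD; last 2 first.
- exact: differentiable_sumE.
- exact: differentiable_sumE.
(* Near [V] the [b j] sum to 1, so the weights [w k] and [b j * w0] together sum to 1, and the cut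
   field agrees there with [F]. *)
apply: partial_near_eq; apply: (near_open (openI oU1 oU2) (conj (VU1 _ Vx) (VU2 _ Vx))) => y [y1 y2].
rewrite -mulr_suml -mulr_suml -mulr_suml sumb // mul1r FtE // -mulrDl.
by rewrite /w0 addrC subrK mul1r.
Qed.

End gauss.

(** * Independence of the partition and the Gauss law *)

Section gauss_law.
Context (R : realType).
Local Notation mu := (@lebesgue_measure R).
Implicit Types (V U S : set 'rV[R]_3).

Lemma integrable_point2 (f : 'rV[R]_2 -> R) : cbm f ->
  (mu \x mu)%E.-integrable setT (EFin \o (fun p => f (point2 p))).
Proof.
move=> [mf [C fC]].
have cf : cbm2 (fun y z => f (point2 (y, z))).
  split => [d T u v mu_ mv|].
    apply: (mf _ _ (fun (k : 'I_2) t => if k == 0 then u t else v t)) => k.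
    by case: (k == 0).
  exists C => y z; have [? h] := fC (point2 (y, z)); split => // /h {}h.
  by split; [have := h 0|have := h 1]; rewrite mxE.
by apply: eq_integrable (integrable_cbm2 cf) => // -[y z] _.
Qed.

(** The flux vanishes off the projection of [K], hence near every point outside the base, and is
    continuous over the base. Continuity of [G] is asked at graph points because the flux field is
    controlled near the surface and not in all of space. *)
Lemma cbm_graph_flux c K (G : 'I_3 -> 'rV[R]_3 -> R) : C1_graph_chart c ->
  compact K -> K `<=` box c -> (forall i x, ~ K x -> G i x = 0) ->
  (forall z i, base c z -> {for graph_point c z, continuous (G i)}) ->
  cbm (graph_flux c G).
Proof.
move=> [hC1 hbox] cK Kbox G0 cG.
have cP := @compact_params R c K cK.
have out z : ~ (params c @` K) z -> graph_flux c G z = 0.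
  move=> nPz; have Gz i : base c z -> G i (graph_point c z) = 0.
    move=> Bz; apply: G0 => Kz; apply: nPz; exists (graph_point c z) => //.
    by rewrite graph_pointE params_ins.
  rewrite /graph_flux; case: asboolP => // Bz; rewrite Gz // big1 ?subrr // => k _.
  by rewrite Gz ?mulr0.
have [C hC] : exists C : R, forall z, graph_flux c G z != 0 -> forall i, `|z 0 i| <= C.
  have [C [_ hC]] := compact_bounded cP.
  exists (C + 1) => z fz i; rewrite (le_trans (entry_le_norm _ _)) //.
  apply: (hC (C + 1)); first by rewrite ltrDl.
  by apply: contrapT => /out f0; rewrite f0 eqxx in fz.
apply: cbm_continuous hC => z.
have [Bz|nBz] := pselect (base c z); last first.
  apply: (@continuous_near_eq _ _ (fun=> 0)); last exact: cst_continuous.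
  have oP : open (~` (params c @` K)) by rewrite openC; exact: compact_closed.
  have nPz : (~` (params c @` K)) z.
    by move=> [x /Kbox/box_base Bx xz]; apply: nBz; rewrite -xz.
  by apply: (near_open oP nPz) => y /out.
have cgp : {for z, continuous (graph_point c)}.
  apply: continuous_row => i; apply: differentiable_continuous.
  exact: (partial_graph_point 0 i hC1 Bz).1.
have cGg i : {for z, continuous (fun y => G i (graph_point c y))}.
  by apply: (@continuous_comp _ _ _ (graph_point c) (G i)) => //; exact: cG.
apply: (@continuous_near_eq _ _ (fun y => G (axis c) (graph_point c y) -
    \sum_k partial k (height c) y * G (lift (axis c) k) (graph_point c y))).
  by apply: (near_open (@open_base _ c) Bz) => y By; rewrite /graph_flux asboolT.
apply: (@continuousD _ _ _ (fun y => G (axis c) (graph_point c y))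
  (fun y => - \sum_k partial k (height c) y * G (lift (axis c) k) (graph_point c y))).
  exact: cGg.
apply: (@continuousN _ _ _ (fun y => \sum_k partial k (height c) y *
  G (lift (axis c) k) (graph_point c y))).
apply: (@continuous_sum _ _ _ (fun k y => partial k (height c) y *
  G (lift (axis c) k) (graph_point c y))) => k.
apply: (@continuousM _ _ (partial k (height c)) (fun y => G (lift (axis c) k) (graph_point c y))).
  exact: (hC1 z Bz).2.
exact: cGg.
Qed.

Lemma volume_side V c : volume V -> surface_chart (frontier V) c ->
  exists e, side e V c.
Proof.
move=> vV sc; have [h|h] := pselect (exists z, base c z).
  exact: surface_chart_side.
(* An empty base makes the box empty, and either side holds vacuously. *)
by exists true => y /box_base By; exfalso; apply: h; exists (params c y).
Qed.

Lemma exists_partition_of_unity S : closed_surface S ->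
  exists A, partition_of_unity S A.
Proof.
move=> [cS chS].
have SO x : S x -> exists c : {c : graph_chart R | surface_chart S c}, box (sval c) x.
  by move=> /chS[c sc bx]; exists (exist _ c sc).
have [m [j [w [U [wP _ SU sumw]]]]] :=
  C1_partition_of_unity cS (fun c => @open_box _ (sval c)) SO.
exists (@WeightedCharts R m (fun k => sval (j k)) w); split => /=.
  by move=> k; have [cw wge0 sw] := wP k; split => //; exact: (svalP (j k)).
by move=> x /SU/sumw.
Qed.

Lemma closed_surface_frontier V : volume V -> closed_surface (frontier V).
Proof.
move=> [cV volV]; split.
  have clV : closed V by exact: compact_closed.
  apply: (subclosed_compact _ cV); last by move=> x [/clV].
  rewrite /frontier setDE; apply: closedI; first exact: closed_closure.
  by rewrite closedC; exact: open_interior.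
move=> x /volV[c [C1c bx sd]].
have [e sV] : exists e, side e V c by case: sd => ?; [exists true|exists false].
by exists c => //; exact: side_surface_chart sV.
Qed.

Section conformally_flat.
Variables (h : 'rV[R]_3 -> 'M[R]_3) (U : set 'rV[R]_3) (p : 'rV[R]_3 -> R)
  (T : 'I_3 -> 'I_3 -> 'rV[R]_3 -> R) (X : 'I_3 -> 'rV[R]_3 -> R).
Let F i x := p x * \sum_j T i j x * X j x.
Hypotheses (oU : open U) (hp : forall x, U x -> h x = (p x ^+ 2)%:M /\ 0 < p x)
  (cF : forall i, C1_on U (F i)) (divF : forall x, U x -> euclidean_div F x = 0).

Lemma frontier_sub V : volume V -> frontier V `<=` V.
Proof. by move=> [cV _] x [clV _]; exact: (compact_closed (@norm_hausdorff _ _) cV). Qed.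

Lemma conformally_flat_flux V nu A : volume V -> V `<=` U ->
  (forall x, frontier V x -> outward_unit_normal h V x (nu x)) ->
  partition_of_unity (frontier V) A ->
  \sum_k chart_integral h (chart k)
    (fun x => weight (w := A) k x * flux_density T X nu x) = 0.
Proof.
move=> vV VU hnu pA.
have /choice[e sV] (k : 'I_(nb_charts A)) : exists e, side e V (chart k).
  by apply: volume_side => //; have [] := pA.1 k.
rewrite -[RHS](flux_through_frontier vV oU VU cF (fun x Vx => divF (VU x Vx)) pA sV).
apply: eq_bigr => k _; rewrite chart_integralE; apply: eq_Rintegral => z _.
apply: (@chart_integrand_flux R h (e k) V (chart k) p) => //.
  by have [] := pA.1 k.
by move=> x /(frontier_sub vV)/VU/hp.
Qed.

Theorem conformally_flat_gauss_law : gauss_law h U T X.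
Proof.
move=> V nu vV VU hnu; split.
  exact: exists_partition_of_unity (closed_surface_frontier vV).
by move=> A; exact: conformally_flat_flux.
Qed.

End conformally_flat.
End gauss_law.

(** * Refining the charts of one surface away from another *)

Section refinement.
Context (R : realType).
Local Notation mu := (@lebesgue_measure R).
Implicit Types (V U S : set 'rV[R]_3) (c : graph_chart R).

Definition with_box c (l u : 'rV[R]_3) : graph_chart R :=
  GraphChart (axis c) l u (height c).

(** A chart must keep its graph inside its box, so the base has to shrink according to the modulus
    of continuity of the height. *)
Lemma small_chart c N x : C1_graph_chart c -> open N -> N x -> box c x ->
  x 0 (axis c) = height c (params c x) ->
  exists l u, [/\ C1_graph_chart (with_box c l u), box (with_box c l u) x &
    box (with_box c l u) `<=` box c `&` N].
Proof.
move=> [hC1 hbox] oN Nx bx xS.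
have /nbhs_rV_ball[e e0 sE] : nbhs x (box c `&` N).
  by apply: filterI; [exact: near_box|exact: open_nbhs_nbhs].
have Bx := box_base bx.
have : nbhs (params c x) (height c @^-1` ball (height c (params c x)) e).
  by apply: (C1_on_continuous hC1 Bx); exact: nbhsx_ballx.
move=> /nbhs_rV_ball[d d0 sD].
(* [m <= d] keeps the graph over the small base within [e] of [x] along the axis, and [m <= e] keeps
   the box inside the given neighbourhood. *)
pose m := Num.min d e.
have m0 : 0 < m by rewrite lt_min d0.
pose l := \row_i (x 0 i - if i == axis c then e else m).
pose u := \row_i (x 0 i + if i == axis c then e else m).
have bE y : box (with_box c l u) y ->
    `|x 0 (axis c) - y 0 (axis c)| < e /\ forall k, `|x 0 (lift (axis c) k) - y 0 (lift (axis c) k)| < m.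
  move=> By; split => [|k].
    have := By (axis c); rewrite !mxE eqxx distrC ltr_distl; lra.
  have := By (lift (axis c) k); rewrite !mxE eq_sym (negbTE (neq_lift _ _)).
  by rewrite distrC ltr_distl.
have mE : m <= e by rewrite ge_min lexx orbT.
have sub : box (with_box c l u) `<=` box c `&` N.
  move=> y /bE[h1 h2]; apply: sE => i; have [k ->|->] := unliftP (axis c) i => //.
  exact: lt_le_trans (h2 k) mE.
have bse z : base (with_box c l u) z -> (forall k, `|params c x 0 k - z 0 k| < m).
  move=> Bz k; have := Bz k; rewrite !mxE /= eq_sym (negbTE (neq_lift _ _)).
  by rewrite distrC ltr_distl.
have gb z : base (with_box c l u) z -> box (with_box c l u) (graph_point c z).
  move=> Bz i; have [k ->|->] := unliftP (axis c) i.
    by rewrite graph_pointE ins_lift; exact: (Bz k).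
  rewrite graph_pointE ins_axis !mxE eqxx xS -ltr_distl distrC.
  apply: sD => k; apply: lt_le_trans (bse z Bz k) _.
  by rewrite ge_min lexx.
exists l, u; split => //.
  split=> [|z Bz]; last exact: gb.
  move=> z Bz; apply: hC1.
  by have [/box_base + _] := sub _ (gb z Bz); rewrite graph_pointE params_ins.
by move=> i; rewrite !mxE; case: ifP => _; lra.
Qed.

Section refine_chart.
Variables (V S S' : set 'rV[R]_3) (h : 'rV[R]_3 -> 'M[R]_3) (p : 'rV[R]_3 -> R)
  (T : 'I_3 -> 'I_3 -> 'rV[R]_3 -> R) (X : 'I_3 -> 'rV[R]_3 -> R)
  (nu : 'rV[R]_3 -> 'rV[R]_3) (c : graph_chart R) (w : 'rV[R]_3 -> R)
  (K : set 'rV[R]_3).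
Hypotheses (vV : volume V) (frE : frontier V = S `|` S') (SS' : S `&` S' = set0)
  (clS : closed S) (clS' : closed S') (sc : surface_chart S c)
  (cw : C1_on setT w) (w_ge0 : forall x, 0 <= w x) (cK : compact K)
  (Kbox : K `<=` box c) (w0 : forall x, ~ K x -> w x = 0).

(** The box of a chart of [S] may meet [S'], and then it is no chart of the frontier. Boxes avoiding
    [S'] around the points of [K] on [S] are charts of both. They keep the axis and the height of
    [c], so that cutting [w] by a partition of unity splits the integrand pointwise, without any
    change of parameters. *)
Lemma refine_chart : exists (m : nat) (d : 'I_m -> graph_chart R)
    (v : 'I_m -> 'rV[R]_3 -> R),
  [/\ forall j, [/\ surface_chart (frontier V) (d j), C1_on setT (v j),
        forall x, 0 <= v j x
      & exists L, [/\ compact L, L `<=` box (d j) & forall x, ~ L x -> v j x = 0]],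
      forall j x, S' x -> v j x = 0,
      forall x, S x -> \sum_j v j x = w x
    & forall f : 'rV[R]_3 -> R,
      (forall j, (mu \x mu)%E.-integrable setT
        (EFin \o chart_integrand h (d j) (fun x => v j x * f x))) ->
      (mu \x mu)%E.-integrable setT (EFin \o chart_integrand h c (fun x => w x * f x)) /\
      chart_integral h c (fun x => w x * f x) =
      \sum_j chart_integral h (d j) (fun x => v j x * f x)].
Proof.
have [C1c SE] := sc.
pose J := {lu : 'rV[R]_3 * 'rV[R]_3 | C1_graph_chart (with_box c lu.1 lu.2) /\
  box (with_box c lu.1 lu.2) `<=` box c `&` ~` S'}.
pose ch (j : J) := with_box c (sval j).1 (sval j).2.
have cKS : compact (K `&` S) by exact: compact_closedI.
have KSO x : (K `&` S) x -> exists j, box (ch j) x.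
  move=> [/Kbox bx Sx].
  have nS'x : (~` S') x by move=> S'x; have : (S `&` S') x by []; rewrite SS'.
  have oS' : open (~` S') by rewrite openC.
  have [l [u [C1d bd sub]]] := small_chart C1c oS' nS'x bx ((SE x bx).1 Sx).
  by exists (exist _ (l, u) (conj C1d sub)).
have [m [j [b [N [bP _ KSO' sumb]]]]] :=
  C1_partition_of_unity cKS (fun j => @open_box _ (ch j)) KSO.
have dbox i : box (ch (j i)) `<=` box c `&` ~` S' by exact: (svalP (j i)).2.
have dC1 i : C1_graph_chart (ch (j i)) by exact: (svalP (j i)).1.
have supv i : exists L, [/\ compact L, L `<=` box (ch (j i)) &
    forall x, ~ L x -> w x * b i x = 0].
  have [_ _ [L [cL Lb b0]]] := bP i; exists L; split => // x /b0 ->; by rewrite mulr0.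
have v0 i x : ~ box (ch (j i)) x -> w x * b i x = 0.
  by have [L [_ Lb b0]] := supv i => nb; apply: b0 => /Lb.
have sumv x : S x -> \sum_i w x * b i x = w x.
  move=> Sx; rewrite -mulr_sumr; have [Kx|/w0 ->] := pselect (K x); last by rewrite mul0r.
  by rewrite sumb ?mulr1 //; exact: KSO'.
exists m, (fun i => ch (j i)), (fun i x => w x * b i x); split => //.
- move=> i; split.
  + split => // x bx; have [bcx nS'x] := dbox i x bx.
    rewrite frE; split => [[/(SE x bcx)//|//]|E]; left; exact/SE.
  + by have [cb _ _] := bP i; exact: (C1_onM (@openT _) cw cb).
  + by move=> x; have [_ bge0 _] := bP i; rewrite mulr_ge0.
  + exact: supv.
- by move=> i x S'x; apply: v0 => /dbox[].
- move=> f intf.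
  (* Over the base of [c] the weights add up on [S], and a piece whose small base misses [z] has
     weight 0 there; off the base of [c] all terms vanish. *)
  have E z : chart_integrand h c (fun x => w x * f x) z =
      \sum_i chart_integrand h (ch (j i)) (fun x => w x * b i x * f x) z.
    rewrite /chart_integrand; under eq_bigr do rewrite patchE.
    rewrite patchE; case: ifPn => [/set_mem Bz|nBz].
      have bx := C1c.2 _ Bz; set x := graph_point c (point2 z) in bx *.
      have Sx : S x by apply/SE => //; rewrite /x graph_pointE ins_axis params_ins.
      rewrite -{1}(sumv x Sx) !mulr_suml; apply: eq_bigr => i _.
      case: ifPn => // /negP nBi; rewrite v0 ?mul0r // => /box_base Bi.
      apply: nBi; apply: mem_set; move: Bi.
      by rewrite -[params _ x]/(params c x) /x graph_pointE params_ins.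
    rewrite big1 // => i _; case: ifPn => // /set_mem Bi.
    exfalso; move/negP: nBz; apply; apply: mem_set.
    have [/box_base + _] := dbox i _ ((dC1 i).2 _ Bi).
    by rewrite -[graph_point _ _]/(graph_point c (point2 z)) graph_pointE params_ins.
  pose g i := EFin \o chart_integrand h (ch (j i)) (fun x => w x * b i x * f x).
  have Ef : EFin \o chart_integrand h c (fun x => w x * f x) =
      (fun z => \sum_i g i z)%E.
    by apply/funext => z; rewrite /= E sumEFin.
  split; first by rewrite Ef; apply: (@integrable_sum _ _ _ (mu \x mu)%E setT measurableT _ _ _ g) => i _; exact: intf.
  rewrite chart_integralE /Rintegral.
  rewrite [X in fine X](_ : _ = \int[(mu \x mu)%E]_z
      (\sum_i g i z))%E; last first.
    by apply: eq_integral => z _; exact: (congr1 (@^~ z) Ef).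
  rewrite (integral_sum measurableT intf) -sum_fine; last first.
    by move=> i _; apply: integrable_fin_num => //; exact: intf.
  by apply: eq_bigr => i _; rewrite chart_integralE.
Qed.

End refine_chart.
End refinement.

(** * Independence of the charge from the surface *)

Section surface_independence.
Context (R : realType).
Local Notation mu := (@lebesgue_measure R).
Implicit Types (V U S : set 'rV[R]_3) (c : graph_chart R).

Lemma sum_sigma (I : finType) (J : I -> finType) (F : forall i, J i -> R) :
  \sum_(p : {i : I & J i}) F (tag p) (tagged p) = \sum_i \sum_j F i j.
Proof. by rewrite (sig_big_dep xpredT (fun _ _ => true) F). Qed.

(** Each chart is refined into a number of pieces of its own, so the pieces are indexed by a sigma
    type; [finite_partition_of_unity] renumbers them. *)
Lemma refine_partition h V S S' A : closed S -> closed S' ->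
  frontier V = S `|` S' -> S `&` S' = set0 -> partition_of_unity S A ->
  exists (T : finType) (d : T -> graph_chart R) (v : T -> 'rV[R]_3 -> R),
  [/\ forall j, [/\ surface_chart (frontier V) (d j), C1_on setT (v j),
        forall x, 0 <= v j x
      & exists L, [/\ compact L, L `<=` box (d j) & forall x, ~ L x -> v j x = 0]],
      forall j x, S' x -> v j x = 0,
      forall x, S x -> \sum_j v j x = 1
    & forall f : 'rV[R]_3 -> R,
      (forall j, (mu \x mu)%E.-integrable setT
        (EFin \o chart_integrand h (d j) (fun x => v j x * f x))) ->
      (forall k, (mu \x mu)%E.-integrable setT
        (EFin \o chart_integrand h (chart k) (fun x => weight (w := A) k x * f x))) /\
      \sum_k chart_integral h (chart k) (fun x => weight (w := A) k x * f x) =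
      \sum_j chart_integral h (d j) (fun x => v j x * f x)].
Proof.
move=> clS clS' frE SS' [Ak Asum].
have /choice[r rP] (k : 'I_(nb_charts A)) : exists r : {m : nat &
    (('I_m -> graph_chart R) * ('I_m -> 'rV[R]_3 -> R))%type},
    let d := (tagged r).1 in let v := (tagged r).2 in
    [/\ forall j, [/\ surface_chart (frontier V) (d j), C1_on setT (v j),
        forall x, 0 <= v j x
      & exists L, [/\ compact L, L `<=` box (d j) & forall x, ~ L x -> v j x = 0]],
      forall j x, S' x -> v j x = 0,
      forall x, S x -> \sum_j v j x = weight (w := A) k x
    & forall f : 'rV[R]_3 -> R,
      (forall j, (mu \x mu)%E.-integrable setT
        (EFin \o chart_integrand h (d j) (fun x => v j x * f x))) ->
      (mu \x mu)%E.-integrable setT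
        (EFin \o chart_integrand h (chart k) (fun x => weight (w := A) k x * f x)) /\
      chart_integral h (chart k) (fun x => weight (w := A) k x * f x) =
      \sum_j chart_integral h (d j) (fun x => v j x * f x)].
  have [sc cw wge0 [K [cK Kbox w0]]] := Ak k.
  have [m [d [v H]]] := refine_chart h frE SS' clS clS' sc cw wge0 cK Kbox w0.
  by exists (existT _ m (d, v)).
exists {k : 'I_(nb_charts A) & 'I_(tag (r k))},
  (fun t => (tagged (r (tag t))).1 (tagged t)),
  (fun t => (tagged (r (tag t))).2 (tagged t)).
split.
- by move=> [k j]; have [H _ _ _] := rP k; exact: H.
- by move=> [k j]; have [_ H _ _] := rP k; exact: H.
- move=> x Sx; rewrite -(Asum x Sx).
  rewrite (sum_sigma (fun k (j : 'I_(tag (r k))) => (tagged (r k)).2 j x)).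
  by apply: eq_bigr => k _; have [_ _ H _] := rP k; exact: H.
- move=> f intf.
  have H k := (let: And4 _ _ _ H := rP k in H) f (fun j => intf (existT _ k j)).
  split; first by move=> k; exact: (H k).1.
  rewrite (sum_sigma (fun k (j : 'I_(tag (r k))) => chart_integral h
    ((tagged (r k)).1 j) (fun x => (tagged (r k)).2 j x * f x))).
  by apply: eq_bigr => k _; exact: (H k).2.
Qed.

Lemma finite_partition_of_unity (T : finType) S (d : T -> graph_chart R)
    (v : T -> 'rV[R]_3 -> R) :
  (forall j, [/\ surface_chart S (d j), C1_on setT (v j), forall x, 0 <= v j x
      & exists L, [/\ compact L, L `<=` box (d j) & forall x, ~ L x -> v j x = 0]]) ->
  (forall x, S x -> \sum_j v j x = 1) ->
  partition_of_unity S
    (@WeightedCharts R #|T| (fun k => d (enum_val k)) (fun k => v (enum_val k))).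
Proof.
move=> dv sumv; split => [k|x Sx] /=; first exact: dv.
by rewrite -(sumv x Sx) (reindex _ (onW_bij _ (@enum_val_bij T))).
Qed.

Lemma flux_densityN (T : 'I_3 -> 'I_3 -> 'rV[R]_3 -> R) X nu nu' x :
  nu x = - nu' x -> flux_density T X nu x = - flux_density T X nu' x.
Proof.
move=> E; rewrite /flux_density -sumrN; apply: eq_bigr => i _.
by rewrite -sumrN; apply: eq_bigr => j _; rewrite E mxE mulrN.
Qed.

Lemma chart_integrand_ext h c S (f g : 'rV[R]_3 -> R) :
  surface_chart S c -> (forall x, S x -> f x = g x) ->
  chart_integrand h c f = chart_integrand h c g.
Proof.
move=> [[hC1 hbox] SE] fg; apply/funext => z; rewrite /chart_integrand !patchE.
case: ifPn => // /set_mem Bz; rewrite fg //; apply/SE; first exact: hbox.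
by rewrite graph_pointE ins_axis params_ins.
Qed.

Section conformally_flat.
Variables (h : 'rV[R]_3 -> 'M[R]_3) (U : set 'rV[R]_3) (p : 'rV[R]_3 -> R)
  (T : 'I_3 -> 'I_3 -> 'rV[R]_3 -> R) (X : 'I_3 -> 'rV[R]_3 -> R).
Let F i x := p x * \sum_j T i j x * X j x.
Hypotheses (oU : open U) (hp : forall x, U x -> h x = (p x ^+ 2)%:M /\ 0 < p x)
  (cF : forall i, C1_on U (F i)) (divF : forall x, U x -> euclidean_div F x = 0).

Lemma integrable_flux_integrand V nu c w L : volume V -> V `<=` U ->
  (forall x, frontier V x -> outward_unit_normal h V x (nu x)) ->
  surface_chart (frontier V) c -> C1_on setT w -> compact L -> L `<=` box c ->
  (forall x, ~ L x -> w x = 0) ->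
  (mu \x mu)%E.-integrable setT
    (EFin \o chart_integrand h c (fun x => w x * flux_density T X nu x)).
Proof.
move=> vV VU hnu sc cw cL Lbox w0.
have frU x : frontier V x -> U x by move=> /(frontier_sub vV)/VU.
have [e sV] := volume_side vV sc.
have [[hC1 hbox] SE] := sc.
have wF0 i x : ~ L x -> w x * F i x = 0 by move=> /w0 ->; rewrite mul0r.
have cg : cbm (graph_flux c (fun i x => w x * F i x)).
  apply: (cbm_graph_flux sc.1 cL Lbox wF0) => z i Bz.
  apply: (@continuousM _ _ w (F i)); first exact: C1_on_continuous cw I.
  apply: (C1_on_continuous (cF i)); apply: frU; apply/SE; first exact: hbox.
  by rewrite graph_pointE ins_axis params_ins.
have := integrable_point2 (cbmZ (sgn R e) cg).
apply: eq_integrable => // z _; congr (_%:E); apply/esym.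
exact: (chart_integrand_flux w T X z sc sV (fun x Sx => hp (frU x Sx)) hnu).
Qed.

(** Refined partitions of [S1] and [S2] together form a partition of unity of the frontier, through
    which the total flux is 0. As [nu1] points into [V], its part of this flux enters with the
    opposite sign, and the two charges agree. *)
Theorem conformally_flat_surface_independence : surface_independence h U T X.
Proof.
move=> S1 S2 V nu1 nu2 cs1 cs2 vV VU frE S12 hnu1 hnu2.
have cl1 : closed S1 by apply: compact_closed cs1.1.
have cl2 : closed S2 by apply: compact_closed cs2.1.
have S1n2 x : S2 x -> ~ S1 x.
  by move=> S2x S1x; have : (S1 `&` S2) x by []; rewrite S12.
pose nu x := if `[< S1 x >] then - nu1 x else nu2 x.
have nuE1 x : S1 x -> nu x = - nu1 x by move=> S1x; rewrite /nu asboolT.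
have nuE2 x : S2 x -> nu x = nu2 x by move=> /S1n2 nS1; rewrite /nu asboolF.
have hnu x : frontier V x -> outward_unit_normal h V x (nu x).
  rewrite frE => -[S1x|S2x]; first by rewrite nuE1 //; exact: hnu1.
  by rewrite nuE2 //; exact: hnu2.
pose flux S (n : 'rV[R]_3 -> 'rV[R]_3) A := \sum_k chart_integral h (chart k)
  (fun x => weight (w := A) k x * flux_density T X n x).
have key A1 A2 : partition_of_unity S1 A1 -> partition_of_unity S2 A2 ->
    flux S1 nu1 A1 = flux S2 nu2 A2.
  move=> p1 p2.
  have [T1 [d1 [v1 [H1 Z1 s1 I1]]]] := refine_partition h cl1 cl2 frE S12 p1.
  have frE' : frontier V = S2 `|` S1 by rewrite setUC.
  have S21 : S2 `&` S1 = set0 by rewrite setIC.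
  have [T2 [d2 [v2 [H2 Z2 s2 I2]]]] := refine_partition h cl2 cl1 frE' S21 p2.
  pose d (t : T1 + T2) := match t with inl t1 => d1 t1 | inr t2 => d2 t2 end.
  pose v (t : T1 + T2) := match t with inl t1 => v1 t1 | inr t2 => v2 t2 end.
  have Hd t : [/\ surface_chart (frontier V) (d t), C1_on setT (v t),
      forall x, 0 <= v t x & exists L,
      [/\ compact L, L `<=` box (d t) & forall x, ~ L x -> v t x = 0]].
    by case: t.
  have sv x : frontier V x -> \sum_t v t x = 1.
    rewrite big_sumType /= frE => -[Sx|Sx].
      by rewrite s1 // big1 ?addr0 // => j _; exact: Z2.
    by rewrite big1 ?add0r ?s2 // => j _; exact: Z1.
  have intd t : (mu \x mu)%E.-integrable setT
      (EFin \o chart_integrand h (d t) (fun x => v t x * flux_density T X nu x)).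
    have [sc cv _ [L [cL Lbox v0]]] := Hd t.
    exact: integrable_flux_integrand vV VU hnu sc cv cL Lbox v0.
  have [J1 E1] := I1 _ (fun t => intd (inl t)).
  have [_ E2] := I2 _ (fun t => intd (inr t)).
  have := conformally_flat_flux oU hp cF divF vV VU hnu (finite_partition_of_unity Hd sv).
  rewrite /= -(reindex _ (onW_bij xpredT (@enum_val_bij (T1 + T2)%type))
    (F := fun t => chart_integral h (d t) (fun x => v t x * flux_density T X nu x))).
  rewrite big_sumType /= -E1 -E2 => /eqP; rewrite addrC addr_eq0 => /eqP E.
  have -> : flux S2 nu2 A2 = \sum_k chart_integral h (chart k)
      (fun x => weight (w := A2) k x * flux_density T X nu x).
    apply: eq_bigr => k _; rewrite !chart_integralE.
    congr Rintegral; have [sc _ _ _] := p2.1 k; apply: (chart_integrand_ext _ sc) => x Sx.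
    by rewrite /flux_density nuE2.
  rewrite E -sumrN; apply: eq_bigr => k _; have [sc _ _ _] := p1.1 k.
  have E3 z : chart_integrand h (chart k)
      (fun x => weight (w := A1) k x * flux_density T X nu1 x) z =
      -1 * chart_integrand h (chart k)
      (fun x => weight (w := A1) k x * flux_density T X nu x) z.
    have wN x : S1 x -> weight (w := A1) k x * flux_density T X nu1 x =
        - (weight (w := A1) k x * flux_density T X nu x).
      by move=> Sx; rewrite (flux_densityN _ _ (nuE1 x Sx)) mulrN opprK.
    rewrite (chart_integrand_ext h sc wN) /chart_integrand !patchE.
    by case: ifP => _; rewrite mulN1r; [rewrite mulNr|exact: (esym (oppr0 _))].
  rewrite !chart_integralE -mulN1r -RintegralZl //; last exact: J1.
  by apply: eq_Rintegral => z _; exact: E3.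
have [A1 p1] := exists_partition_of_unity cs1.
have [A2 p2] := exists_partition_of_unity cs2.
(* The value [Q] is taken from one partition of [S1]. Any other partition of [S1] is compared with
   it through [A2], and any partition of [S2] directly through [A1]. *)
exists (flux S1 nu1 A1); split.
  split; first by exists A1.
  by move=> A pA; rewrite (key A1 A2 p1 p2) -(key A A2).
split; first by exists A2.
by move=> A pA; rewrite (key A1 A p1 pA).
Qed.

End conformally_flat.
End surface_independence.

(** * Conserved currents of a conformally flat metric *)

(** Derives an equation as a multiple of a known one, leaving an identity for [ring] or [field]. *)
Lemma eq_of_multiple (R : realType) (c a b a' b' : R) :
  a = b -> a' - b' = c * (a - b) -> a' = b'.
Proof. by move=> ->; rewrite subrr mulr0 => /eqP; rewrite subr_eq0 => /eqP. Qed.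

Section diagonal_metric.
Context (R : realType).

Lemma invmx_diagonal n (A : 'M[R]_n) (d : 'I_n -> R) :
  (forall i j, A i j = if i == j then d i else 0) -> (forall i, d i != 0) ->
  forall i j, invmx A i j = if i == j then (d i)^-1 else 0.
Proof.
move=> AE d0 i j; pose B : 'M[R]_n := \matrix_(i, j) if i == j then (d i)^-1 else 0.
have AB : A *m B = 1%:M.
  apply/matrixP => k l; rewrite !mxE (bigD1 k) //= big1 ?addr0 => [|m mk].
    by rewrite AE eqxx mxE; case: (eqVneq k l) => [_|_]; rewrite ?mulfV ?mulr0.
  by rewrite AE eq_sym (negbTE mk) mul0r.
have [uA _] := mulmx1_unit AB.
have -> : invmx A = B by rewrite -[LHS]mulmx1 -AB mulKmx.
by rewrite mxE.
Qed.

Lemma christoffel_diagonal n (g : 'rV[R]_n -> 'M[R]_n) (d : 'I_n -> 'rV[R]_n -> R) x :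
  (forall y i j, g y i j = if i == j then d i y else 0) ->
  (forall i, d i x != 0) -> forall k i j,
  christoffel g k i j x = (2 * d k x)^-1 *
    ((if j == k then partial i (d k) x else 0) + (if i == k then partial j (d k) x else 0)
     - (if i == j then partial k (d i) x else 0)).
Proof.
move=> gE d0 k i j; rewrite /christoffel (bigD1 k) //= big1 ?addr0 => [|l lk]; last first.
  by rewrite (invmx_diagonal (gE x) (d0)) eq_sym (negbTE lk) mul0r.
have pg l a b : partial l (fun y => g y a b) x = if a == b then partial l (d a) x else 0.
  case: (eqVneq a b) => [->|ab].
    by congr (partial l _ x); apply/funext => y; rewrite gE eqxx.
  rewrite -[RHS](@partial_cst R n 0 x l); congr (partial l _ x); apply/funext => y.
  by rewrite gE (negbTE ab).
rewrite (invmx_diagonal (gE x) d0) eqxx !pg invfM -!mulrA; congr (_ * (_ * _)).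
congr (_ + _ - _).
- by case: eqP => [->|].
- by case: eqP => [->|].
Qed.

End diagonal_metric.

Section three_dimensional_sums.
Context (R : realType).

Lemma sum3 (f : 'I_3 -> R) : \sum_i f i = f 0 + f 1 + f 2.
Proof.
rewrite !big_ord_recl big_ord0 addr0 addrA.
by congr (_ + f _ + f _); apply: val_inj.
Qed.

Lemma ord3P (P : 'I_3 -> Prop) : P 0 -> P 1 -> P 2 -> forall i, P i.
Proof.
move=> P0 P1 P2 [[|[|[|//]]] lt_i].
- by rewrite (_ : Ordinal _ = 0) //; exact: val_inj.
- by rewrite (_ : Ordinal _ = 1) //; exact: val_inj.
- by rewrite (_ : Ordinal _ = 2) //; exact: val_inj.
Qed.

Lemma sum_delta n (i : 'I_n) (f : 'I_n -> R) : \sum_m (i == m)%:R * f m = f i.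
Proof.
rewrite (bigD1 i) //= eqxx mul1r big1 ?addr0 // => m mi.
by rewrite eq_sym (negbTE mi) mul0r.
Qed.

Lemma lowered_christoffel_sum (d Y : 'I_3 -> R) (q : R) i j :
  \sum_m ((i == m)%:R * d j + (j == m)%:R * d i - (j == i)%:R * d m) * (q * Y m) =
  q * (d j * Y i + d i * Y j - (j == i)%:R * \sum_m d m * Y m).
Proof.
transitivity (\sum_m ((i == m)%:R * (d j * (q * Y m)) + (j == m)%:R * (d i * (q * Y m))
    - (j == i)%:R * q * (d m * Y m))).
  apply: eq_bigr => m _.
  by move: (i == m)%:R (j == m)%:R (j == i)%:R (d i) (d j) (d m) (Y m) => *; ring.
rewrite sumrB big_split /= !sum_delta -mulr_sumr.
by move: (j == i)%:R (d i) (d j) (Y i) (Y j) (\sum_m _) => *; ring.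
Qed.

(** The contracted connection of a conformally flat metric contributes three times the gradient of
    log p. The remaining terms cancel: one pair by symmetry of [S], the other because [S] is
    traceless. *)
Lemma conformal_divergence_algebra (D : 'I_3 -> 'I_3 -> R) (S : 'I_3 -> 'I_3 -> R)
  (d : 'I_3 -> R) j : (forall i k, S i k = S k i) -> \sum_i S i i = 0 ->
  \sum_i (D i j
    + \sum_m ((m == i)%:R * d i + (i == i)%:R * d m - (i == m)%:R * d i) * S m j
    - \sum_m ((j == m)%:R * d i + (i == m)%:R * d j - (i == j)%:R * d m) * S i m)
  = \sum_i (D i j + 3 * d i * S i j).
Proof.
move=> S_sym S_tr.
transitivity (\sum_i (D i j + \sum_m d m * S m j
    - (d i * S i j + S i i * d j - (j == i)%:R * \sum_m d m * S i m))).
  apply: eq_bigr => i _; congr (_ + _ - _).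
    by apply: eq_bigr => m _; rewrite eqxx mul1r eq_sym addrAC subrr add0r.
  under eq_bigr do rewrite mulrBl mulrDl -!mulrA.
  by rewrite sumrB big_split /= !sum_delta mulr_sumr [j == i]eq_sym
    [d j * _]mulrC; congr (_ - _); apply: eq_bigr => m _.
rewrite sumrB big_split sumrB big_split /= sum_delta -mulr_suml S_tr mul0r addr0.
rewrite (_ : \sum_m d m * S j m = \sum_m d m * S m j); last first.
  by apply: eq_bigr => m _; rewrite S_sym.
rewrite subrr subr0 big_split /= sumr_const card_ord; congr (_ + _).
by under [RHS]eq_bigr do rewrite -mulrA; rewrite -mulr_sumr mulr_natl.
Qed.

End three_dimensional_sums.

(** * Symmetric traceless tensors and currents for the metric p^2 times the flat one *)

Section conformally_flat_calculus.
Context (R : realType) (U : set 'rV[R]_3) (p : 'rV[R]_3 -> R)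
  (h : 'rV[R]_3 -> 'M[R]_3).
Hypotheses (oU : open U) (Cp : C1_on U p) (p_gt0 : forall x, U x -> 0 < p x)
  (hE : forall x i j, h x i j = if i == j then p x ^+ 2 else 0).

Definition dlog (i : 'I_3) x := partial i p x / p x.

Lemma conformal_christoffel x k i j : U x -> christoffel h k i j x =
  (j == k)%:R * dlog i x + (i == k)%:R * dlog j x - (i == j)%:R * dlog k x.
Proof.
move=> Ux; have px := p_gt0 Ux; have dp := (Cp Ux).1.
have p0 : p x != 0 by rewrite gt_eqF.
have pE i' : partial i' (fun y => p y ^+ 2) x = 2 * p x * partial i' p x.
  by under eq_fun do rewrite expr2; rewrite partialM //; ring.
rewrite (@christoffel_diagonal R 3 h (fun _ y => p y ^+ 2)) //; last first.
  by move=> _; rewrite expf_neq0.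
rewrite !pE /dlog; move: (p x) p0 (partial i p x) (partial j p x) (partial k p x).
by move=> q q0 di dj dk; do 3!case: (_ == _) => /=; field.
Qed.

Lemma inverse_metric x i j : U x -> invmx (h x) i j = if i == j then (p x ^+ 2)^-1 else 0.
Proof.
move=> Ux; apply: (@invmx_diagonal _ _ _ (fun=> p x ^+ 2)) => // _.
by rewrite expf_neq0 // gt_eqF // p_gt0.
Qed.

Section tensor.
(** [tau] is the tensor [E] with its first index raised, on which the lemmas operate; [tau_div] says
    that the Euclidean divergence of p^3 [tau] vanishes. *)
Variables (E tau : 'I_3 -> 'I_3 -> 'rV[R]_3 -> R).
Hypotheses (Ctau : forall i j, C1_on U (tau i j))
  (tau_sym : forall x i j, U x -> tau i j x = tau j i x)
  (tau_tr : forall x, U x -> \sum_i tau i i x = 0)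
  (tauE : forall x i j, U x -> E i j x = p x ^+ 2 * tau i j x)
  (tau_div : forall x j, U x ->
    \sum_i (partial i (tau i j) x + 3 * dlog i x * tau i j x) = 0).

Lemma raise_firstE x i j : U x -> raise_first h E i j x = tau i j x.
Proof.
move=> Ux; rewrite /raise_first (bigD1 i) //= big1 ?addr0 => [|k ki]; last first.
  by rewrite inverse_metric // eq_sym (negbTE ki) mul0r.
by rewrite inverse_metric // eqxx tauE // mulKf // expf_neq0 // gt_eqF // p_gt0.
Qed.

Lemma partial_raise_first x k i j : U x ->
  partial k (raise_first h E i j) x = partial k (tau i j) x.
Proof.
by move=> Ux; apply: partial_near_eq; apply: (near_open oU Ux) => y /raise_firstE.
Qed.

Lemma div_mixed0 x j : U x -> div_mixed h (raise_first h E) j x = 0.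
Proof.
move=> Ux; rewrite -(tau_div j Ux) /div_mixed /cov_mixed.
under eq_bigr do rewrite partial_raise_first //.
under eq_bigr do under eq_bigr do rewrite raise_firstE // conformal_christoffel //.
under eq_bigr do under [X in _ - X]eq_bigr do rewrite raise_firstE // conformal_christoffel //.
apply: (@conformal_divergence_algebra R (fun i j => partial i (tau i j) x)
  (fun i j => tau i j x) (fun i => dlog i x)) => [i k|]; first exact: tau_sym.
exact: tau_tr.
Qed.

Variable X : 'I_3 -> 'rV[R]_3 -> R.
Hypothesis hX : conformal_killing h U X.

(** With upper index, being conformal Killing depends only on the conformal class of the metric, so
    [X] is conformal Killing for the flat metric as well. *)
Lemma killing_partial x : U x -> exists kappa : R, forall i j,
  partial i (X j) x + partial j (X i) x = (i == j)%:R * kappa.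
Proof.
move=> Ux; have [CX [lam hl]] := hX.
(* The derivative of log p along [X] is the change of the factor under the rescaling of the
   metric. *)
exists (2 * (lam x - \sum_m dlog m x * X m x)) => i j.
have lowE k y : lower h X k y = p y ^+ 2 * X k y.
  rewrite /lower (bigD1 k) //= big1 ?addr0 => [|m mk]; first by rewrite hE eqxx.
  by rewrite hE eq_sym (negbTE mk) mul0r.
have dp := (Cp Ux).1; have p0 : p x != 0 by rewrite gt_eqF // p_gt0.
have plow k l : partial k (lower h X l) x =
    p x ^+ 2 * (partial k (X l) x + 2 * dlog k x * X l x).
  rewrite (_ : lower h X l = fun y => p y * p y * X l y); last first.
    by apply/funext => y; rewrite lowE expr2.
  have dX := (CX l x Ux).1.
  rewrite partialM ?partialM //; last exact: differentiableM.
  by rewrite /dlog; field.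
have := hl x Ux i j; rewrite /cov_covector !plow hE.
under eq_bigr do rewrite conformal_christoffel // lowE.
under [X in _ + (_ - X)]eq_bigr do rewrite conformal_christoffel // lowE.
have lcs (a b : 'I_3) : \sum_m ((a == m)%:R * dlog b x + (b == m)%:R * dlog a x
      - (b == a)%:R * dlog m x) * (p x ^+ 2 * X m x) =
    p x ^+ 2 * (dlog b x * X a x + dlog a x * X b x
      - (b == a)%:R * \sum_m dlog m x * X m x).
  exact: (lowered_christoffel_sum (fun m => dlog m x) (fun m => X m x)).
rewrite !lcs [j == i]eq_sym => H.
have p2 : p x ^+ 2 != 0 by rewrite expf_neq0.
apply: (mulfI p2); apply: (eq_of_multiple (c := 2) H).
move: (dlog i x) (dlog j x) (X i x) (X j x) (lam x) (p x) (\sum_m _).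
move: (partial i (X j) x) (partial j (X i) x) => *.
by case: (i == j) => /=; field.
Qed.

Lemma current_near x k : U x -> \forall y \near x,
  current h E X k y = \sum_l tau k l y * X l y.
Proof.
move=> Ux; apply: (near_open oU Ux) => y Uy.
by apply: eq_bigr => l _; rewrite raise_firstE.
Qed.

Lemma partial_current x i k : U x -> partial i (current h E X k) x =
  \sum_l (tau k l x * partial i (X l) x + X l x * partial i (tau k l) x).
Proof.
move=> Ux; rewrite (partial_near_eq i (current_near k Ux)) partial_sum.
  by apply: eq_bigr => l _; rewrite partialM //; [exact: (Ctau _ _ Ux).1|exact: (hX.1 _ _ Ux).1].
by move=> l; apply: differentiableM; [exact: (Ctau _ _ Ux).1|exact: (hX.1 _ _ Ux).1].
Qed.

(** The derivatives falling on [tau] vanish by [tau_div]. Those falling on [X] are contracted with a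
    symmetric tensor, hence only their symmetric part counts; it is a multiple of the identity and
    is killed by the trace. *)
Lemma div_current_flat x : U x ->
  \sum_i (partial i (current h E X i) x + 3 * dlog i x * current h E X i x) = 0.
Proof.
move=> Ux; have [kappa hk] := killing_partial Ux.
have Ti : \sum_i \sum_l tau i l x * partial i (X l) x = 0.
  (* Adding the sum to itself with the indices exchanged produces the symmetrised derivative of
     [X]. *)
  set S := LHS; suff : S + S = 0 by move=> /eqP; rewrite -mulr2n mulrn_eq0 => /eqP.
  transitivity (\sum_i tau i i x * kappa); last by rewrite -mulr_suml tau_tr ?mul0r.
  rewrite /S [X in _ + X]exchange_big -big_split /=.
  apply: eq_bigr => i _; rewrite -big_split /=.
  rewrite -(sum_delta i (fun l => tau i l x * kappa)).
  apply: eq_bigr => l _; rewrite (tau_sym l i Ux) -mulrDr hk.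
  by rewrite mulrCA mulrA.
transitivity (\sum_l X l x *
    \sum_i (partial i (tau i l) x + 3 * dlog i x * tau i l x)); last first.
  by apply: big1 => l _; rewrite tau_div ?mulr0.
transitivity (\sum_i \sum_l tau i l x * partial i (X l) x +
    \sum_l X l x * \sum_i (partial i (tau i l) x + 3 * dlog i x * tau i l x));
  last by rewrite Ti add0r.
under [X in _ = _ + X]eq_bigr do rewrite mulr_sumr.
rewrite [X in _ = _ + X]exchange_big -big_split /=; apply: eq_bigr => i _.
rewrite partial_current // /current mulr_sumr -!big_split /=; apply: eq_bigr => l _.
rewrite raise_firstE //.
move: (tau i l x) (X l x) (dlog i x) (partial i (X l) x) (partial i (tau i l) x) => *.
ring.
Qed.

(** In the divergence of a vector the connection enters through its trace, which is three times the
    gradient of log p. *)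
Lemma div_current0 x : U x -> div_vector h (current h E X) x = 0.
Proof.
move=> Ux; rewrite -(div_current_flat Ux) /div_vector /cov_vector.
under eq_bigr do under [X in _ + X]eq_bigr do rewrite conformal_christoffel //.
rewrite big_split [RHS]big_split /=; congr (_ + _).
rewrite exchange_big /=; apply: eq_bigr => m _; rewrite -mulr_suml; congr (_ * _).
under eq_bigr => i _.
  rewrite eqxx mul1r [m == i]eq_sym addrAC subrr add0r.
over.
by rewrite sumr_const card_ord mulr_natl.
Qed.

(** The cube of p is the volume density of the metric, which is why the Euclidean divergence of this
    field is a multiple of the covariant divergence of the current. *)
Lemma flux_fieldE x i : U x -> p x * \sum_j E i j x * X j x =
  p x * p x * p x * current h E X i x.
Proof.
move=> Ux; rewrite -!mulrA; congr (_ * _).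
rewrite /current !mulr_sumr; apply: eq_bigr => j _.
by rewrite raise_firstE // tauE // expr2 !mulrA.
Qed.

Lemma C1_current i : C1_on U (current h E X i).
Proof.
have CJ : C1_on U (fun x => \sum_j tau i j x * X j x).
  by apply: (C1_on_sum oU) => j; exact: (C1_onM oU (Ctau i j) (hX.1 j)).
apply: (C1_on_ext oU _ CJ) => x Ux.
by apply: eq_bigr => j _; rewrite raise_firstE.
Qed.

Lemma flux_field_C1 i : C1_on U (fun x => p x * \sum_j E i j x * X j x).
Proof.
have CF : C1_on U (fun x => p x * p x * p x * current h E X i x).
  exact: (C1_onM oU (C1_onM oU (C1_onM oU Cp Cp) Cp) (C1_current i)).
by apply: (C1_on_ext oU _ CF) => x Ux; rewrite flux_fieldE.
Qed.

Lemma flux_field_div0 x : U x ->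
  euclidean_div (fun i x => p x * \sum_j E i j x * X j x) x = 0.
Proof.
move=> Ux; rewrite /euclidean_div.
have p0 : p x != 0 by rewrite gt_eqF // p_gt0.
have nE i : \forall y \near x,
    p y * \sum_j E i j y * X j y = p y * p y * p y * current h E X i y.
  by apply: (near_open oU Ux) => y Uy; exact: flux_fieldE.
have dp := (Cp Ux).1; have dJ i := (C1_current i Ux).1.
transitivity (p x ^+ 3 * \sum_i (partial i (current h E X i) x
    + 3 * dlog i x * current h E X i x)); last by rewrite div_current_flat ?mulr0.
rewrite mulr_sumr; apply: eq_bigr => i _.
have dpp : differentiable (fun y => p y * p y) x := differentiableM dp dp.
have dppp : differentiable (fun y => p y * p y * p y) x := differentiableM dpp dp.
rewrite (partial_near_eq i (nE i)) (partialM _ dppp (dJ i)).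
rewrite (partialM _ dpp dp) (partialM _ dp dp) /dlog.
move: (p x) p0 (current h E X i x) (partial i p x) (partial i _ x) => *.
by field.
Qed.

Lemma conformal_current_laws :
  [/\ forall x, U x -> div_vector h (current h E X) x = 0,
      gauss_law h U E X & surface_independence h U E X].
Proof.
have hp x : U x -> h x = (p x ^+ 2)%:M /\ 0 < p x.
  move=> Ux; split; last exact: p_gt0.
  by apply/matrixP => i j; rewrite hE mxE; case: (i == j).
split; first exact: div_current0.
- exact: (conformally_flat_gauss_law oU hp flux_field_C1 flux_field_div0).
- exact: (conformally_flat_surface_independence oU hp flux_field_C1 flux_field_div0).
Qed.

End tensor.
End conformally_flat_calculus.

(** * Pointwise algebra of spin-2 fields *)

Section spin2_algebra.
Context (R : realType).
Notation s := (lift (ord0 : 'I_4)).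
Implicit Types i j k m : 'I_3.

(** Arithmetic in ['I_3] is modulo 3, so [i], [i + 1], [i - 1] run through the three axes in cyclic
    order; this encodes the spatial permutation symbol. *)
Lemma pred_ord3 i : i + 1 + 1 = i - 1.
Proof. by move: i; apply: ord3P; apply: val_inj. Qed.

Lemma succ_ord3 i : i - 1 - 1 = i + 1.
Proof. by move: i; apply: ord3P; apply: val_inj. Qed.

Lemma ord3_cyclicP (P : 'I_3 -> Prop) i : P i -> P (i + 1) -> P (i - 1) -> forall j, P j.
Proof.
have eP (u v : 'I_3) : u = v :> nat -> P u -> P v by move=> /val_inj ->.
by rewrite -pred_ord3; move: i; apply: ord3P => P0 P1 P2; apply: ord3P;
  [apply: eP P0|apply: eP P1|apply: eP P2|apply: eP P2|apply: eP P0|apply: eP P1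
  |apply: eP P1|apply: eP P2|apply: eP P0].
Qed.

Lemma neq_succ_ord3 i : (i == i + 1) = false.
Proof. by move: i; apply: ord3P. Qed.

Lemma neq_pred_ord3 i : (i == i - 1) = false.
Proof. by move: i; apply: ord3P. Qed.

Lemma sum3_cyclic (f : 'I_3 -> R) i : \sum_m f m = f i + f (i + 1) + f (i - 1).
Proof.
have -> : f (i - 1) = f (i + 1 + 1) by rewrite pred_ord3.
move: i; apply: ord3P; rewrite sum3.
- by congr (_ + f _ + f _); apply: val_inj.
- rewrite [RHS]addrC addrA; congr (f _ + f _ + f _); exact: val_inj.
- rewrite -[RHS]addrA [RHS]addrC; congr (f _ + f _ + f _); exact: val_inj.
Qed.

(** [G l c T] stands for the sum over m of Gamma^m_lc T_m in a static conformally flat metric: [a]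
    and [b] are the gradients of log N and log p, and [gamma] is N^2 / p^2. Likewise [w] and [dw]
    stand for the values of the spin-2 field and of its partial derivatives at one point, so that
    the rest is algebra. *)
Variables (a b : 'I_3 -> R) (gamma : R) (G : 'I_4 -> 'I_4 -> ('I_4 -> R) -> R).
Hypotheses (G00 : forall T, G 0 0 T = gamma * \sum_k a k * T (s k))
  (G0s : forall i T, G 0 (s i) T = a i * T 0)
  (Gs0 : forall i T, G (s i) 0 T = a i * T 0)
  (Gss : forall i j T, G (s i) (s j) T =
     b j * T (s i) + b i * T (s j) - (i == j)%:R * \sum_k b k * T (s k)).

Variables (w : 'I_4 -> 'I_4 -> 'I_4 -> 'I_4 -> R)
  (dw : 'I_4 -> 'I_4 -> 'I_4 -> 'I_4 -> 'I_4 -> R).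
Hypotheses (w_pair : forall c d e f, w c d e f = w e f c d)
  (w_anti : forall c d e f, w c d e f = - w d c e f)
  (w_cyclic : forall c d e f, w c d e f + w c e f d + w c f d e = 0)
  (w_trace0 : forall d, \sum_i w (s i) d (s i) 0 = 0)
  (w_trace : forall j k, gamma * \sum_i w (s i) (s j) (s i) (s k) = w 0 (s j) 0 (s k)).
Hypotheses (dw_pair : forall l c d e f, dw l c d e f = dw l e f c d)
  (dw_anti : forall l c d e f, dw l c d e f = - dw l d c e f)
  (dw_trace0 : forall l d, \sum_i dw l (s i) d (s i) 0 = 0).

Let cov l c d e f := dw l c d e f - G l c (fun x => w x d e f)
  - G l d (fun x => w c x e f) - G l e (fun x => w c d x f) - G l f (fun x => w c d e x).

Hypothesis bianchi : forall l c d e f, cov l c d e f + cov c d l e f + cov d l c e f = 0.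

Let S i j := w (s i) 0 0 (s j).

Lemma w_anti2 c d e f : w c d e f = - w c d f e.
Proof. by rewrite w_pair w_anti w_pair. Qed.

Lemma w_diag c e f : w c c e f = 0.
Proof. by have := w_anti c c e f; lra. Qed.

Lemma electric_sym i j : S i j = S j i.
Proof. by rewrite /S w_pair w_anti w_anti2 opprK. Qed.

Lemma electric_trace : \sum_i S i i = 0.
Proof.
have := w_trace0 0; under eq_bigr do rewrite w_anti2.
by rewrite sumrN => /eqP; rewrite oppr_eq0 => /eqP.
Qed.

(* Sum over [m] the Bianchi identities in [m, 0, j] with last indices [m, 0]. *)
Lemma electric_div j :
  \sum_i (dw (s i) (s i) 0 0 (s j) + (b i - 2 * a i) * S i j) = 0.
Proof.
have w1 i k : w 0 (s i) (s k) 0 = S k i by rewrite w_pair.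
have w2 i k : w (s i) 0 (s k) 0 = - S i k by rewrite w_anti2.
pose A := \sum_m dw (s m) (s m) 0 0 (s j).
pose P := \sum_m a m * S m j; pose B := \sum_m b m * S m j.
have PE : \sum_m a m * S j m = P by apply: eq_bigr => m _; rewrite electric_sym.
have BE : \sum_m b m * S j m = B by apply: eq_bigr => m _; rewrite electric_sym.
have -> : \sum_i (dw (s i) (s i) 0 0 (s j) + (b i - 2 * a i) * S i j) = A + B - 2 * P.
  rewrite /A /B /P mulr_sumr -big_split -sumrB; apply: eq_bigr => m _ /=.
  by move: (S m j) => *; ring.
have T1 : \sum_m cov (s m) 0 (s j) (s m) 0 = A + B - 2 * P.
  transitivity (\sum_m (dw (s m) (s m) 0 0 (s j) - 2 * (a m * S m j) - b j * S m m
    - 3 * (b m * S m j) + B + (j == m)%:R * \sum_k b k * S m k)).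
    apply: eq_bigr => m _; rewrite /cov !Gs0 !Gss eqxx mulr1n mul1r dw_pair.
    have -> : \sum_k b k * w 0 (s k) (s m) 0 = \sum_k b k * S m k.
      by apply: eq_bigr => k _; rewrite w1.
    have -> : \sum_k b k * w 0 (s j) (s k) 0 = B.
      by apply: eq_bigr => k _; rewrite w1.
    rewrite !w1 [m == j]eq_sym.
    move: (dw _ _ _ _ _) (a m) (b m) (b j) (S m m) (S m j) (\sum_k _) => *.
    by move: (_ == _)%:R => *; ring.
  rewrite !big_split /= sum_delta BE !sumrN -!mulr_sumr electric_trace mulr0 subr0.
  rewrite sumr_const card_ord -/A -/B -/P.
  by ring.
have T2 : \sum_m cov 0 (s j) (s m) (s m) 0 = 0.
  transitivity (\sum_m (- dw 0 (s m) (s j) (s m) 0 - a j * S m m + a m * S j m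
      + gamma * \sum_k a k * w (s m) (s j) (s m) (s k))).
    apply: eq_bigr => m _; rewrite /cov G00 !G0s dw_anti.
    have -> : \sum_k a k * w (s j) (s m) (s m) (s k) =
        - \sum_k a k * w (s m) (s j) (s m) (s k).
      by rewrite -sumrN; apply: eq_bigr => k _; rewrite w_anti mulrN.
    rewrite w1 w2 w_pair w_diag.
    by move: (dw _ _ _ _ _) (S m m) (S j m) (\sum_k _) => *; ring.
  rewrite !big_split /= !sumrN dw_trace0 -mulr_sumr electric_trace -mulr_sumr.
  rewrite exchange_big /= mulr_sumr PE.
  (* The trace condition turns the spatial trace of [w] back into electric components, which cancel
     the terms in [a] coming from the other Christoffel symbols. *)
  have -> : \sum_k gamma * \sum_m a k * w (s m) (s j) (s m) (s k) = - P.
    rewrite -PE -sumrN; apply: eq_bigr => k _.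
    by rewrite -mulr_sumr mulrCA w_trace w_anti mulrN.
  by rewrite mulr0 subr0 oppr0 add0r subrr.
have T3 : \sum_m cov (s j) (s m) 0 (s m) 0 = 0.
  transitivity (\sum_m (dw (s j) (s m) 0 (s m) 0 + 2 * b j * S m m
      + 2 * (b m * S j m) + 2 * a j * S m m - 2 * ((j == m)%:R * \sum_k b k * S m k))).
    apply: eq_bigr => m _; rewrite /cov !Gs0 !Gss.
    have -> : \sum_k b k * w (s k) 0 (s m) 0 = - \sum_k b k * S m k.
      by rewrite -sumrN; apply: eq_bigr => k _; rewrite w2 mulrN electric_sym.
    have -> : \sum_k b k * w (s m) 0 (s k) 0 = - \sum_k b k * S m k.
      by rewrite -sumrN; apply: eq_bigr => k _; rewrite w2 mulrN.
    rewrite !w2 [S m j]electric_sym.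
    move: (dw _ _ _ _ _) (S m m) (S j m) (\sum_k _) => *.
    by move: (_ == _)%:R => *; ring.
  rewrite !big_split /= sumrN -!mulr_sumr sum_delta dw_trace0 electric_trace BE.
  by ring.
have : \sum_m cov (s m) 0 (s j) (s m) 0 + \sum_m cov 0 (s j) (s m) (s m) 0
    + \sum_m cov (s j) (s m) 0 (s m) 0 = 0.
  by rewrite -!big_split; apply: big1 => m _; exact: bianchi.
by rewrite T1 T2 T3 !addr0.
Qed.

Let H i j := w (s i) 0 (s (j + 1)) (s (j - 1)).

(** The three diagonal terms are those of the cyclic identity with one time index and three distinct
    spatial ones. *)
Lemma magnetic_trace : \sum_i H i i = 0.
Proof.
rewrite (sum3_cyclic _ 0) /H !sub0r !add0r subrr addNr.
have := w_cyclic 0 (s 0) (s 1) (s (-1)).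
rewrite (_ : 1 + 1 = -1) -?[-1 - 1]/(- 1 - 1 : 'I_3) ?succ_ord3; last exact: val_inj.
rewrite (_ : -1 - 1 = 1); last exact: val_inj.
by rewrite ![w (s _) 0 _ _]w_anti; lra.
Qed.

(* Equivalent to the vanishing of the traces of [w] with one time index. *)
Lemma magnetic_sym i j : H i j = H j i.
Proof.
have succ k : H k (k + 1) = H (k + 1) k.
  have := w_trace0 (s (k - 1)); rewrite (sum3_cyclic _ k).
  rewrite w_diag addr0 => E.
  rewrite /H pred_ord3 addrK w_pair [RHS]w_pair [LHS]w_anti.
  by move: E; lra.
by move: j; apply: (@ord3_cyclicP _ i) => //; have := succ (i - 1); rewrite subrK => ->.
Qed.

(* The Bianchi identity in the three spatial indices with last indices [j, 0]. *)
Lemma magnetic_div j :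
  \sum_i (dw (s i) (s j) 0 (s (i + 1)) (s (i - 1)) - a i * H j i) = 0.
Proof.
have h1 i k : w (s (i + 1)) (s (i - 1)) (s k) 0 = H k i by rewrite w_pair.
have h2 i : w (s i) (s (i - 1)) (s j) 0 = - H j (i + 1).
  by rewrite w_pair w_anti2 /H pred_ord3 addrK.
have h3 i : w (s (i + 1)) (s i) (s j) 0 = - H j (i - 1).
  by rewrite w_pair w_anti2 /H succ_ord3 subrK.
pose B := \sum_m b m * H j m.
have BE : \sum_k b k * H k j = B by apply: eq_bigr => k _; rewrite magnetic_sym.
have covE i : cov (s i) (s (i + 1)) (s (i - 1)) (s j) 0 =
    dw (s i) (s j) 0 (s (i + 1)) (s (i - 1)) - a i * H j i
    + b (i + 1) * H j (i + 1) + b (i - 1) * H j (i - 1) - 3 * (b i * H j i)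
    - b j * H i i + (j == i)%:R * \sum_k b k * H k i.
  rewrite /cov !Gs0 !Gss neq_succ_ord3 neq_pred_ord3 !h1 h2 h3 !mul0r dw_pair.
  have -> : \sum_k b k * w (s (i + 1)) (s (i - 1)) (s k) 0 = \sum_k b k * H k i.
    by apply: eq_bigr => k _; rewrite h1.
  rewrite [i == j]eq_sym; move: (dw _ _ _ _ _) (H _ _) (H _ _) (H _ _) (H _ _) (\sum_k _).
  by move: (b (i + 1)) (b (i - 1)) (b i) (_ == _)%:R => *; ring.
(* Summation is invariant under cyclic shifts, so the terms in [b] add up to B + B - 3 B + B = 0,
   apart from one that carries the vanishing trace. *)
have sh (u : 'I_3) : \sum_i b (i + u) * H j (i + u) = B.
  by rewrite [RHS](reindex_inj (addIr u)).
have : \sum_i cov (s i) (s (i + 1)) (s (i - 1)) (s j) 0 = 0.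
  rewrite (sum3_cyclic _ 0) !sub0r !add0r subrr addNr.
  have -> : 1 + 1 = -1 :> 'I_3 by exact: val_inj.
  have -> : -1 - 1 = 1 :> 'I_3 by exact: val_inj.
  exact: bianchi.
under eq_bigr do rewrite covE.
rewrite big_split sumrB sumrB big_split big_split /= !sh -!mulr_sumr sum_delta BE.
rewrite magnetic_trace -/B.
by move: (\sum_i _) => T; lra.
Qed.

End spin2_algebra.

(** * Static conformally flat spacetimes *)

Section spacetime_coordinates.
Context (R : realType).
Notation s := (lift (ord0 : 'I_4)).

Lemma event0 t (x : 'rV[R]_3) : event t x 0 0 = t.
Proof. by rewrite mxE unlift_none. Qed.

Lemma event_lift t (x : 'rV[R]_3) i : event t x 0 (s i) = x 0 i.
Proof. by rewrite mxE liftK. Qed.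

Lemma space_part_event t (x : 'rV[R]_3) : space_part (event t x) = x.
Proof. by apply/rowP => i; rewrite mxE event_lift. Qed.

Lemma ord4P (P : 'I_4 -> Prop) : P 0 -> (forall i, P (s i)) -> forall m, P m.
Proof. by move=> P0 Ps m; case: (unliftP 0 m) => [i ->|->]. Qed.

Lemma C1_on_event t (U : set 'rV[R]_3) i : open U ->
  C1_on U (fun x => event t x 0 i).
Proof.
move=> oU; move: i; apply: ord4P => [|i].
  by under eq_fun do rewrite event0; exact: C1_on_cst.
by under eq_fun do rewrite event_lift; exact: C1_on_coord.
Qed.

Lemma partial_event t (x : 'rV[R]_3) i m :
  partial i (fun y => event t y 0 m) x = (m == s i)%:R.
Proof.
move: m; apply: ord4P => [|k].
  by under eq_fun do rewrite event0; rewrite partial_cst.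
by under eq_fun do rewrite event_lift; rewrite partial_coord (inj_eq lift_inj).
Qed.

Lemma differentiable_event t (x : 'rV[R]_3) : differentiable (event t) x.
Proof.
by apply: differentiable_row => i; exact: (C1_on_event t i openT I).1.
Qed.

Lemma partial_on_slice t (f : 'rV[R]_4 -> R) x i : differentiable f (event t x) ->
  partial i (fun y => f (event t y)) x = partial (s i) f (event t x).
Proof.
move=> df; rewrite partial_comp //; last exact: differentiable_event.
under eq_bigr do rewrite partial_event mulrC eq_sym.
exact: sum_delta.
Qed.

Lemma differentiable_space_part (q : 'rV[R]_4) : differentiable (@space_part R) q.
Proof.
apply: differentiable_row => i; under eq_fun do rewrite mxE.
exact: differentiable_coord.
Qed.

Lemma partial_space_part (q : 'rV[R]_4) i m :
  partial m (fun y => space_part y 0 i) q = (s i == m)%:R.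
Proof. by under eq_fun do rewrite mxE; rewrite partial_coord. Qed.

Lemma partial_static0 (f : 'rV[R]_3 -> R) q : differentiable f (space_part q) ->
  partial 0 (fun y => f (space_part y)) q = 0.
Proof.
move=> df; rewrite partial_comp //; last exact: differentiable_space_part.
by apply: big1 => i _; rewrite partial_space_part mulr0.
Qed.

Lemma partial_static (f : 'rV[R]_3 -> R) q i : differentiable f (space_part q) ->
  partial (s i) (fun y => f (space_part y)) q = partial i f (space_part q).
Proof.
move=> df; rewrite partial_comp //; last exact: differentiable_space_part.
under eq_bigr do rewrite partial_space_part (inj_eq lift_inj) mulrC eq_sym.
exact: sum_delta.
Qed.

End spacetime_coordinates.

(** * The permutation symbol in four dimensions *)

Section permutation_symbol.
Context (R : realType).
Implicit Types a b c d : 'I_4.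
Notation s := (lift (ord0 : 'I_4)).

Lemma perm_symbol_perm (u : 'S_4) : perm_symbol R (u 0) (u 1) (u 2) (u 3) = (-1) ^+ u.
Proof.
rewrite -det_perm; congr (\det _); apply/matrixP => i j; rewrite !mxE; congr (_ == _)%:R.
by move: i => [[|[|[|[|//]]]] lt_i] /=; rewrite /tnth /=; congr (u _); exact: val_inj.
Qed.

Lemma perm_symbol_swap a b c d : perm_symbol R b a c d = - perm_symbol R a b c d.
Proof.
rewrite /perm_symbol; set A := (X in _ = - \det X).
have -> : \matrix_(i < 4, j < 4) (tnth [tuple b; a; c; d] i == j)%:R = row_perm (tperm 0 1) A.
  apply/matrixP => i j; rewrite !mxE permE.
  by move: i => [[|[|[|[|//]]]] lt_i].
by rewrite row_permE det_mulmx det_perm odd_tperm /= expr1 mulN1r.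
Qed.

Lemma perm_symbol_rep a b c d i k : i != k ->
  tnth [tuple a; b; c; d] i = tnth [tuple a; b; c; d] k -> perm_symbol R a b c d = 0.
Proof. by move=> ik e; apply: (determinant_alternate ik) => j; rewrite !mxE e. Qed.

(** For each [j] the indices form an even permutation, exhibited as a product of two
    transpositions. *)
Lemma perm_symbol_spatial j : perm_symbol R (s (j + 1)) (s (j - 1)) 0 (s j) = 1.
Proof.
move: j; apply: ord3P.
- have := perm_symbol_perm (tperm 0 2 * tperm 1 3).
  rewrite odd_permM !odd_tperm /= expr0 => <-.
  by rewrite !permM !permE /=; congr perm_symbol; exact: val_inj.
- have := perm_symbol_perm (tperm 0 3 * tperm 0 2).
  rewrite odd_permM !odd_tperm /= expr0 => <-.
  by rewrite !permM !permE /=; congr perm_symbol; exact: val_inj.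
- have := perm_symbol_perm (tperm 0 1 * tperm 0 2).
  rewrite odd_permM !odd_tperm /= expr0 => <-.
  by rewrite !permM !permE /=; congr perm_symbol; exact: val_inj.
Qed.

End permutation_symbol.

Definition conserved_charges (R : realType) (h : 'rV[R]_3 -> 'M[R]_3)
    (U : set 'rV[R]_3) (E : 'I_3 -> 'I_3 -> 'rV[R]_3 -> R) : Prop :=
  (forall x, U x -> forall j, div_mixed h (raise_first h E) j x = 0) /\
  forall X, conformal_killing h U X ->
    [/\ forall x, U x -> div_vector h (current h E X) x = 0,
        gauss_law h U E X & surface_independence h U E X].

Section static_spacetime.
Context (R : realType) (U : set 'rV[R]_3) (N p : 'rV[R]_3 -> R)
  (g : 'rV[R]_4 -> 'M[R]_4).
Notation s := (lift (ord0 : 'I_4)).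
Hypotheses (oU : open U) (CN : C1_on U N) (Cp : C1_on U p)
  (N_gt0 : forall x, U x -> 0 < N x) (p_gt0 : forall x, U x -> 0 < p x).

Let d (m : 'I_4) (q : 'rV[R]_4) : R :=
  if m == 0 then - N (space_part q) ^+ 2 else p (space_part q) ^+ 2.

Hypothesis gE : forall q a b, g q a b = if a == b then d a q else 0.

Let N_neq0 x : U x -> N x != 0. Proof. by move=> /N_gt0/lt0r_neq0. Qed.
Let p_neq0 x : U x -> p x != 0. Proof. by move=> /p_gt0/lt0r_neq0. Qed.

Section at_point.
Variable q : 'rV[R]_4.
Hypothesis Uq : U (space_part q).
Let x := space_part q.
Let a i := dlog N i x.
Let b i := dlog p i x.

Lemma static_metric_neq0 m : d m q != 0.
Proof.
rewrite /d; case: ifP => _; first rewrite oppr_eq0.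
  by rewrite expf_neq0 // gt_eqF // N_gt0.
by rewrite expf_neq0 // gt_eqF // p_gt0.
Qed.

Lemma static_inverse m v : invmx (g q) m v = if m == v then (d m q)^-1 else 0.
Proof. exact: (invmx_diagonal (gE q) static_metric_neq0). Qed.

Lemma differentiable_sqr n (f : 'rV[R]_n -> R) y :
  differentiable f y -> differentiable (fun z => f z ^+ 2) y.
Proof. by move=> df; under eq_fun do rewrite expr2; exact: differentiableM. Qed.

Let dp2 : differentiable (fun y => p y ^+ 2) x := differentiable_sqr (Cp Uq).1.
Let dN2 : differentiable (fun y => - N y ^+ 2) x :=
  differentiableN (differentiable_sqr (CN Uq).1).

Lemma static_partial0 m : partial 0 (d m) q = 0.
Proof.
rewrite /d; case: (m == 0); first exact: (@partial_static0 R (fun x => - N x ^+ 2)).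
exact: (@partial_static0 R (fun x => p x ^+ 2)).
Qed.

Lemma static_partial i m : partial (s i) (d m) q =
  2 * d m q * (if m == 0 then a i else b i).
Proof.
have dN := (CN Uq).1; have dp := (Cp Uq).1.
have N0 := N_neq0 Uq.
have p0 := p_neq0 Uq.
have sqr (f : 'rV[R]_3 -> R) : differentiable f x ->
    partial i (fun y => f y ^+ 2) x = 2 * f x * partial i f x.
  by move=> df; under eq_fun do rewrite expr2; rewrite partialM //; ring.
rewrite /d /a /b /dlog; case: (m == 0).
  rewrite (@partial_static R (fun x => - N x ^+ 2)) //.
  rewrite partialN ?sqr //; last exact: differentiable_sqr.
  by rewrite -/x; move: (N x) N0 (partial _ _ _) => *; field.
rewrite (@partial_static R (fun x => p x ^+ 2)) ?sqr //.
by rewrite -/x; move: (p x) p0 (partial _ _ _) => *; field.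
Qed.

Let G l c (T : 'I_4 -> R) := \sum_m christoffel g m l c q * T m.

Lemma static_christoffel_sum l c T : G l c T =
  partial l (d c) q / (2 * d c q) * T c + partial c (d l) q / (2 * d l q) * T l
  - (l == c)%:R * \sum_m partial m (d l) q / (2 * d m q) * T m.
Proof.
rewrite /G -(sum_delta c (fun m => partial l (d m) q / (2 * d m q) * T m)).
rewrite -(sum_delta l (fun m => partial c (d m) q / (2 * d m q) * T m)).
rewrite mulr_sumr -big_split -sumrB; apply: eq_bigr => m _ /=.
rewrite (christoffel_diagonal gE static_metric_neq0).
move: ((2 * d m q)^-1) (partial l _ _) (partial c _ _) (partial m _ _) (T m) => *.
by do 3!case: (_ == _) => /=; ring.
Qed.

Lemma static_G00 T : G 0 0 T = (N x ^+ 2 / p x ^+ 2) * \sum_k a k * T (s k).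
Proof.
rewrite static_christoffel_sum static_partial0 !mul0r !add0r eqxx mul1r.
rewrite big_ord_recl static_partial0 !mul0r add0r mulr_sumr -sumrN.
apply: eq_bigr => i _; rewrite static_partial /= /d /= -/x.
have p0 := p_neq0 Uq.
by move: (p x) p0 (N x) (a i) (T _) => *; field.
Qed.

Lemma static_Gs0 i T : G (s i) 0 T = a i * T 0.
Proof.
rewrite static_christoffel_sum static_partial0 static_partial /= !mul0r addr0 subr0.
have := static_metric_neq0 0; move: (d 0 q) (a i) (T 0) => D e t D0; by field.
Qed.

Lemma static_G0s i T : G 0 (s i) T = a i * T 0.
Proof.
rewrite static_christoffel_sum static_partial0 static_partial /= !mul0r add0r subr0.
have := static_metric_neq0 0; move: (d 0 q) (a i) (T 0) => D e t D0; by field.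
Qed.

Lemma static_Gss i j T : G (s i) (s j) T =
  b j * T (s i) + b i * T (s j) - (i == j)%:R * \sum_k b k * T (s k).
Proof.
rewrite static_christoffel_sum !static_partial /= (inj_eq lift_inj).
rewrite big_ord_recl static_partial0 !mul0r add0r.
have ds k : d (s k) q = p x ^+ 2 by [].
have p0 := p_neq0 Uq.
have e k : 2 * d (s i) q * b k / (2 * d (s k) q) * T (s k) = b k * T (s k).
  by rewrite !ds; move: (p x) p0 (b k) (T _) => *; field.
rewrite [X in _ - _ * X = _](_ : _ = \sum_k b k * T (s k)); last first.
  by apply: eq_bigr => k _; rewrite static_partial /= e.
rewrite !ds; move: (p x) p0 (b i) (b j) (T _) (T _) (\sum_k _) ((i == j)%:R) => *.
by field.
Qed.

Lemma static_volume_element : Num.sqrt `|\det (g q)| = N x * p x ^+ 3.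
Proof.
have -> : g q = diag_mx (\row_m d m q).
  by apply/matrixP => m v; rewrite gE !mxE; case: eqP.
rewrite det_diag; under eq_bigr do rewrite mxE.
have Nx := N_gt0 Uq; have px := p_gt0 Uq.
rewrite big_ord_recl /= prodr_const card_ord /d /= mulNr normrN -/x.
have -> : N x ^+ 2 * p x ^+ 2 ^+ 3 = (N x * p x ^+ 3) ^+ 2.
  by rewrite [RHS]exprMn -!exprM.
by rewrite normrX sqrtr_sqr normr_id gtr0_norm // mulr_gt0 // exprn_gt0.
Qed.

(** Only the index pairs (j + 1, j - 1) and (j - 1, j + 1) survive, and by antisymmetry they
    contribute equally, which absorbs the factor 1/2. Raising two spatial indices gives p^-4 and the
    volume element N p^3, whence N / p. *)
Lemma static_right_dual (W : 'I_4 -> 'I_4 -> 'I_4 -> 'I_4 -> 'rV[R]_4 -> R) i j :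
  (forall e f, W (s i) 0 e f q = - W (s i) 0 f e q) ->
  right_dual g W (s i) 0 0 (s j) q =
  N x / p x * W (s i) 0 (s (j + 1)) (s (j - 1)) q.
Proof.
move=> Wanti; have px := p_gt0 Uq; have p0 : p x != 0 by rewrite gt_eqF.
pose F e f := (d e q)^-1 * (d f q)^-1 * (N x * p x ^+ 3) * perm_symbol R e f 0 (s j).
have FE e f : \sum_c \sum_h invmx (g q) e c * invmx (g q) f h * levi_civita g c h 0 (s j) q
    = F e f.
  transitivity (\sum_c (e == c)%:R * \sum_h (f == h)%:R *
      ((d e q)^-1 * (d f q)^-1 * levi_civita g c h 0 (s j) q)).
    apply: eq_bigr => c _; rewrite mulr_sumr; apply: eq_bigr => h _.
    rewrite !static_inverse.
    by case: (e == c); case: (f == h); rewrite ?mul1r ?mul0r ?mulr0 ?mul0r.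
  by rewrite !sum_delta /levi_civita static_volume_element mulrA.
rewrite /right_dual.
under eq_bigr do under eq_bigr do rewrite FE.
have Fe f : F 0 f = 0.
  by rewrite /F (@perm_symbol_rep _ _ _ _ _ 0 2) // mulr0.
have Ff e : F e 0 = 0.
  by rewrite /F (@perm_symbol_rep _ _ _ _ _ 1 2) // mulr0.
have Fj f : F (s j) f = 0.
  by rewrite /F (@perm_symbol_rep _ _ _ _ _ 0 3) // mulr0.
have Fj' e : F e (s j) = 0.
  by rewrite /F (@perm_symbol_rep _ _ _ _ _ 1 3) // mulr0.
have Fd e : F e e = 0.
  by rewrite /F (@perm_symbol_rep _ _ _ _ _ 0 1) // mulr0.
have Fp : F (s (j + 1)) (s (j - 1)) = N x / p x.
  rewrite /F perm_symbol_spatial /d /= -/x.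
  by move: (p x) p0 (N x) => *; field.
have Fm : F (s (j - 1)) (s (j + 1)) = - (N x / p x).
  rewrite /F perm_symbol_swap perm_symbol_spatial /d /= -/x.
  by move: (p x) p0 (N x) => *; field.
rewrite big_ord_recl [X in X + _]big1 ?add0r => [|f _]; last by rewrite Fe mulr0.
under eq_bigr do rewrite big_ord_recl Ff mulr0 add0r.
rewrite (sum3_cyclic _ j) !(sum3_cyclic _ j) !Fj !Fj' !Fd Fp Fm.
rewrite !mulr0 !addr0 !add0r [W _ _ (s (j - 1)) _ _]Wanti.
by move: (W _ _ _ _ _) (N x / p x) => *; field.
Qed.

(** Orthogonality removes the spatial components of [n], and normalisation determines the square of
    its time component, the only quantity that enters. *)
Lemma static_electric n W i j : unit_normal_to_slices g (fun q => U (space_part q)) n ->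
  electric W n i j q = W i 0 0 j q / N x ^+ 2.
Proof.
move=> hn; have [nn no] := hn q Uq.
have ns k : n (s k) q = 0.
  have := no k; rewrite (bigD1 (s k)) //= big1 ?addr0 => [|m mk]; last first.
    by rewrite gE (negbTE mk) mul0r.
  by rewrite gE eqxx => /eqP; rewrite mulf_eq0 (negbTE (static_metric_neq0 _)) => /eqP.
have Nx : N x != 0 by rewrite gt_eqF // N_gt0.
have n0 : n 0 q * n 0 q = (N x ^+ 2)^-1.
  move: nn; rewrite (bigD1 0) //= [X in _ + X]big1 ?addr0 => [|m]; last first.
    move: m; apply: ord4P => // k _; apply: big1 => m _.
    by rewrite ns mulr0 mul0r.
  rewrite (bigD1 0) //= big1 ?addr0 => [|m]; last first.
    by rewrite gE eq_sym => /negbTE ->; rewrite !mul0r.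
  rewrite gE eqxx /d eqxx -/x => e.
  apply: (mulfI (x := N x ^+ 2)); first by rewrite expf_neq0.
  rewrite mulfV ?expf_neq0 //; move: e; move: (N x ^+ 2) (n 0 q) => *; lra.
rewrite /electric (bigD1 0) //= [X in _ + X]big1 ?addr0 => [|m]; last first.
  move: m; apply: ord4P => // k _; apply: big1 => m _.
  by rewrite ns mulr0 mul0r.
rewrite (bigD1 0) //= big1 ?addr0 => [|m]; last first.
  by move: m; apply: ord4P => // k _; rewrite ns mulr0.
by rewrite -mulrA n0.
Qed.

End at_point.

(** * From components of the spin-2 field to conserved charges *)

Section rescaled_divergence.
Variables (D : 'rV[R]_3 -> R) (c : 'I_3 -> 'rV[R]_3 -> R)
  (V : 'I_3 -> 'I_3 -> 'rV[R]_3 -> R).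
Hypotheses (CD : C1_on U D) (D_neq0 : forall x, U x -> D x != 0)
  (CV : forall i j, C1_on U (V i j))
  (Dc : forall x i, U x -> partial i D x = D x * c i x).

Lemma rescaled_C1 i j : C1_on U (fun x => (D x)^-1 * V i j x).
Proof. exact: (C1_onM oU (C1_onV oU CD D_neq0) (CV i j)). Qed.

Lemma partial_rescaled x i j k : U x -> partial i (fun y => (D y)^-1 * V j k y) x =
  (D x)^-1 * (partial i (V j k) x - c i x * V j k x).
Proof.
move=> Ux; have dD := (CD Ux).1; have dV := (CV j k Ux).1.
have dI := (C1_onV oU CD D_neq0 Ux).1; have D0 := D_neq0 Ux.
rewrite partialM //.
have : partial i (fun y => (D y)^-1 * D y) x = 0.
  rewrite -(partial_cst 1 x i); apply: partial_near_eq.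
  by apply: (near_open oU Ux) => y Uy; rewrite mulVf ?D_neq0.
rewrite partialM // Dc // => e.
have -> : partial i (fun y => (D y)^-1) x = - ((D x)^-1 * c i x).
  apply: (mulfI D0); apply: (eq_of_multiple (c := 1) e).
  by move: (D x) D0 (partial _ _ _) (c i x) => *; field.
by move: (D x)^-1 (partial _ _ _) (c i x) (V j k x) => *; ring.
Qed.

(** [c] is the logarithmic gradient of [D], so dividing by [D] shifts the coefficient 3 grad log p
    by - [c]. A suitable product of powers of N and p then matches the coefficients given by the
    Bianchi identity. *)
Lemma rescaled_divergence x j : U x ->
  \sum_i (partial i (V i j) x + (3 * dlog p i x - c i x) * V i j x) = 0 ->
  \sum_i (partial i (fun y => (D y)^-1 * V i j y) x
    + 3 * dlog p i x * ((D x)^-1 * V i j x)) = 0.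
Proof.
move=> Ux V0; transitivity ((D x)^-1 * \sum_i (partial i (V i j) x
    + (3 * dlog p i x - c i x) * V i j x)); last by rewrite V0 mulr0.
rewrite mulr_sumr; apply: eq_bigr => i _.
rewrite partial_rescaled //.
by move: (D x)^-1 (partial _ _ _) (c i x) (dlog _ _ _) (V i j x) => *; ring.
Qed.

Variables (h : 'rV[R]_3 -> 'M[R]_3) (E : 'I_3 -> 'I_3 -> 'rV[R]_3 -> R).
Hypotheses (hE : forall x i j, h x i j = if i == j then p x ^+ 2 else 0)
  (EV : forall x i j, U x -> E i j x = p x ^+ 2 * ((D x)^-1 * V i j x))
  (V_sym : forall x i j, U x -> V i j x = V j i x)
  (V_trace : forall x, U x -> \sum_i V i i x = 0)
  (V_div : forall x j, U x ->
    \sum_i (partial i (V i j) x + (3 * dlog p i x - c i x) * V i j x) = 0).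

Lemma rescaled_laws : conserved_charges h U E.
Proof.
have tau_sym x i j : U x -> (D x)^-1 * V i j x = (D x)^-1 * V j i x.
  by move=> Ux; rewrite V_sym.
have tau_tr x : U x -> \sum_i (D x)^-1 * V i i x = 0.
  by move=> Ux; rewrite -mulr_sumr V_trace ?mulr0.
have tau_div x j (Ux : U x) := rescaled_divergence Ux (V_div j Ux).
split=> [x Ux j|X hX].
  exact: (div_mixed0 (tau := fun i j x => (D x)^-1 * V i j x)
    oU Cp p_gt0 hE tau_sym tau_tr EV tau_div j Ux).
exact: (conformal_current_laws (tau := fun i j x => (D x)^-1 * V i j x)
  oU Cp p_gt0 hE rescaled_C1 tau_sym tau_tr EV tau_div hX).
Qed.

End rescaled_divergence.

Variables (W : 'I_4 -> 'I_4 -> 'I_4 -> 'I_4 -> 'rV[R]_4 -> R)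
  (n : 'I_4 -> 'rV[R]_4 -> R) (t : R).
Hypotheses (hW : spin2_field g (fun q => U (space_part q)) W)
  (hn : unit_normal_to_slices g (fun q => U (space_part q)) n).

Section spin2_at_point.
Variable q : 'rV[R]_4.
Hypothesis Uq : U (space_part q).

Lemma spin2_pair a b m v : W a b m v q = W m v a b q.
Proof. by have [] := hW.2 q Uq. Qed.

Lemma spin2_anti a b m v : W a b m v q = - W b a m v q.
Proof.
have [_ h _ _ _] := hW.2 q Uq.
by rewrite [LHS]h [X in - X]h /antisym2; move: (W _ _ _ _ _) (W _ _ _ _ _) (W _ _ _ _ _) (W _ _ _ _ _) => *; ring.
Qed.

Lemma spin2_cyclic a b m v : W a b m v q + W a m v b q + W a v b m q = 0.
Proof.
have [_ _ h _ _] := hW.2 q Uq.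
have anti3 c e f : W a c e f q = - W a c f e q.
  by rewrite spin2_pair spin2_anti spin2_pair.
have := h a b m v; rewrite /antisym3 (anti3 m b v) (anti3 b v m) (anti3 v m b).
by move: (W a b m v q) (W a m v b q) (W a v b m q) => *; lra.
Qed.

Lemma spin2_trace b v : N (space_part q) ^+ 2 / p (space_part q) ^+ 2 *
  \sum_i W (s i) b (s i) v q = W 0 b 0 v q.
Proof.
have [_ _ _ h _] := hW.2 q Uq; have := h b v.
have -> : \sum_a \sum_m invmx (g q) a m * W a b m v q = \sum_a (d a q)^-1 * W a b a v q.
  apply: eq_bigr => a _; rewrite -[RHS](sum_delta a (fun m => (d a q)^-1 * W a b m v q)).
  apply: eq_bigr => m _; rewrite static_inverse //.
  by case: (a == m); rewrite ?mul1r ?mul0r.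
have N0 := N_neq0 Uq.
have p0 := p_neq0 Uq.
rewrite big_ord_recl /d /= -mulr_sumr => e.
apply: (eq_of_multiple (c := N (space_part q) ^+ 2) e).
rewrite -[W ord0 b ord0 v q]/(W 0 b 0 v q).
rewrite invrN; move: (N _) N0 (p _) p0 (W 0 b 0 v q) (\sum_i _) => *.
by field; apply/andP.
Qed.

(** The time component W_0b00 in the trace vanishes by antisymmetry in the last pair, which leaves
    the spatial part alone. *)
Lemma spin2_trace0 b : \sum_i W (s i) b (s i) 0 q = 0.
Proof.
have z : W 0 b 0 0 q = 0.
  by have := spin2_anti 0 0 0 b; rewrite (spin2_pair 0 b); lra.
have /eqP := spin2_trace b 0; rewrite z mulf_eq0 mulf_eq0 invr_eq0 !expf_eq0 /=.
by rewrite (gt_eqF (N_gt0 Uq)) (gt_eqF (p_gt0 Uq)) => /eqP.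
Qed.

End spin2_at_point.

Section spin2_derivatives.
Variable q : 'rV[R]_4.
Hypothesis Uq : U (space_part q).

Let nearU : \forall y \near q, U (space_part y).
Proof.
have := differentiable_continuous (differentiable_space_part q); apply.
exact: open_nbhs_nbhs.
Qed.

Let dW l a b m v := partial l (W a b m v) q.

(** The algebraic symmetries hold on a neighbourhood of [q] and may be differentiated there. *)
Lemma spin2_partial_pair l a b m v : dW l a b m v = dW l m v a b.
Proof.
by apply: partial_near_eq; apply: filterS nearU => y Uy; exact: spin2_pair.
Qed.

Lemma spin2_partial_anti l a b m v : dW l a b m v = - dW l b a m v.
Proof.
rewrite /dW -partialN; last exact: (hW.1 _ _ _ _ q Uq).1.
by apply: partial_near_eq; apply: filterS nearU => y Uy; exact: spin2_anti.
Qed.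

Lemma spin2_partial_trace0 l b : \sum_i dW l (s i) b (s i) 0 = 0.
Proof.
rewrite /dW -partial_sum; last by move=> i; exact: (hW.1 _ _ _ _ q Uq).1.
rewrite -[RHS](partial_cst 0 q l).
by apply: partial_near_eq; apply: filterS nearU => y Uy; exact: spin2_trace0.
Qed.

Lemma cov_rank4_anti l a b m v : cov_rank4 g W l a b m v q = - cov_rank4 g W l b a m v q.
Proof.
have sN e (F F' : 'I_4 -> R) : (forall k, F k = - F' k) ->
    \sum_k christoffel g k l e q * F k = - \sum_k christoffel g k l e q * F' k.
  by move=> FF; rewrite -sumrN; apply: eq_bigr => k _; rewrite FF mulrN.
rewrite /cov_rank4 -![partial l _ q]/(dW l _ _ _ _) spin2_partial_anti.
rewrite (sN a _ (fun k => W b k m v q)) => [|k]; last exact: spin2_anti.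
rewrite (sN b _ (fun k => W k a m v q)) => [|k]; last exact: spin2_anti.
rewrite (sN m _ (fun k => W b a k v q)) => [|k]; last exact: spin2_anti.
rewrite (sN v _ (fun k => W b a m k q)) => [|k]; last exact: spin2_anti.
move: (dW _ _ _ _ _) (\sum_k _) (\sum_k _) (\sum_k _) (\sum_k _) => *; ring.
Qed.

(** Covariant differentiation preserves the antisymmetry in the first pair, so the six terms of the
    antisymmetrisation reduce to twice the cyclic sum. *)
Lemma spin2_bianchi l a b m v : cov_rank4 g W l a b m v q
  + cov_rank4 g W a b l m v q + cov_rank4 g W b l a m v q = 0.
Proof.
have [_ _ _ _ h] := hW.2 q Uq; have := h l a b m v; rewrite /antisym3.
rewrite (cov_rank4_anti a l) (cov_rank4_anti l b) (cov_rank4_anti b a).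
by move: (cov_rank4 _ _ _ _ _ _ _ _) (cov_rank4 _ _ _ _ _ _ _ _)
  (cov_rank4 _ _ _ _ _ _ _ _) => *; lra.
Qed.

Lemma spin2_electric_div j : \sum_i (dW (s i) (s i) 0 0 (s j) +
  (dlog p i (space_part q) - 2 * dlog N i (space_part q)) * W (s i) 0 0 (s j) q) = 0.
Proof.
exact: (electric_div (static_G00 Uq) (static_G0s Uq) (static_Gs0 Uq) (static_Gss Uq)
  (w := fun a b m v => W a b m v q) (dw := dW)
  (spin2_pair Uq) (spin2_anti Uq) (spin2_trace0 Uq) (fun j k => spin2_trace Uq (s j) (s k))
  spin2_partial_pair spin2_partial_anti spin2_partial_trace0 spin2_bianchi).
Qed.

Lemma spin2_magnetic_div j : \sum_i (dW (s i) (s j) 0 (s (i + 1)) (s (i - 1))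
  - dlog N i (space_part q) * W (s j) 0 (s (i + 1)) (s (i - 1)) q) = 0.
Proof.
exact: (magnetic_div (static_Gs0 Uq) (static_Gss Uq)
  (w := fun a b m v => W a b m v q) (dw := dW)
  (spin2_pair Uq) (spin2_anti Uq) (spin2_cyclic Uq) (spin2_trace0 Uq)
  spin2_partial_pair spin2_bianchi).
Qed.

End spin2_derivatives.

Lemma static_induced_metric x i j :
  induced_metric g t x i j = if i == j then p x ^+ 2 else 0.
Proof. by rewrite mxE gE (inj_eq lift_inj) /d /= space_part_event. Qed.

Let Ut x : U x -> U (space_part (event t x)).
Proof. by rewrite space_part_event. Qed.

Lemma spin2_slice_C1 a b m v : C1_on U (fun x => W a b m v (event t x)).
Proof. exact: (C1_on_comp oU (hW.1 a b m v) (fun i => C1_on_event t i oU) Ut). Qed.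

Lemma partial_spin2_slice i a b m v x : U x ->
  partial i (fun y => W a b m v (event t y)) x = partial (s i) (W a b m v) (event t x).
Proof. by move=> Ux; rewrite partial_on_slice //; exact: (hW.1 _ _ _ _ _ (Ut Ux)).1. Qed.

Let dN x (Ux : U x) := (CN Ux).1.
Let dp x (Ux : U x) := (Cp Ux).1.

Lemma static_electric_laws :
  conserved_charges (induced_metric g t) U (on_slice t (electric W n)).
Proof.
(* N^2 comes from the two normals and p^2 from raising an index; the coefficient 3 grad log p - c
   becomes grad log p - 2 grad log N, as in [electric_div]. *)
apply: (@rescaled_laws (fun x => N x * N x * (p x * p x))
  (fun i x => 2 * dlog N i x + 2 * dlog p i x)
  (fun i j x => W (s i) 0 0 (s j) (event t x))).
- exact: (C1_onM oU (C1_onM oU CN CN) (C1_onM oU Cp Cp)).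
- by move=> x Ux; rewrite !mulf_neq0 ?N_neq0 ?p_neq0.
- by move=> i j; exact: spin2_slice_C1.
- move=> x i Ux.
  have N0 := N_neq0 Ux.
  have p0 := p_neq0 Ux.
  have dNN : differentiable (fun y => N y * N y) x := differentiableM (dN Ux) (dN Ux).
  have dpp : differentiable (fun y => p y * p y) x := differentiableM (dp Ux) (dp Ux).
  rewrite (partialM _ dNN dpp) (partialM _ (dN Ux) (dN Ux)) (partialM _ (dp Ux) (dp Ux)).
  rewrite /dlog; move: (N x) N0 (p x) p0 (partial i N x) (partial i p x) => *.
  by field; apply/andP.
- exact: static_induced_metric.
- move=> x i j Ux; rewrite /on_slice (static_electric (Ut Ux)) // space_part_event.
  have N0 := N_neq0 Ux.
  have p0 := p_neq0 Ux.
  move: (N x) N0 (p x) p0 (W _ _ _ _ _) => *.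
  by field; apply/andP.
- by move=> x i j Ux; rewrite (spin2_pair (Ut Ux)) (spin2_anti (Ut Ux))
    (spin2_pair (Ut Ux)) (spin2_anti (Ut Ux)) (spin2_pair (Ut Ux)) opprK.
- move=> x Ux; have := spin2_trace0 (Ut Ux) 0.
  move=> /(congr1 -%R); rewrite oppr0 -sumrN => e; rewrite -[RHS]e.
  apply: eq_bigr => i _.
  by rewrite (spin2_pair (Ut Ux)) (spin2_anti (Ut Ux)).
- move=> x j Ux; have := spin2_electric_div (Ut Ux) j; rewrite space_part_event => e.
  rewrite -[RHS]e; apply: eq_bigr => i _; rewrite partial_spin2_slice //.
  by congr (_ + _ * _); move: (dlog N i x) (dlog p i x) => *; ring.
Qed.

Lemma static_magnetic_laws :
  conserved_charges (induced_metric g t) U (on_slice t (magnetic g W n)).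
Proof.
have Hsym x i j (Ux : U x) := magnetic_sym (w := fun a b m v => W a b m v (event t x))
  (spin2_pair (Ut Ux)) (spin2_anti (Ut Ux)) (spin2_trace0 (Ut Ux)) i j.
(* The dual contributes N / p, the normals N^-2 and the raised index p^-2, so the weight is N p^3
   and the coefficient 3 grad log p - c is - grad log N. The differentiated index [i] sits in the
   dualised pair, as in [magnetic_div]; this is where the symmetry of the magnetic part is used. *)
apply: (@rescaled_laws (fun x => N x * (p x * p x * p x))
  (fun i x => dlog N i x + 3 * dlog p i x)
  (fun i j x => W (s j) 0 (s (i + 1)) (s (i - 1)) (event t x))).
- exact: (C1_onM oU CN (C1_onM oU (C1_onM oU Cp Cp) Cp)).
- by move=> x Ux; rewrite !mulf_neq0 ?N_neq0 ?p_neq0.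
- by move=> i j; exact: spin2_slice_C1.
- move=> x i Ux.
  have N0 := N_neq0 Ux.
  have p0 := p_neq0 Ux.
  have dpp : differentiable (fun y => p y * p y) x := differentiableM (dp Ux) (dp Ux).
  have dppp : differentiable (fun y => p y * p y * p y) x := differentiableM dpp (dp Ux).
  rewrite (partialM _ (dN Ux) dppp) (partialM _ dpp (dp Ux)) (partialM _ (dp Ux) (dp Ux)).
  rewrite /dlog; move: (N x) N0 (p x) p0 (partial i N x) (partial i p x) => *.
  by field; apply/andP.
- exact: static_induced_metric.
- move=> x i j Ux; rewrite /on_slice /magnetic (static_electric (Ut Ux)) //.
  have Wanti e f : W (s i) 0 e f (event t x) = - W (s i) 0 f e (event t x).
    by rewrite (spin2_pair (Ut Ux)) (spin2_anti (Ut Ux)) (spin2_pair (Ut Ux)).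
  rewrite (static_right_dual (Ut Ux) j Wanti) space_part_event (Hsym x i j Ux).
  have N0 := N_neq0 Ux.
  have p0 := p_neq0 Ux.
  move: (N x) N0 (p x) p0 (W _ _ _ _ _) => *.
  by field; apply/andP.
- by move=> x i j Ux; exact: (Hsym x j i Ux).
- move=> x Ux.
  exact: (magnetic_trace (w := fun a b m v => W a b m v (event t x))
    (spin2_anti (Ut Ux)) (spin2_cyclic (Ut Ux))).
- move=> x j Ux; have := spin2_magnetic_div (Ut Ux) j; rewrite space_part_event => e.
  rewrite -[RHS]e; apply: eq_bigr => i _; rewrite partial_spin2_slice //.
  move: (W _ _ _ _ _) (partial _ _ _) (dlog N i x) (dlog p i x) => *; ring.
Qed.

End static_spacetime.

(** * Schwarzschild slices *)

Section schwarzschild_slices.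
Context (R : realType) (M : R).
Implicit Types x : 'rV[R]_3.

Lemma C1_sum_sqr : C1_on setT (fun x : 'rV[R]_3 => \sum_i x 0 i ^+ 2).
Proof.
apply: (C1_on_sum openT) => i; under eq_fun do rewrite expr2.
exact: (C1_onM openT (C1_on_coord i) (C1_on_coord i)).
Qed.

Lemma rbar_gt0E :
  [set x : 'rV[R]_3 | 0 < rbar x] = [set x : 'rV[R]_3 | 0 < \sum_i x 0 i ^+ 2].
Proof. by apply/funext => x; rewrite /rbar /= sqrtr_gt0. Qed.

Lemma open_rbar_gt0 : open [set x : 'rV[R]_3 | 0 < rbar x].
Proof.
rewrite rbar_gt0E.
apply: (@open_comp _ _ (fun x : 'rV[R]_3 => \sum_i x 0 i ^+ 2) [set r | 0 < r]).
  by move=> x _; exact: C1_on_continuous C1_sum_sqr I.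
exact: open_gt.
Qed.

Lemma C1_rbar : C1_on [set x | 0 < rbar x] (@rbar R).
Proof.
have o := open_rbar_gt0; rewrite rbar_gt0E in o *.
exact: (C1_on_sqrt o (C1_onS (fun _ _ => I) C1_sum_sqr) (fun x => id)).
Qed.

(** Both signs occur: [k = M] yields the spatial metric and the denominator of the lapse, [k = - M]
    its numerator. *)
Definition potential (k : R) x : R := 1 + k * (2 * rbar x)^-1.

Lemma C1_potential k : C1_on [set x | 0 < rbar x] (potential k).
Proof.
have o := open_rbar_gt0.
have C2 : C1_on [set x | 0 < rbar x] (fun x => 2 * rbar x).
  exact: (C1_onM o (C1_on_cst 2) C1_rbar).
have CV := C1_onV o C2 (fun x r => lt0r_neq0 (mulr_gt0 (ltr0Sn _ 1) r)).
exact: (C1_onD o (C1_on_cst 1) (C1_onM o (C1_on_cst k) CV)).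
Qed.

Lemma SigmaE : Sigma M = [set x | 0 < rbar x] `&`
  [set x | potential M x != 0] `&` [set x | potential (- M) x != 0].
Proof.
apply/seteqP; split=> x.
  by move=> [r0 a b]; split; [split|]; rewrite //= /potential mulNr.
by move=> [[r0 a] b]; split; rewrite //; move: b; rewrite /= /potential mulNr.
Qed.

Lemma open_Sigma : open (Sigma M).
Proof.
rewrite SigmaE openE => x [[r0 a] b].
have near0 k : potential k x != 0 -> \forall y \near x, potential k y != 0.
  have c : {for x, continuous (potential k)} := C1_on_continuous (C1_potential k) r0.
  by move=> k0; exact: (cvgr_neq0 _ c k0).
have nr := near_open open_rbar_gt0 r0 (fun y => id).
by apply: filterI; [apply: filterI nr _; exact: near0|exact: near0].
Qed.

Lemma C1_potential_Sigma k : C1_on (Sigma M) (potential k).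
Proof. by apply: C1_onS (C1_potential k) => x; case. Qed.

(* The quotient is negative inside the horizon sphere, hence the square root. *)
Definition lapse x : R := Num.sqrt ((potential (- M) x / potential M x) ^+ 2).

Lemma potential_neq0 x : Sigma M x -> potential M x != 0 /\ potential (- M) x != 0.
Proof. by rewrite SigmaE => -[[]]. Qed.

Lemma lapse_arg_gt0 x : Sigma M x -> 0 < (potential (- M) x / potential M x) ^+ 2.
Proof.
move=> /potential_neq0[a b]; rewrite lt_neqAle sqr_ge0 andbT eq_sym sqrf_eq0.
by rewrite mulf_neq0 // invr_eq0.
Qed.

Lemma lapse_gt0 x : Sigma M x -> 0 < lapse x.
Proof. by move=> Sx; rewrite sqrtr_gt0 lapse_arg_gt0. Qed.

Lemma C1_lapse : C1_on (Sigma M) lapse.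
Proof.
apply: (C1_on_sqrt open_Sigma _ lapse_arg_gt0); under eq_fun do rewrite expr2.
have Cr := C1_onM open_Sigma (C1_potential_Sigma (- M))
  (C1_onV open_Sigma (C1_potential_Sigma M) (fun x Sx => (potential_neq0 Sx).1)).
exact: (C1_onM open_Sigma Cr Cr).
Qed.

(** The square serves as the factor p, since for negative [M] the potential itself can be negative;
    the metric coefficient p^2 is its fourth power. *)
Lemma C1_conformal_factor : C1_on (Sigma M) (fun x => potential M x ^+ 2).
Proof.
under eq_fun do rewrite expr2.
exact: (C1_onM open_Sigma (C1_potential_Sigma M) (C1_potential_Sigma M)).
Qed.

Lemma conformal_factor_gt0 x : Sigma M x -> 0 < potential M x ^+ 2.
Proof. by move=> /potential_neq0[a _]; rewrite lt_neqAle sqr_ge0 andbT eq_sym sqrf_eq0. Qed.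

Lemma schwarzschild_static q a b : schwarzschild M q a b =
  if a == b then (if a == 0 then - lapse (space_part q) ^+ 2
                  else (potential M (space_part q) ^+ 2) ^+ 2)
  else 0.
Proof.
rewrite mxE /lapse sqr_sqrtr ?sqr_ge0 // /potential mulNr -exprM.
by [].
Qed.

End schwarzschild_slices.

Unset Implicit Arguments.

Theorem mainTheorem3 (R : realType) (M : R)
    (W : 'I_4 -> 'I_4 -> 'I_4 -> 'I_4 -> 'rV[R]_4 -> R)
    (n : 'I_4 -> 'rV[R]_4 -> R)
    (hW : spin2_field (schwarzschild M) (spacetime M) W)
    (hn : unit_normal_to_slices (schwarzschild M) (spacetime M) n)
    (t : R) :
  let h := induced_metric (schwarzschild M) t in
  let E := on_slice t (electric W n) in
  let H := on_slice t (magnetic (schwarzschild M) W n) in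
  [/\ (forall x, Sigma M x -> forall j, div_mixed h (raise_first h E) j x = 0),
      (forall x, Sigma M x -> forall j, div_mixed h (raise_first h H) j x = 0)
    & forall X : 'I_3 -> 'rV[R]_3 -> R, conformal_killing h (Sigma M) X ->
        [/\ (forall x, Sigma M x -> div_vector h (current h E X) x = 0),
            (forall x, Sigma M x -> div_vector h (current h H X) x = 0),
            gauss_law h (Sigma M) E X /\ gauss_law h (Sigma M) H X
          & surface_independence h (Sigma M) E X /\
            surface_independence h (Sigma M) H X]].
Proof.
move=> h E H.
have [divE chargeE] := static_electric_laws (@open_Sigma R M) (@C1_lapse R M)
  (@C1_conformal_factor R M) (@lapse_gt0 R M)
  (@conformal_factor_gt0 R M) (@schwarzschild_static R M) t hW hn.
have [divH chargeH] := static_magnetic_laws (@open_Sigma R M) (@C1_lapse R M)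
  (@C1_conformal_factor R M) (@lapse_gt0 R M)
  (@conformal_factor_gt0 R M) (@schwarzschild_static R M) t hW hn.
split=> // X hX; have [cE gE sE] := chargeE X hX; have [cH gH sH] := chargeH X hX.
by split.
Qed.
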